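(* Assume (A1). Then for every $\delta>0$ there exists $\sigma>0$, independent of $\varepsilon$, such that $$|R(\lambda,\varepsilon)|=\mathcal O\big(e^{-\sigma/\varepsilon}\big)\qquad(\varepsilon\to0^+),$$ uniformly for $\lambda\in(-\infty,-\delta]\cup[\delta,\infty)$.
   Context: Let $\varepsilon>0$ be a small (semiclassical) parameter. For $\rho,\theta>0$ set $D(\rho,\theta)=\{x\in\mathbb C:\ |\mathrm{Im}\,x|<\max(\rho,(\tan\theta)|\mathrm{Re}\,x|)\}$. Assumption (A1): $A:\mathbb R\to\mathbb R$ is positive and smooth, extends holomorphically to $D_0=D(\rho_0,\theta_0)$ for some $\rho_0,\theta_0>0$, and there is $\tau>0$ with $A(x)=\mathcal O(|x|^{-1-\tau})$ as $|x|\to\infty$ in $D_0$. Consider the non-self-adjoint Dirac (Zakharov–Shabat) operator $L=\begin{pmatrix}-\frac{\varepsilon}{i}\frac{d}{dx} & -iA(x)\\ -iA(x) & \frac{\varepsilon}{i}\frac{d}{dx}\end{pmatrix}$ on $\mathbb C^2$-valued functions on $\mathbb R$. The equation $Lu=\lambda u$ is equivalent to $\frac{\varepsilon}{i}u'=M(x,\lambda)u$ with $M(x,\lambda)=\begin{pmatrix}-\lambda & -iA(x)\\ iA(x)&\lambda\end{pmatrix}$. Reflection coefficient: for real $\lambda\neq0$, the Jost solutions are the unique solutions with $f^r_+\sim(0,e^{i\lambda x/\varepsilon})^T$, $f^r_-\sim(e^{-i\lambda x/\varepsilon},0)^T$ as $x\to+\infty$, and $f^l_+\sim(0,e^{i\lambda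 x/\varepsilon})^T$, $f^l_-\sim(e^{-i\lambda x/\varepsilon},0)^T$ as $x\to-\infty$. Writing $(f^l_+,f^l_-)=(f^r_+,f^r_-)\begin{pmatrix}a & \bar b\\ b&\bar a\end{pmatrix}$, the reflection coefficient is $R(\lambda,\varepsilon)=b(\lambda,\varepsilon)/a(\lambda,\varepsilon)$. *)

(* Defs.v *)
From Stdlib Require Import Reals Lra.
Open Scope R_scope.

Record Cx := mkC { Cre : R; Cim : R }.

Definition RtoC (x : R) : Cx := mkC x 0.
Definition C0 : Cx := RtoC 0.
Definition Ci : Cx := mkC 0 1.
Definition Cadd (z w : Cx) : Cx := mkC (Cre z + Cre w) (Cim z + Cim w).
Definition Copp (z : Cx) : Cx := mkC (- Cre z) (- Cim z).
Definition Csub (z w : Cx) : Cx := Cadd z (Copp w).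
Definition Cmul (z w : Cx) : Cx :=
  mkC (Cre z * Cre w - Cim z * Cim w) (Cre z * Cim w + Cim z * Cre w).
Definition Cmod (z : Cx) : R := sqrt (Cre z ^ 2 + Cim z ^ 2).
(* inverse; Cinv 0 = 0 (total convention, as for Rinv) *)
Definition Cinv (z : Cx) : Cx :=
  mkC (Cre z / (Cre z ^ 2 + Cim z ^ 2)) (- Cim z / (Cre z ^ 2 + Cim z ^ 2)).
Definition Cdiv (z w : Cx) : Cx := Cmul z (Cinv w).
Definition Cexpi (t : R) : Cx := mkC (cos t) (sin t).

Definition C_differentiable_at (F : Cx -> Cx) (z : Cx) : Prop :=
  exists l : Cx, forall e, 0 < e -> exists d, 0 < d /\
    forall h : Cx, h <> C0 -> Cmod h < d ->
      Cmod (Csub (Cdiv (Csub (F (Cadd z h)) (F z)) h) l) < e.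

Definition holomorphic_on (D : Cx -> Prop) (F : Cx -> Cx) : Prop :=
  forall z, D z -> C_differentiable_at F z.

Definition Dsector (rho theta : R) (z : Cx) : Prop :=
  Rabs (Cim z) < Rmax rho (tan theta * Rabs (Cre z)).

Definition smooth (f : R -> R) : Prop :=
  exists fn : nat -> R -> R, fn 0%nat = f /\
    forall n x, derivable_pt_lim (fn n) x (fn (S n) x).

Definition assumption_A1 (A : R -> R) : Prop :=
  (forall x, 0 < A x) /\ smooth A /\
  exists rho0 theta0 tau : R, 0 < rho0 /\ 0 < theta0 /\ 0 < tau /\
  exists F : Cx -> Cx,
    holomorphic_on (Dsector rho0 theta0) F /\
    (forall x : R, F (RtoC x) = RtoC (A x)) /\
    exists K R0, 0 < R0 /\ forall z, Dsector rho0 theta0 z -> R0 <= Cmod z ->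
      Cmod (F z) <= K * Rpower (Cmod z) (-1 - tau).

Definition Cderiv_real (f : R -> Cx) (x : R) (l : Cx) : Prop :=
  derivable_pt_lim (fun t => Cre (f t)) x (Cre l) /\
  derivable_pt_lim (fun t => Cim (f t)) x (Cim l).

(* u solves (eps/i) u' = M(x,lambda) u,  M = [[-lam, -iA],[iA, lam]] *)
Definition ZS_solution (A : R -> R) (eps lam : R) (u : R -> Cx * Cx) : Prop :=
  forall x, exists d1 d2 : Cx,
    Cderiv_real (fun t => fst (u t)) x d1 /\
    Cderiv_real (fun t => snd (u t)) x d2 /\
    Cmul (Cdiv (RtoC eps) Ci) d1 =
      Cadd (Cmul (RtoC (- lam)) (fst (u x)))
           (Cmul (Cmul (Copp Ci) (RtoC (A x))) (snd (u x))) /\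
    Cmul (Cdiv (RtoC eps) Ci) d2 =
      Cadd (Cmul (Cmul Ci (RtoC (A x))) (fst (u x)))
           (Cmul (RtoC lam) (snd (u x))).

Definition asymp_plus (u v : R -> Cx * Cx) : Prop :=
  forall e, 0 < e -> exists X, forall x, X <= x ->
    Cmod (Csub (fst (u x)) (fst (v x))) < e /\
    Cmod (Csub (snd (u x)) (snd (v x))) < e.
Definition asymp_minus (u v : R -> Cx * Cx) : Prop :=
  forall e, 0 < e -> exists X, forall x, x <= X ->
    Cmod (Csub (fst (u x)) (fst (v x))) < e /\
    Cmod (Csub (snd (u x)) (snd (v x))) < e.

Definition jost_plus (eps lam : R) : R -> Cx * Cx :=
  fun x => (C0, Cexpi (lam * x / eps)).
Definition jost_minus (eps lam : R) : R -> Cx * Cx :=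
  fun x => (Cexpi (- (lam * x / eps)), C0).

(* Main.v *)
Require Import Defs.
From Stdlib Require Import Reals Lra Lia Psatz Factorial ClassicalEpsilon.
From Coquelicot Require Import Rcomplements Rbar Hierarchy Continuity Derive RInt RInt_analysis
  Lim_seq Series PSeries ElemFct AutoDerive.
From Coquelicot Require Complex.
Open Scope R_scope.

(** The Jost solution u normalised at -oo is extended holomorphically to a thin
    strip and followed along the curve z(x) = x + i y(x), y = y0 lam / mu(x),
    mu = sqrt (lam^2 + A^2), which to first order in y0 is a level line of
    Im (int mu).  On the real axis |u|^2 is conserved.  On the curve the
    quantity |v1|^2 + |v2|^2 + kap Re (v1 conj v2), for v = u o z and a real
    kap = O(y0), has logarithmic derivative O(1 + y0^2 / eps) times an
    integrable function, because all terms of order y0 / eps cancel.  At -oo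
    this quantity is about exp (- 2 y0 |lam| / eps), and at +oo the reflected
    component contributes |b|^2 exp (2 y0 |lam| / eps).  Hence
    |b|^2 = O(exp ((- 4 y0 |lam| + K y0^2) / eps)), which is exponentially small
    for y0 small, and |a|^2 + |b|^2 = 1.  For theta0 > pi/2 the domain of A may be
    no more than the strip |Im x| < rho0, and only this strip is used. *)

(** * Bisection *)

(** The curve and kap come from one elimination. Up to O(y0^2), the factors of |v1|^2 - |v2|^2 and
    of Im (v1 conj v2) in the derivative of the energy are 2 lam y' - kap A and 4 (A y)' + 2 kap
    lam. If both vanish, then lam^2 y' + A (A y)' = 0, that is (mu y)' = 0, so y is a multiple of 1
    / mu. The factor lam in y makes lam y positive for both signs of lam, so that v1 is amplified
    and v2 damped at both ends. Only the constants of the energy estimate have to be independent of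
    eps and lam. The bounds on the extension and on its distance from the free evolution may depend
    on both, because they serve only to choose points far to the left and to the right for fixed eps
    and lam. The extension can therefore be the crude one: a Taylor series at every real point, with
    coefficients given by the recursion of the equation. What matters is that these series share the
    radius r / 2, which does not depend on eps or lam. The Taylor coefficients of A need a bound
    that also decays in x; Cauchy's formula on circles of fixed radius gives it, and is derived here
    from Goursat's bisection argument. *)

Definition quadrant (Q : R -> R -> R -> Prop) (k : R) (s : R * R * R) : R * R * R :=
  let '(a, c, l) := s in
  if excluded_middle_informative (Q a c (l / 2)) then
    if excluded_middle_informative (Q (a + l / 2) c (l / 2)) then
      if excluded_middle_informative (Q a (c + k * (l / 2)) (l / 2)) then
        (a + l / 2, c + k * (l / 2), l / 2)
      else (a, c + k * (l / 2), l / 2)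
    else (a + l / 2, c, l / 2)
  else (a, c, l / 2).

(* Only rectangles [a, a+l] x [c, c+kl] of one shape occur, so that squared
   diameters are comparable to areas when this is applied to Goursat's lemma. *)
Lemma rect_induction (k : R) (Q : R -> R -> R -> Prop) (a0 c0 l0 : R) :
  0 < k -> 0 < l0 ->
  (forall a c l, 0 < l -> a0 <= a -> a + l <= a0 + l0 -> c0 <= c -> c + k * l <= c0 + k * l0 ->
     Q a c (l / 2) -> Q (a + l / 2) c (l / 2) -> Q a (c + k * (l / 2)) (l / 2) ->
     Q (a + l / 2) (c + k * (l / 2)) (l / 2) -> Q a c l) ->
  (forall x y, a0 <= x <= a0 + l0 -> c0 <= y <= c0 + k * l0 ->
     exists d, 0 < d /\ forall a c l, 0 < l < d ->
       a0 <= a -> a + l <= a0 + l0 -> c0 <= c -> c + k * l <= c0 + k * l0 ->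
       a <= x <= a + l -> c <= y <= c + k * l -> Q a c l) ->
  Q a0 c0 l0.
Proof.
  intros Hk Hl0 Hglue Hloc. apply NNPP. intros HQ0.
  set (s := fun n => Nat.iter n (quadrant Q k) (a0, c0, l0)).
  set (an := fun n => fst (fst (s n))). set (cn := fun n => snd (fst (s n))).
  set (ln := fun n => snd (s n)).
  assert (Hs : forall n, 0 < ln n /\ a0 <= an n /\ an n + ln n <= a0 + l0 /\
      c0 <= cn n /\ cn n + k * ln n <= c0 + k * l0 /\ ~ Q (an n) (cn n) (ln n) /\
      ln n = l0 / 2 ^ n).
  { induction n as [|n IH].
    - unfold ln, an, cn; simpl. repeat split; try lra; try assumption.
    - destruct IH as (H1 & H2 & H3 & H4 & H5 & H6 & H7).
      assert (E : s (S n) = quadrant Q k (s n)) by reflexivity.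
      unfold ln, an, cn in *. rewrite E. destruct (s n) as [[a c] l]. simpl in *.
      assert (Hkl : 0 < k * l) by (apply Rmult_lt_0_compat; lra).
      assert (Hl2 : l / 2 = l0 / (2 * 2 ^ n)).
      { rewrite H7. field. apply pow_nonzero; lra. }
      destruct (excluded_middle_informative (Q a c (l / 2))) as [q1|q1]; simpl.
      2:{ repeat split; try assumption; lra. }
      destruct (excluded_middle_informative (Q (a + l / 2) c (l / 2))) as [q2|q2]; simpl.
      2:{ repeat split; try assumption; lra. }
      destruct (excluded_middle_informative (Q a (c + k * (l / 2)) (l / 2))) as [q3|q3]; simpl.
      2:{ repeat split; try assumption; lra. }
      repeat split; try assumption; try lra.
      (* The fourth quarter is selected without a test: if Q held there as well, gluing would give Q
         on the parent. *)
      intros q4. apply H6. apply Hglue; assumption. }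
  assert (Hstep : forall n, an n <= an (S n) /\ an (S n) + ln (S n) <= an n + ln n /\
      cn n <= cn (S n) /\ cn (S n) + k * ln (S n) <= cn n + k * ln n).
  { intros n. destruct (Hs n) as (H1 & _).
    assert (E : s (S n) = quadrant Q k (s n)) by reflexivity.
    unfold ln, an, cn in *. rewrite E. destruct (s n) as [[a c] l]. simpl in *.
    assert (Hkl : 0 < k * l) by (apply Rmult_lt_0_compat; lra).
    repeat destruct excluded_middle_informative; simpl; repeat split; lra. }
  assert (Hnest : forall n m, an n <= an (n + m)%nat /\ an (n + m)%nat + ln (n + m)%nat <= an n + ln n /\
      cn n <= cn (n + m)%nat /\ cn (n + m)%nat + k * ln (n + m)%nat <= cn n + k * ln n).
  { intros n m. induction m as [|m IH].
    - rewrite Nat.add_0_r. lra.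
    - rewrite Nat.add_succ_r. generalize (Hstep (n + m)%nat). lra. }
  (* Every left end lies below every right end, so the suprema of the left and of the lower ends
     belong to all the rectangles. *)
  assert (Hcross : forall n m, an n <= an m + ln m /\ cn n <= cn m + k * ln m).
  { intros n m. destruct (Nat.le_ge_cases n m) as [H|H].
    - replace m with (n + (m - n))%nat by lia.
      destruct (Hnest n (m - n)%nat) as (h1 & h2 & h3 & h4).
      destruct (Hs (n + (m - n))%nat) as (h5 & _).
      assert (0 < k * ln (n + (m - n))%nat) by (apply Rmult_lt_0_compat; lra). lra.
    - replace n with (m + (n - m))%nat by lia.
      destruct (Hnest m (n - m)%nat) as (h1 & h2 & h3 & h4).
      destruct (Hs (m + (n - m))%nat) as (h5 & _).
      assert (0 < k * ln (m + (n - m))%nat) by (apply Rmult_lt_0_compat; lra). lra. }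
  destruct (completeness (fun z => exists n, z = an n)) as [x [Hx1 Hx2]].
  { exists (an 0%nat + ln 0%nat). intros z [n ->]. apply Hcross. }
  { exists (an 0%nat). now exists 0%nat. }
  destruct (completeness (fun z => exists n, z = cn n)) as [y [Hy1 Hy2]].
  { exists (cn 0%nat + k * ln 0%nat). intros z [n ->]. apply Hcross. }
  { exists (cn 0%nat). now exists 0%nat. }
  assert (Hx : forall n, an n <= x <= an n + ln n).
  { intros n; split; [apply Hx1; now exists n|]. apply Hx2. intros z [m ->]. apply Hcross. }
  assert (Hy : forall n, cn n <= y <= cn n + k * ln n).
  { intros n; split; [apply Hy1; now exists n|]. apply Hy2. intros z [m ->]. apply Hcross. }
  destruct (Hloc x y) as [d [Hd Hd']].
  { apply (Hx 0%nat). } { apply (Hy 0%nat). }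
  destruct (pow_lt_1_zero (/ 2)) with (y := d / l0) as [N HN].
  { rewrite Rabs_pos_eq; lra. }
  { apply Rdiv_lt_0_compat; lra. }
  specialize (HN N (Nat.le_refl _)).
  destruct (Hs N) as (H1 & H2 & H3 & H4 & H5 & H6 & H7).
  apply H6. apply Hd'; auto. split; [assumption|].
  rewrite H7. rewrite Rabs_pos_eq in HN by (apply pow_le; lra).
  rewrite pow_inv in HN. apply Rmult_lt_compat_r with (r := l0) in HN; [|lra].
  unfold Rdiv in *. rewrite Rmult_assoc, Rinv_l, Rmult_1_r in HN by lra. lra.
Qed.

(* P + iQ is complex differentiable at x + iy, with derivative br + i bi. *)
Definition holo_at (P Q : R -> R -> R) (x y : R) : Prop :=
  exists br bi, forall e, 0 < e -> exists d, 0 < d /\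
    forall u v, Rabs u < d -> Rabs v < d ->
      Rabs (P (x + u) (y + v) - P x y - (br * u - bi * v)) <= e * (Rabs u + Rabs v) /\
      Rabs (Q (x + u) (y + v) - Q x y - (br * v + bi * u)) <= e * (Rabs u + Rabs v).

Lemma Rabs_le_shift (x l e f : R) : Rabs (x - l) <= e -> Rabs l <= f -> Rabs x <= e + f.
Proof. intros H1 H2. replace x with ((x - l) + l) by ring. generalize (Rabs_triang (x - l) l). lra. Qed.

Lemma holo_cont P Q x y : holo_at P Q x y ->
  forall e, 0 < e -> exists d, 0 < d /\ forall u v, Rabs u < d -> Rabs v < d ->
    Rabs (P (x + u) (y + v) - P x y) < e /\ Rabs (Q (x + u) (y + v) - Q x y) < e.
Proof.
  intros (br & bi & H) e He. destruct (H 1 Rlt_0_1) as (d & Hd & Hd').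
  (* The remainder at tolerance 1 contributes 2 and the linear part |br| + |bi|, each per unit of
     max (|u|, |v|). *)
  set (B := 2 + Rabs br + Rabs bi).
  assert (HB : 0 < B) by (unfold B; generalize (Rabs_pos br) (Rabs_pos bi); lra).
  exists (Rmin d (e / (3 * B))). split.
  { apply Rmin_glb_lt; [lra|]. apply Rdiv_lt_0_compat; lra. }
  intros u v Hu Hv.
  assert (Hu1 := Rlt_le_trans _ _ _ Hu (Rmin_l _ _)).
  assert (Hv1 := Rlt_le_trans _ _ _ Hv (Rmin_l _ _)).
  assert (Hu2 := Rlt_le_trans _ _ _ Hu (Rmin_r _ _)).
  assert (Hv2 := Rlt_le_trans _ _ _ Hv (Rmin_r _ _)).
  destruct (Hd' u v Hu1 Hv1) as [h1 h2]. rewrite Rmult_1_l in h1, h2.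
  set (w := e / (3 * B)) in *.
  assert (Hw : B * w = e / 3) by (unfold w; field; lra).
  assert (a1 : Rabs (br * u) <= Rabs br * w) by (rewrite Rabs_mult; apply Rmult_le_compat_l; [apply Rabs_pos|lra]).
  assert (a2 : Rabs (bi * v) <= Rabs bi * w) by (rewrite Rabs_mult; apply Rmult_le_compat_l; [apply Rabs_pos|lra]).
  assert (a3 : Rabs (br * v) <= Rabs br * w) by (rewrite Rabs_mult; apply Rmult_le_compat_l; [apply Rabs_pos|lra]).
  assert (a4 : Rabs (bi * u) <= Rabs bi * w) by (rewrite Rabs_mult; apply Rmult_le_compat_l; [apply Rabs_pos|lra]).
  unfold B in Hw.
  assert (Rabs (br * u - bi * v) <= Rabs (br * u) + Rabs (bi * v)) by (unfold Rminus; rewrite <- (Rabs_Ropp (bi * v)); apply Rabs_triang).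
  assert (Rabs (br * v + bi * u) <= Rabs (br * v) + Rabs (bi * u)) by apply Rabs_triang.
  split.
  - assert (hh := Rabs_le_shift _ _ _ _ h1 (Rle_refl _)). lra.
  - assert (hh := Rabs_le_shift _ _ _ _ h2 (Rle_refl _)). lra.
Qed.

(** Compactness through [rect_induction]: a bound passes from four quarters to their union, and
    continuity gives one near each point. *)
Lemma holo_bounded P Q a b c d : a < b -> c < d ->
  (forall x y, a <= x <= b -> c <= y <= d -> holo_at P Q x y) ->
  exists M, 0 <= M /\ forall x y, a <= x <= b -> c <= y <= d -> Rabs (P x y) <= M /\ Rabs (Q x y) <= M.
Proof.
  intros Hab Hcd H.
  set (k := (d - c) / (b - a)).
  assert (Hk : 0 < k) by (apply Rdiv_lt_0_compat; lra).
  assert (Ek : c + k * (b - a) = d) by (unfold k; field; lra).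
  set (bnd := fun a c l => exists M, forall x y, a <= x <= a + l -> c <= y <= c + k * l ->
      Rabs (P x y) <= M /\ Rabs (Q x y) <= M).
  assert (G : bnd a c (b - a)).
  { apply (rect_induction k bnd); unfold bnd; [lra|lra| |].
    - intros a' c' l Hl _ _ _ _ [M1 h1] [M2 h2] [M3 h3] [M4 h4].
      exists (Rmax (Rmax M1 M2) (Rmax M3 M4)). intros x y Hx Hy.
      assert (HH : forall M, M = M1 \/ M = M2 \/ M = M3 \/ M = M4 -> M <= Rmax (Rmax M1 M2) (Rmax M3 M4)).
      { intros M [->| [->| [->| ->]]]; unfold Rmax; repeat destruct Rle_dec; lra. }
      assert (k * l = k * (l / 2) + k * (l / 2)) by field.
      destruct (Rle_dec x (a' + l / 2)); destruct (Rle_dec y (c' + k * (l / 2))).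
      + destruct (h1 x y); [lra|lra|]. assert (hh := HH M1). lra.
      + destruct (h3 x y); [lra|lra|]. assert (hh := HH M3). lra.
      + destruct (h2 x y); [lra|lra|]. assert (hh := HH M2). lra.
      + destruct (h4 x y); [lra|lra|]. assert (hh := HH M4). lra.
    - intros x y Hx Hy.
      destruct (holo_cont P Q x y (H x y ltac:(lra) ltac:(lra)) 1 Rlt_0_1) as (e & He & He').
      exists (Rmin e (e / k)). split.
      { apply Rmin_glb_lt; [lra|]. apply Rdiv_lt_0_compat; lra. }
      intros a' c' l Hl _ _ _ _ Hx' Hy'. exists (Rabs (P x y) + Rabs (Q x y) + 1).
      intros x1 y1 Hx1 Hy1.
      assert (l1 := Rlt_le_trans _ _ _ (proj2 Hl) (Rmin_l _ _)).
      assert (l2 := Rlt_le_trans _ _ _ (proj2 Hl) (Rmin_r _ _)).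
      assert (l3 : k * l < e).
      { apply Rmult_lt_compat_l with (r := k) in l2; [|lra].
        replace (k * (e / k)) with e in l2 by (field; lra). lra. }
      destruct (He' (x1 - x) (y1 - y)) as [h1 h2].
      { apply Rabs_def1; lra. } { apply Rabs_def1; lra. }
      replace (x + (x1 - x)) with x1 in h1, h2 by ring.
      replace (y + (y1 - y)) with y1 in h1, h2 by ring.
      generalize (Rabs_pos (P x y)) (Rabs_pos (Q x y)). intros p1 p2.
      assert (h3 := Rabs_le_shift _ _ _ _ (Rlt_le _ _ h1) (Rle_refl _)).
      assert (h4 := Rabs_le_shift _ _ _ _ (Rlt_le _ _ h2) (Rle_refl _)).
      split; lra. }
  destruct G as [M G]. exists (Rmax 0 M). split; [apply Rmax_l|].
  intros x y Hx Hy. destruct (G x y); [lra|lra|]. generalize (Rmax_r 0 M). lra.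
Qed.

(** * Cauchy estimates *)

Lemma continuous_Rminus (f g : R -> R) x :
  continuous f x -> continuous g x -> continuous (fun t => f t - g t) x.
Proof. exact (@continuous_minus _ R_AbsRing R_NormedModule f g x). Qed.

Lemma continuous_Rmult (f g : R -> R) x :
  continuous f x -> continuous g x -> continuous (fun t => f t * g t) x.
Proof. exact (@continuous_mult _ R_AbsRing f g x). Qed.

Lemma RInt_Rminus (f g : R -> R) a b : ex_RInt f a b -> ex_RInt g a b ->
  RInt (fun t => f t - g t) a b = RInt f a b - RInt g a b.
Proof. exact (@RInt_minus R_CompleteNormedModule f g a b). Qed.

(* Real and imaginary parts of 1 / (1 - s e^(-i th)). *)
Definition kap_re (s th : R) : R := (1 - s * cos th) / (1 - 2 * s * cos th + s ^ 2).
Definition kap_im (s th : R) : R := - (s * sin th) / (1 - 2 * s * cos th + s ^ 2).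

(** The denominator is |1 - s e^(-i th)|^2, which is at least (1 - |s|)^2. *)
Lemma kap_den s th : Rabs s <= 1 / 2 -> 1 / 4 <= 1 - 2 * s * cos th + s ^ 2.
Proof.
  intros Hs. generalize (sin2_cos2 th); unfold Rsqr; intros H.
  assert (Hc : -1 <= cos th <= 1) by apply COS_bound.
  apply Rabs_le_between in Hs.
  assert (s * cos th <= Rabs s).
  { generalize (Rle_abs (s * cos th)). rewrite Rabs_mult.
    assert (Rabs (cos th) <= 1) by (apply Rabs_le; lra).
    generalize (Rabs_pos s). nra. }
  assert (s ^ 2 = Rabs s ^ 2) by (rewrite pow2_abs; reflexivity).
  assert (Rabs s <= 1 / 2) by (apply Rabs_le; lra).
  generalize (Rabs_pos s). nra.
Qed.

(** This is kap = 1 + s e^(-i th) kap in real coordinates; iterated, it produces the geometric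
    series. *)
Lemma kap_eq s th : Rabs s <= 1 / 2 ->
  kap_re s th = 1 + s * (cos th * kap_re s th + sin th * kap_im s th) /\
  kap_im s th = s * (cos th * kap_im s th - sin th * kap_re s th).
Proof.
  intros Hs. generalize (kap_den s th Hs); intros Hd.
  generalize (sin2_cos2 th); unfold Rsqr; intros H.
  unfold kap_re, kap_im.
  set (d := 1 - 2 * s * cos th + s ^ 2) in *.
  split; apply Rmult_eq_reg_r with d; try lra; field_simplify; try lra; unfold d;
    replace (sin th ^ 2) with (1 - cos th ^ 2) by (rewrite <- H; ring); ring.
Qed.

Lemma kap_bound s th : Rabs s <= 1 / 2 -> Rabs (kap_re s th) <= 2 /\ Rabs (kap_im s th) <= 2.
Proof.
  intros Hs. generalize (kap_den s th Hs); intros Hd.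
  generalize (sin2_cos2 th); unfold Rsqr; intros H.
  assert (E : kap_re s th ^ 2 + kap_im s th ^ 2 = / (1 - 2 * s * cos th + s ^ 2)).
  { unfold kap_re, kap_im. set (d := 1 - 2 * s * cos th + s ^ 2) in *.
    apply Rmult_eq_reg_r with (d ^ 2); [|apply pow_nonzero; lra].
    field_simplify; try lra. unfold d.
    replace (sin th ^ 2) with (1 - cos th ^ 2) by (rewrite <- H; ring). ring. }
  assert (/ (1 - 2 * s * cos th + s ^ 2) <= 4).
  { replace 4 with (/ (1 / 4)) by field. apply Rinv_le_contravar; lra. }
  split; apply Rabs_le; nra.
Qed.

Lemma kap_continuous s th : Rabs s <= 1 / 2 ->
  continuous (kap_re s) th /\ continuous (kap_im s) th.
Proof.
  intros Hs. generalize (kap_den s th Hs); intros Hd.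
  split; apply (ex_derive_continuous (V := R_NormedModule)); unfold kap_re, kap_im;
    auto_derive; simpl in *; lra.
Qed.

(* In the coordinates (t, th) -> e^t q(th), q(th) = r (e^(i th) - s), the form
   F dz / z is F dt + F (q'/q) dth; this is the real part of its
   integral, divided by i, around [t1, t2] x [th1, th2]. *)
Definition polar_circulation (fr fi : R -> R -> R) (s t1 t2 th1 th2 : R) : R :=
  RInt (fun th => (fr t2 th - fr t1 th) * kap_re s th - (fi t2 th - fi t1 th) * kap_im s th) th1 th2
  - RInt (fun t => fi t th2 - fi t th1) t1 t2.

(** Goursat's argument in logarithmic polar coordinates: the region between two circles becomes a
    rectangle, and contracting the circle becomes moving t to -oo. The derivative hypothesis
    compares F with the increments of g, while its error is measured in (t, th), the coordinates
    that are bisected. *)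
Lemma goursat_polar (fr fi : R -> R -> R) (r s T : R) :
  0 < r -> Rabs s <= 1 / 2 -> T < 0 ->
  let gr t th := exp t * (r * cos th - s * r) in
  let gi t th := exp t * (r * sin th) in
  (forall t th, T <= t <= 0 -> continuous (fr t) th /\ continuous (fi t) th) ->
  (forall t th, T <= t <= 0 -> continuous (fun t => fi t th) t) ->
  (forall t0 th0, T <= t0 <= 0 -> exists br bi, forall e, 0 < e -> exists d, 0 < d /\
    forall t th, Rabs (t - t0) < d -> Rabs (th - th0) < d ->
      Rabs (fr t th - fr t0 th0 - (br * (gr t th - gr t0 th0) - bi * (gi t th - gi t0 th0)))
        <= e * (Rabs (t - t0) + Rabs (th - th0)) /\
      Rabs (fi t th - fi t0 th0 - (br * (gi t th - gi t0 th0) + bi * (gr t th - gr t0 th0)))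
        <= e * (Rabs (t - t0) + Rabs (th - th0))) ->
  polar_circulation fr fi s T 0 0 (2 * PI) = 0.
Proof.
  intros Hr Hs HT gr gi Hc1 Hc2 Hloc.
  set (Phi := polar_circulation fr fi s).
  set (I1 := fun t1 t2 th => (fr t2 th - fr t1 th) * kap_re s th - (fi t2 th - fi t1 th) * kap_im s th).
  assert (X1 : forall t1 t2 a b, T <= t1 <= 0 -> T <= t2 <= 0 -> ex_RInt (I1 t1 t2) a b).
  { intros t1 t2 a b H1 H2. apply (ex_RInt_continuous (V := R_CompleteNormedModule)). intros z _.
    destruct (kap_continuous s z Hs). destruct (Hc1 t1 z H1). destruct (Hc1 t2 z H2).
    unfold I1. apply continuous_Rminus; apply continuous_Rmult; auto; apply continuous_Rminus; auto. }
  assert (X2 : forall th1 th2 a b, T <= a <= 0 -> T <= b <= 0 -> ex_RInt (fun t => fi t th2 - fi t th1) a b).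
  { intros th1 th2 a b Ha Hb. apply (ex_RInt_continuous (V := R_CompleteNormedModule)). intros z Hz.
    assert (T <= z <= 0).
    { destruct Hz as [z1 z2]. split; [apply Rle_trans with (2 := z1); apply Rmin_glb; lra|].
      apply Rle_trans with (1 := z2); apply Rmax_lub; lra. }
    apply continuous_Rminus; auto. }
  assert (Add : forall a b c t1 t2 t3, T <= t1 <= 0 -> T <= t2 <= 0 -> T <= t3 <= 0 ->
     Phi t1 t3 a c = Phi t1 t2 a b + Phi t2 t3 a b + Phi t1 t2 b c + Phi t2 t3 b c).
  { intros a b c t1 t2 t3 H1 H2 H3. unfold Phi, polar_circulation.
    fold (I1 t1 t3) (I1 t1 t2) (I1 t2 t3).
    assert (E : forall u v, RInt (I1 t1 t3) u v = RInt (I1 t1 t2) u v + RInt (I1 t2 t3) u v).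
    { intros u v. rewrite <- (RInt_plus (V := R_CompleteNormedModule)); auto.
      apply RInt_ext. intros z _. unfold I1, plus; simpl. ring. }
    rewrite !E.
    rewrite <- (RInt_Chasles (I1 t1 t2) a b c), <- (RInt_Chasles (I1 t2 t3) a b c) by auto.
    assert (E2 : forall u v, RInt (fun t => fi t c - fi t a) u v = RInt (fun t => fi t c - fi t b) u v + RInt (fun t => fi t b - fi t a) u v
       \/ ~ (T <= u <= 0 /\ T <= v <= 0)).
    { intros u v. destruct (classic (T <= u <= 0 /\ T <= v <= 0)) as [[Hu Hv]|Hn]; [left|right; assumption].
      rewrite <- (RInt_plus (V := R_CompleteNormedModule)); auto.
      apply RInt_ext. intros z _. unfold plus; simpl. ring. }
    rewrite <- (RInt_Chasles (fun t => fi t c - fi t a) t1 t2 t3) by auto.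
    destruct (E2 t1 t2) as [-> |]; [|tauto].
    destruct (E2 t2 t3) as [-> |]; [|tauto]. unfold plus; simpl. ring. }
  apply cond_eq. intros e He.
  set (k := 2 * PI / - T).
  assert (HPI := PI_RGT_0).
  assert (Hk : 0 < k) by (apply Rdiv_lt_0_compat; lra).
  assert (EkT : k * - T = 2 * PI) by (unfold k; field; lra).
  (* With this [e1] the bound e1 l^2 equals e / 2 on the full rectangle, where l = - T. *)
  set (e1 := e / (2 * (- T) ^ 2)).
  assert (He1 : 0 < e1).
  { apply Rdiv_lt_0_compat; [lra|]. assert (0 < (- T) ^ 2) by (apply pow_lt; lra). lra. }
  set (small := fun a c l => Rabs (Phi a (a + l) c (c + k * l)) <= e1 * l ^ 2).
  assert (G : small T 0 (- T)).
  { apply (rect_induction k small); [lra|lra| |].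
    - intros a c l Hl Ha Hal Hc Hcl h1 h2 h3 h4. unfold small in *.
      rewrite (Add c (c + k * (l / 2)) (c + k * l) a (a + l / 2) (a + l)) by lra.
      replace (a + l / 2 + l / 2) with (a + l) in * by field.
      replace (c + k * (l / 2) + k * (l / 2)) with (c + k * l) in * by field.
      eapply Rle_trans; [apply Rabs_triang|].
      assert (h := Rabs_triang (Phi a (a + l / 2) c (c + k * (l / 2)) + Phi (a + l / 2) (a + l) c (c + k * (l / 2))) (Phi a (a + l / 2) (c + k * (l / 2)) (c + k * l))).
      assert (h' := Rabs_triang (Phi a (a + l / 2) c (c + k * (l / 2))) (Phi (a + l / 2) (a + l) c (c + k * (l / 2)))).
      replace (e1 * l ^ 2) with (4 * (e1 * (l / 2) ^ 2)) by field. lra.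
    - intros t0 th0 Ht0 Hth0.
      destruct (Hloc t0 th0) as (br & bi & Hd); [lra|].
      (* The th-sides have length k l and integrand at most 8 m, the t-sides length l and integrand
         at most 2 m, where m = e2 (1 + k) l. This [e2] makes the total equal to e1 l^2. *)
      set (e2 := e1 / ((1 + k) * (8 * k + 2))).
      assert (He2 : 0 < e2) by (apply Rdiv_lt_0_compat; nra).
      destruct (Hd e2 He2) as (d & Hd0 & Hd1).
      exists (Rmin d (d / k)). split.
      { apply Rmin_glb_lt; [lra|]. apply Rdiv_lt_0_compat; lra. }
      intros a c l Hl Ha Hal Hc Hcl Hin1 Hin2.
      assert (l1 := Rlt_le_trans _ _ _ (proj2 Hl) (Rmin_l _ _)).
      assert (l2 := Rlt_le_trans _ _ _ (proj2 Hl) (Rmin_r _ _)).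
      assert (l3 : k * l < d).
      { apply Rmult_lt_compat_l with (r := k) in l2; [|lra].
        replace (k * (d / k)) with d in l2 by (field; lra). lra. }
      assert (Hkl : 0 < k * l) by (apply Rmult_lt_0_compat; lra).
      set (rr := fun t th => fr t th - fr t0 th0 - (br * (gr t th - gr t0 th0) - bi * (gi t th - gi t0 th0))).
      set (ri := fun t th => fi t th - fi t0 th0 - (br * (gi t th - gi t0 th0) + bi * (gr t th - gr t0 th0))).
      set (m := e2 * ((1 + k) * l)).
      assert (Hm : forall t th, a <= t <= a + l -> c <= th <= c + k * l -> Rabs (rr t th) <= m /\ Rabs (ri t th) <= m).
      { intros t th Ht Hth. destruct (Hd1 t th) as [q1 q2].
        { apply Rabs_def1; lra. } { apply Rabs_def1; lra. }
        assert (Rabs (t - t0) <= l) by (apply Rabs_le; lra).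
        assert (Rabs (th - th0) <= k * l) by (apply Rabs_le; lra).
        assert (e2 * (Rabs (t - t0) + Rabs (th - th0)) <= m).
        { unfold m. apply Rmult_le_compat_l; lra. }
        unfold rr, ri. lra. }
      (* [L1] and [L2] are the contributions of the linear part of F. They have explicit primitives,
         and their integrals cancel in the circulation; the constant part of F already drops out of
         the differences. *)
      set (L1 := fun th => (exp (a + l) - exp a) * (r * (br * cos th - bi * sin th))).
      set (L2 := fun t => exp t * (br * (r * sin (c + k * l) - r * sin c) + bi * (r * cos (c + k * l) - r * cos c))).
      assert (HL1 : is_RInt L1 c (c + k * l) ((exp (a + l) - exp a) * (r * (br * sin (c + k * l) + bi * cos (c + k * l))) - (exp (a + l) - exp a) * (r * (br * sin c + bi * cos c)))).
      { apply (is_RInt_derive (V := R_CompleteNormedModule) (fun th => (exp (a + l) - exp a) * (r * (br * sin th + bi * cos th)))).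
        - intros th _. unfold L1. auto_derive; auto. ring.
        - intros th _. apply (ex_derive_continuous (V := R_NormedModule)). unfold L1. auto_derive; auto. }
      assert (HL2 : is_RInt L2 a (a + l) (exp (a + l) * (br * (r * sin (c + k * l) - r * sin c) + bi * (r * cos (c + k * l) - r * cos c)) - exp a * (br * (r * sin (c + k * l) - r * sin c) + bi * (r * cos (c + k * l) - r * cos c)))).
      { apply (is_RInt_derive (V := R_CompleteNormedModule) (fun t => exp t * (br * (r * sin (c + k * l) - r * sin c) + bi * (r * cos (c + k * l) - r * cos c)))).
        - intros th _. unfold L2. auto_derive; auto. ring.
        - intros th _. apply (ex_derive_continuous (V := R_NormedModule)). unfold L2. auto_derive; auto. }
      assert (Xa : ex_RInt (fun th => I1 a (a + l) th - L1 th) c (c + k * l)).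
      { apply (ex_RInt_minus (V := R_NormedModule) (I1 a (a + l)) L1); [apply X1; lra|]. eexists; apply HL1. }
      assert (Xb : ex_RInt (fun t => (fi t (c + k * l) - fi t c) - L2 t) a (a + l)).
      { apply (ex_RInt_minus (V := R_NormedModule) (fun t => fi t (c + k * l) - fi t c) L2); [apply X2; lra|]. eexists; apply HL2. }
      assert (EPhi : Phi a (a + l) c (c + k * l) =
         RInt (fun th => I1 a (a + l) th - L1 th) c (c + k * l) -
         RInt (fun t => (fi t (c + k * l) - fi t c) - L2 t) a (a + l)).
      { unfold Phi, polar_circulation. fold (I1 a (a + l)).
        rewrite (RInt_Rminus (I1 a (a + l)) L1); [|apply X1; lra|eexists; apply HL1].
        rewrite (RInt_Rminus (fun t => fi t (c + k * l) - fi t c) L2); [|apply X2; lra|eexists; apply HL2].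
        rewrite (is_RInt_unique _ _ _ _ HL1), (is_RInt_unique _ _ _ _ HL2).
        ring. }
      unfold small. rewrite EPhi.
      assert (B1 : Rabs (RInt (fun th => I1 a (a + l) th - L1 th) c (c + k * l)) <= (c + k * l - c) * (8 * m)).
      { apply abs_RInt_le_const; [lra|assumption|]. intros th Hth.
        destruct (Hm a th) as [w1 w2]; [lra|lra|]. destruct (Hm (a + l) th) as [w3 w4]; [lra|lra|].
        destruct (kap_bound s th Hs) as [w5 w6].
        replace (I1 a (a + l) th - L1 th) with ((rr (a + l) th - rr a th) * kap_re s th - (ri (a + l) th - ri a th) * kap_im s th).
        - assert (m1 : Rabs ((rr (a + l) th - rr a th) * kap_re s th) <= 4 * m).
          { rewrite Rabs_mult. replace (4 * m) with ((2 * m) * 2) by ring.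
            apply Rmult_le_compat; auto using Rabs_pos.
            eapply Rle_trans; [apply Rabs_triang|]. rewrite Rabs_Ropp. lra. }
          assert (m2 : Rabs ((ri (a + l) th - ri a th) * kap_im s th) <= 4 * m).
          { rewrite Rabs_mult. replace (4 * m) with ((2 * m) * 2) by ring.
            apply Rmult_le_compat; auto using Rabs_pos.
            eapply Rle_trans; [apply Rabs_triang|]. rewrite Rabs_Ropp. lra. }
          unfold Rminus at 1.
          eapply Rle_trans; [apply Rabs_triang|]. rewrite Rabs_Ropp. lra.
        - destruct (kap_eq s th Hs) as [k1 k2].
          (* In complex form e^(i th) = (e^(i th) - s) kap. Hence q kap = r e^(i th), which is why
             the linear part is elementary to integrate. *)
          assert (q1 : cos th = (cos th - s) * kap_re s th - sin th * kap_im s th /\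
                       sin th = (cos th - s) * kap_im s th + sin th * kap_re s th).
          { generalize (sin2_cos2 th); unfold Rsqr; intros h.
            set (kr := kap_re s th) in *. set (ki := kap_im s th) in *.
            split.
            - replace ((cos th - s) * kr - sin th * ki) with (cos th * (kr - s * (cos th * kr + sin th * ki)) - sin th * (ki - s * (cos th * ki - sin th * kr)) + s * kr * (sin th * sin th + cos th * cos th - 1)) by ring.
              rewrite h. replace (kr - s * (cos th * kr + sin th * ki)) with 1 by lra.
              replace (ki - s * (cos th * ki - sin th * kr)) with 0 by lra. ring.
            - replace ((cos th - s) * ki + sin th * kr) with (sin th * (kr - s * (cos th * kr + sin th * ki)) + cos th * (ki - s * (cos th * ki - sin th * kr)) + s * ki * (sin th * sin th + cos th * cos th - 1)) by ring.
              rewrite h. replace (kr - s * (cos th * kr + sin th * ki)) with 1 by lra.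
              replace (ki - s * (cos th * ki - sin th * kr)) with 0 by lra. ring. }
          destruct q1 as [q1 q2].
          replace (L1 th) with ((exp (a + l) - exp a) * (r * (br * ((cos th - s) * kap_re s th - sin th * kap_im s th)
            - bi * ((cos th - s) * kap_im s th + sin th * kap_re s th)))) by (unfold L1; rewrite <- q1, <- q2; ring).
          unfold I1, rr, ri, gr, gi. ring. }
      assert (B2 : Rabs (RInt (fun t => (fi t (c + k * l) - fi t c) - L2 t) a (a + l)) <= (a + l - a) * (2 * m)).
      { apply abs_RInt_le_const; [lra|assumption|]. intros t Ht.
        destruct (Hm t c) as [w1 w2]; [lra|lra|]. destruct (Hm t (c + k * l)) as [w3 w4]; [lra|lra|].
        replace ((fi t (c + k * l) - fi t c) - L2 t) with (ri t (c + k * l) - ri t c).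
        - eapply Rle_trans; [apply Rabs_triang|]. rewrite Rabs_Ropp. lra.
        - unfold ri, L2, gr, gi. ring. }
      assert (E3 : (c + k * l - c) * (8 * m) + (a + l - a) * (2 * m) = e1 * l ^ 2).
      { unfold m, e2. field. split; lra. }
      unfold Rminus at 1.
      eapply Rle_trans; [apply Rabs_triang|]. rewrite Rabs_Ropp. lra. }
  unfold small in G. rewrite EkT in G. rewrite !Rplus_0_l in G.
  replace (T + - T) with 0 in G by ring.
  replace (e1 * (- T) ^ 2) with (e / 2) in G by (unfold e1; field; lra).
  rewrite Rminus_0_r. unfold Phi in G |- *. lra.
Qed.

Lemma RInt_ext_all (f g : R -> R) a b : (forall x, f x = g x) -> RInt f a b = RInt g a b.
Proof. intros H. apply RInt_ext. intros x _. apply H. Qed.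

Lemma continuous_of_eps (f : R -> R) x :
  (forall e, 0 < e -> exists d, 0 < d /\ forall y, Rabs (y - x) < d -> Rabs (f y - f x) < e) ->
  continuous f x.
Proof.
  intros H. apply continuity_pt_filterlim. intros e He.
  destruct (H e He) as (d & Hd & Hd'). exists d. split; [exact Hd|].
  intros y [_ Hy]. apply Hd'. exact Hy.
Qed.

(** Between t0 and t the exponential is at most exp 1 <= 3, and |cos th - s| <= 3 / 2; the product 9
    / 2 is rounded up to 5. *)
Lemma polar_lipschitz r s t th t0 th0 : 0 < r -> Rabs s <= 1 / 2 -> t0 <= 0 -> Rabs (t - t0) < 1 ->
  Rabs (exp t * (r * cos th - s * r) - exp t0 * (r * cos th0 - s * r)) <= 5 * r * (Rabs (t - t0) + Rabs (th - th0)) /\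
  Rabs (exp t * (r * sin th) - exp t0 * (r * sin th0)) <= 5 * r * (Rabs (t - t0) + Rabs (th - th0)).
Proof.
  intros Hr Hs Ht0 Ht.
  assert (E : Rabs (exp t - exp t0) <= 3 * Rabs (t - t0)).
  { apply (bounded_variation exp exp). intros u Hu. split; [apply is_derive_exp|].
    rewrite Rabs_pos_eq by (left; apply exp_pos).
    apply Rle_trans with (exp 1); [|apply exp_le_3]. left. apply exp_increasing.
    assert (h := Rle_lt_trans _ _ _ Hu Ht). apply Rabs_def2 in h. lra. }
  assert (C : Rabs (cos th - cos th0) <= 1 * Rabs (th - th0)).
  { apply (bounded_variation cos (fun u => - sin u)). intros u Hu. split; [apply is_derive_cos|].
    rewrite Rabs_Ropp. apply Rabs_le. apply SIN_bound. }
  assert (S : Rabs (sin th - sin th0) <= 1 * Rabs (th - th0)).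
  { apply (bounded_variation sin cos). intros u Hu. split; [apply is_derive_sin|].
    apply Rabs_le. apply COS_bound. }
  assert (e0 : 0 < exp t0 <= 1).
  { split; [apply exp_pos|]. rewrite <- exp_0. destruct Ht0 as [h| ->]; [left; now apply exp_increasing|lra]. }
  assert (Hp := Rabs_pos (t - t0)). assert (Hq := Rabs_pos (th - th0)).
  apply Rabs_le_between in Hs.
  split.
  - replace (exp t * (r * cos th - s * r) - exp t0 * (r * cos th0 - s * r)) with
      ((exp t - exp t0) * (r * (cos th - s)) + exp t0 * (r * (cos th - cos th0))) by ring.
    eapply Rle_trans; [apply Rabs_triang|]. rewrite !Rabs_mult.
    rewrite (Rabs_pos_eq r) by lra. rewrite (Rabs_pos_eq (exp t0)) by lra.
    assert (Rabs (cos th - s) <= 3 / 2) by (generalize (COS_bound th); intros; apply Rabs_le; lra).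
    assert (Rabs (exp t - exp t0) * (r * Rabs (cos th - s)) <= (3 * Rabs (t - t0)) * (r * (3 / 2))).
    { apply Rmult_le_compat; [apply Rabs_pos| |assumption|].
      - apply Rmult_le_pos; [lra|apply Rabs_pos].
      - apply Rmult_le_compat_l; lra. }
    assert (exp t0 * (r * Rabs (cos th - cos th0)) <= 1 * (r * (1 * Rabs (th - th0)))).
    { apply Rmult_le_compat; [lra| |lra|].
      - apply Rmult_le_pos; [lra|apply Rabs_pos].
      - apply Rmult_le_compat_l; lra. }
    nra.
  - replace (exp t * (r * sin th) - exp t0 * (r * sin th0)) with
      ((exp t - exp t0) * (r * sin th) + exp t0 * (r * (sin th - sin th0))) by ring.
    eapply Rle_trans; [apply Rabs_triang|]. rewrite !Rabs_mult.
    rewrite (Rabs_pos_eq r) by lra. rewrite (Rabs_pos_eq (exp t0)) by lra.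
    assert (Rabs (sin th) <= 1) by (generalize (SIN_bound th); intros; apply Rabs_le; lra).
    assert (Rabs (exp t - exp t0) * (r * Rabs (sin th)) <= (3 * Rabs (t - t0)) * (r * 1)).
    { apply Rmult_le_compat; [apply Rabs_pos| |assumption|].
      - apply Rmult_le_pos; [lra|apply Rabs_pos].
      - apply Rmult_le_compat_l; lra. }
    assert (exp t0 * (r * Rabs (sin th - sin th0)) <= 1 * (r * (1 * Rabs (th - th0)))).
    { apply Rmult_le_compat; [lra| |lra|].
      - apply Rmult_le_pos; [lra|apply Rabs_pos].
      - apply Rmult_le_compat_l; lra. }
    nra.
Qed.

(** The circle of radius r about x is contracted, not to its centre, but to the real point z = x + s
    r inside it, by z + e^t (r e^(i th) - s r). The integral is independent of t, and for t near -oo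
    continuity replaces P by its value at z and Q by 0. *)
Lemma cauchy_formula (P Q : R -> R -> R) (x r rho s : R) :
  0 < r < rho -> Rabs s <= 1 / 2 ->
  (forall u v, Rabs v < rho -> holo_at P Q u v) ->
  (forall u, Q u 0 = 0) ->
  RInt (fun th => P (x + r * cos th) (r * sin th) * kap_re s th
                - Q (x + r * cos th) (r * sin th) * kap_im s th) 0 (2 * PI)
  = P (x + s * r) 0 * RInt (kap_re s) 0 (2 * PI).
Proof.
  intros Hr Hs Hholo HQ.
  set (gr := fun t th => exp t * (r * cos th - s * r)).
  set (gi := fun t th => exp t * (r * sin th)).
  set (z := x + s * r).
  set (fr := fun t th => P (z + gr t th) (gi t th)).
  set (fi := fun t th => Q (z + gr t th) (gi t th)).
  assert (Hdom : forall t th, t <= 0 -> holo_at P Q (z + gr t th) (gi t th)).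
  { intros t th Ht. apply Hholo. unfold gi. rewrite !Rabs_mult.
    assert (Rabs (exp t) <= 1).
    { rewrite Rabs_pos_eq by (left; apply exp_pos). rewrite <- exp_0.
      destruct Ht as [h| ->]; [left; now apply exp_increasing|lra]. }
    assert (Rabs (sin th) <= 1) by (generalize (SIN_bound th); intros; apply Rabs_le; lra).
    rewrite (Rabs_pos_eq r) by lra.
    assert (Rabs (exp t) * (r * Rabs (sin th)) <= 1 * (r * 1)).
    { apply Rmult_le_compat; [apply Rabs_pos| |assumption|].
      - apply Rmult_le_pos; [lra|apply Rabs_pos].
      - apply Rmult_le_compat_l; lra. }
    lra. }
  assert (Hnear : forall t0 th0 d, t0 <= 0 -> 0 < d -> exists d', 0 < d' /\ d' <= 1 /\
     forall t th, Rabs (t - t0) < d' -> Rabs (th - th0) < d' ->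
       Rabs (gr t th - gr t0 th0) < d /\ Rabs (gi t th - gi t0 th0) < d).
  { intros t0 th0 d Ht0 Hd. exists (Rmin 1 (d / (10 * r))).
    split; [apply Rmin_glb_lt; [lra|apply Rdiv_lt_0_compat; lra]|].
    split; [apply Rmin_l|].
    intros t th h1 h2.
    assert (a1 := Rlt_le_trans _ _ _ h1 (Rmin_l _ _)).
    assert (a2 := Rlt_le_trans _ _ _ h1 (Rmin_r _ _)).
    assert (a3 := Rlt_le_trans _ _ _ h2 (Rmin_r _ _)).
    destruct (polar_lipschitz r s t th t0 th0) as [b1 b2]; [lra|lra|lra|lra|].
    assert (5 * r * (Rabs (t - t0) + Rabs (th - th0)) < 5 * r * (2 * (d / (10 * r)))).
    { apply Rmult_lt_compat_l; lra. }
    replace (5 * r * (2 * (d / (10 * r)))) with d in H by (field; lra).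
    unfold gr, gi. lra. }
  assert (Hcont : forall t0 th0, t0 <= 0 -> forall e, 0 < e -> exists d, 0 < d /\
     forall t th, Rabs (t - t0) < d -> Rabs (th - th0) < d ->
       Rabs (fr t th - fr t0 th0) < e /\ Rabs (fi t th - fi t0 th0) < e).
  { intros t0 th0 Ht0 e He.
    destruct (holo_cont _ _ _ _ (Hdom t0 th0 Ht0) e He) as (d & Hd & Hd').
    destruct (Hnear t0 th0 d Ht0 Hd) as (d' & h1 & h2 & h3).
    exists d'. split; [assumption|]. intros t th q1 q2.
    destruct (h3 t th q1 q2) as [w1 w2]. destruct (Hd' _ _ w1 w2) as [w3 w4].
    unfold fr, fi.
    replace (z + gr t th) with (z + gr t0 th0 + (gr t th - gr t0 th0)) by ring.
    replace (gi t th) with (gi t0 th0 + (gi t th - gi t0 th0)) by ring. split; assumption. }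
  assert (Hc1 : forall t th, t <= 0 -> continuous (fr t) th /\ continuous (fi t) th).
  { intros t th Ht. split; apply continuous_of_eps; intros e He;
    destruct (Hcont t th Ht e He) as (d & Hd & Hd'); exists d; (split; [assumption|]);
    intros y Hy; destruct (Hd' t y); auto;
    unfold Rminus; rewrite Rplus_opp_r, Rabs_R0; assumption. }
  assert (XI : forall t a b, t <= 0 -> ex_RInt (fun th => fr t th * kap_re s th - fi t th * kap_im s th) a b).
  { intros t a b Ht. apply (ex_RInt_continuous (V := R_CompleteNormedModule)). intros th _.
    destruct (kap_continuous s th Hs). destruct (Hc1 t th Ht).
    apply continuous_Rminus; apply continuous_Rmult; auto. }
  assert (Hconst : forall T, T < 0 ->
     RInt (fun th => fr 0 th * kap_re s th - fi 0 th * kap_im s th) 0 (2 * PI) =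
     RInt (fun th => fr T th * kap_re s th - fi T th * kap_im s th) 0 (2 * PI)).
  { intros T HT.
    assert (G : polar_circulation fr fi s T 0 0 (2 * PI) = 0).
    { apply (goursat_polar fr fi r s T); [lra|assumption|assumption| | |].
      - intros t th Ht. apply Hc1; lra.
      - intros t th Ht. apply continuous_of_eps; intros e He.
        destruct (Hcont t th ltac:(lra) e He) as (d & Hd & Hd'); exists d; (split; [assumption|]).
        intros y Hy. destruct (Hd' y th); auto.
        unfold Rminus; rewrite Rplus_opp_r, Rabs_R0; assumption.
      - intros t0 th0 Ht0.
        destruct (Hdom t0 th0 ltac:(lra)) as (br & bi & Hb). exists br, bi. intros e He.
        destruct (Hb (e / (10 * r))) as (d & Hd & Hd').
        { apply Rdiv_lt_0_compat; lra. }
        destruct (Hnear t0 th0 d ltac:(lra) Hd) as (d' & h1 & h2 & h3).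
        exists d'. split; [assumption|]. intros t th q1 q2.
        destruct (h3 t th q1 q2) as [w1 w2]. destruct (Hd' _ _ w1 w2) as [w3 w4].
        replace (z + gr t0 th0 + (gr t th - gr t0 th0)) with (z + gr t th) in w3, w4 by ring.
        replace (gi t0 th0 + (gi t th - gi t0 th0)) with (gi t th) in w3, w4 by ring.
        destruct (polar_lipschitz r s t th t0 th0) as [b1 b2]; [lra|lra|lra|lra|].
        fold (gr t th) (gr t0 th0) in b1. fold (gi t th) (gi t0 th0) in b2.
        assert (e / (10 * r) * (Rabs (gr t th - gr t0 th0) + Rabs (gi t th - gi t0 th0)) <=
                e * (Rabs (t - t0) + Rabs (th - th0))).
        { apply Rle_trans with (e / (10 * r) * (10 * r * (Rabs (t - t0) + Rabs (th - th0)))).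
          - apply Rmult_le_compat_l; [left; apply Rdiv_lt_0_compat; lra|lra].
          - right. field. lra. }
        fold (gr t th) (gr t0 th0) (gi t th) (gi t0 th0).
        unfold fr, fi. lra. }
    unfold polar_circulation in G.
    (* The two sides th = 0 and th = 2 PI carry the same values, so they cancel. *)
    rewrite (RInt_ext_all (fun t => fi t (2 * PI) - fi t 0) (fun _ => 0)) in G.
    2:{ intros t. unfold fi, gr, gi. rewrite cos_2PI, sin_2PI, cos_0, sin_0. ring. }
    rewrite (RInt_const (V := R_CompleteNormedModule)) in G. unfold scal in G; simpl in G.
    unfold mult in G; simpl in G.
    rewrite (RInt_ext_all _ (fun th => (fr 0 th * kap_re s th - fi 0 th * kap_im s th) - (fr T th * kap_re s th - fi T th * kap_im s th))) in G
      by (intros; ring).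
    rewrite RInt_Rminus in G by (apply XI; lra). lra. }
  assert (XK : ex_RInt (kap_re s) 0 (2 * PI)).
  { apply (ex_RInt_continuous (V := R_CompleteNormedModule)). intros th _. now apply kap_continuous. }
  transitivity (RInt (fun th => fr 0 th * kap_re s th - fi 0 th * kap_im s th) 0 (2 * PI)).
  { apply RInt_ext_all. intros th. unfold fr, fi, gr, gi, z. rewrite exp_0.
    replace (x + s * r + 1 * (r * cos th - s * r)) with (x + r * cos th) by ring.
    rewrite !Rmult_1_l. reflexivity. }
  assert (HPI := PI_RGT_0).
  apply Rminus_diag_uniq. apply cond_eq. intros e He.
  assert (H0 : holo_at P Q z 0) by (apply Hholo; rewrite Rabs_R0; lra).
  destruct (holo_cont _ _ _ _ H0 (e / (16 * PI))) as (d & Hd & Hd').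
  { apply Rdiv_lt_0_compat; lra. }
  (* At this T the contracted circle stays within 2 r e^T <= d / 2 of z in each coordinate. *)
  set (T := Rmin (-1) (ln (d / (4 * r)))).
  assert (HT : T < 0) by (unfold T; generalize (Rmin_l (-1) (ln (d / (4 * r)))); lra).
  assert (HeT : exp T * (4 * r) <= d).
  { assert (exp T <= d / (4 * r)).
    { rewrite <- (exp_ln (d / (4 * r))) by (apply Rdiv_lt_0_compat; lra).
      destruct (Rmin_r (-1) (ln (d / (4 * r)))) as [h|h].
      - left. apply exp_increasing. exact h.
      - unfold T. rewrite h. lra. }
    apply Rle_trans with (d / (4 * r) * (4 * r)).
    - apply Rmult_le_compat_r; lra.
    - right. field. lra. }
  rewrite (Hconst T HT).
  assert (EA : P z 0 * RInt (kap_re s) 0 (2 * PI) = RInt (fun th => P z 0 * kap_re s th) 0 (2 * PI)).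
  { symmetry. exact (RInt_scal (V := R_CompleteNormedModule) (kap_re s) 0 (2 * PI) (P z 0) XK). }
  rewrite EA.
  assert (XA : ex_RInt (fun th => P z 0 * kap_re s th) 0 (2 * PI)).
  { exact (ex_RInt_scal (V := R_NormedModule) (kap_re s) 0 (2 * PI) (P z 0) XK). }
  rewrite <- (RInt_Rminus _ _ 0 (2 * PI) (XI T 0 (2 * PI) ltac:(lra)) XA).
  rewrite Rminus_0_r.
  apply Rle_lt_trans with ((2 * PI - 0) * (4 * (e / (16 * PI)))).
  2:{ replace ((2 * PI - 0) * (4 * (e / (16 * PI)))) with (e / 2) by (field; lra). lra. }
  apply abs_RInt_le_const; [lra| |].
  { exact (ex_RInt_minus (V := R_NormedModule) _ _ 0 (2 * PI) (XI T 0 (2 * PI) ltac:(lra)) XA). }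
  intros th _.
  destruct (kap_bound s th Hs) as [k1 k2].
  assert (eT : 0 < exp T) by apply exp_pos.
  destruct (Hd' (gr T th) (gi T th)) as [p1 p2].
  { unfold gr. rewrite Rabs_mult. rewrite (Rabs_pos_eq (exp T)) by lra.
    apply Rle_lt_trans with (exp T * (2 * r)); [|nra]. apply Rmult_le_compat_l; [lra|].
    generalize (COS_bound th); intros. apply Rabs_le_between in Hs. apply Rabs_le; nra. }
  { unfold gi. rewrite Rabs_mult. rewrite (Rabs_pos_eq (exp T)) by lra.
    apply Rle_lt_trans with (exp T * (2 * r)); [|nra]. apply Rmult_le_compat_l; [lra|].
    generalize (SIN_bound th); intros. apply Rabs_le; nra. }
  rewrite Rplus_0_l in p1, p2. fold (fr T th) in p1. fold (fi T th) in p2.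
  rewrite HQ, Rminus_0_r in p2.
  replace (fr T th * kap_re s th - fi T th * kap_im s th - P z 0 * kap_re s th)
    with ((fr T th - P z 0) * kap_re s th + - (fi T th * kap_im s th)) by ring.
  eapply Rle_trans; [apply Rabs_triang|]. rewrite Rabs_Ropp, !Rabs_mult.
  assert (Rabs (fr T th - P z 0) * Rabs (kap_re s th) <= e / (16 * PI) * 2).
  { apply Rmult_le_compat; auto using Rabs_pos. lra. }
  assert (Rabs (fi T th) * Rabs (kap_im s th) <= e / (16 * PI) * 2).
  { apply Rmult_le_compat; auto using Rabs_pos. lra. }
  lra.
Qed.

Lemma is_series_of_lim (a u : nat -> R) (l : R) :
  (forall n, sum_n a n = u n) -> is_lim_seq u l -> is_series a l.
Proof. intros E H. exact (is_lim_seq_ext u (sum_n a) l (fun n => eq_sym (E n)) H). Qed.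

(** With K n the integral of Re (F e^(-i n th) kap), the equation for kap gives K n = c n + s K (n +
    1). The partial sums telescope to K 0 - s^(n + 1) K (n + 1), and K is bounded; no sum has to be
    exchanged with an integral. *)
Lemma kernel_expansion (f1 f2 : R -> R) (M s : R) :
  Rabs s <= 1 / 2 ->
  (forall th, continuous f1 th) -> (forall th, continuous f2 th) ->
  (forall th, Rabs (f1 th) <= M) -> (forall th, Rabs (f2 th) <= M) ->
  is_series (fun n => RInt (fun th => f1 th * cos (INR n * th) + f2 th * sin (INR n * th)) 0 (2 * PI) * s ^ n)
    (RInt (fun th => f1 th * kap_re s th - f2 th * kap_im s th) 0 (2 * PI)).
Proof.
  intros Hs C1 C2 M1 M2.
  assert (HPI := PI_RGT_0).
  assert (HM : 0 <= M) by (apply Rle_trans with (2 := M1 0); apply Rabs_pos).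
  set (c := fun n => RInt (fun th => f1 th * cos (INR n * th) + f2 th * sin (INR n * th)) 0 (2 * PI)).
  set (kr := fun n th => cos (INR n * th) * kap_re s th + sin (INR n * th) * kap_im s th).
  set (ki := fun n th => cos (INR n * th) * kap_im s th - sin (INR n * th) * kap_re s th).
  set (K := fun n => RInt (fun th => f1 th * kr n th - f2 th * ki n th) 0 (2 * PI)).
  assert (Hcs : forall n th, continuous (fun th => cos (INR n * th)) th /\ continuous (fun th => sin (INR n * th)) th).
  { intros n th. split; apply (ex_derive_continuous (V := R_NormedModule)); auto_derive; auto. }
  assert (Cp : forall (f g : R -> R) x, continuous f x -> continuous g x -> continuous (fun t => f t + g t) x).
  { intros f g x. exact (@continuous_plus _ R_AbsRing R_NormedModule f g x). }
  assert (XK : forall n, ex_RInt (fun th => f1 th * kr n th - f2 th * ki n th) 0 (2 * PI)).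
  { intros n. apply (ex_RInt_continuous (V := R_CompleteNormedModule)). intros th _.
    destruct (kap_continuous s th Hs). destruct (Hcs n th).
    apply continuous_Rminus; apply continuous_Rmult; auto;
      [apply Cp|apply continuous_Rminus]; apply continuous_Rmult; auto. }
  assert (Xc : forall n, ex_RInt (fun th => f1 th * cos (INR n * th) + f2 th * sin (INR n * th)) 0 (2 * PI)).
  { intros n. apply (ex_RInt_continuous (V := R_CompleteNormedModule)). intros th _.
    destruct (Hcs n th). apply Cp; apply continuous_Rmult; auto. }
  assert (HK : forall n, K n = c n + s * K (S n)).
  { intros n. unfold K, c.
    transitivity (RInt (fun th => (f1 th * cos (INR n * th) + f2 th * sin (INR n * th)) + s * (f1 th * kr (S n) th - f2 th * ki (S n) th)) 0 (2 * PI)).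
    - apply RInt_ext_all. intros th. unfold kr, ki. rewrite S_INR.
      replace ((INR n + 1) * th) with (INR n * th + th) by ring. rewrite cos_plus, sin_plus.
      destruct (kap_eq s th Hs) as [e1 e2].
      transitivity (f1 th * (cos (INR n * th) * (1 + s * (cos th * kap_re s th + sin th * kap_im s th))
          + sin (INR n * th) * (s * (cos th * kap_im s th - sin th * kap_re s th)))
        - f2 th * (cos (INR n * th) * (s * (cos th * kap_im s th - sin th * kap_re s th))
          - sin (INR n * th) * (1 + s * (cos th * kap_re s th + sin th * kap_im s th)))).
      + rewrite <- e1, <- e2. reflexivity.
      + ring.
    - rewrite <- (RInt_scal (V := R_CompleteNormedModule)) by apply XK.
      exact (RInt_plus (V := R_CompleteNormedModule) _ _ 0 (2 * PI) (Xc n) (ex_RInt_scal (V := R_NormedModule) _ 0 (2 * PI) s (XK (S n)))). }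
  assert (BK : forall n, Rabs (K n) <= 2 * PI * (8 * M)).
  { intros n. replace (2 * PI * (8 * M)) with ((2 * PI - 0) * (8 * M)) by ring.
    apply abs_RInt_le_const; [lra|apply XK|]. intros th _.
    destruct (kap_bound s th Hs) as [k1 k2].
    assert (h1 : Rabs (cos (INR n * th)) <= 1) by (apply Rabs_le; apply COS_bound).
    assert (h2 : Rabs (sin (INR n * th)) <= 1) by (apply Rabs_le; apply SIN_bound).
    assert (hp : forall a b, Rabs a <= 1 -> Rabs b <= 2 -> Rabs (a * b) <= 2).
    { intros a b Ha Hb. rewrite Rabs_mult. replace 2 with (1 * 2) by ring. apply Rmult_le_compat; auto using Rabs_pos. }
    assert (b1 : Rabs (kr n th) <= 4).
    { unfold kr. eapply Rle_trans; [apply Rabs_triang|].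
      generalize (hp _ _ h1 k1) (hp _ _ h2 k2). lra. }
    assert (b2 : Rabs (ki n th) <= 4).
    { unfold ki, Rminus. eapply Rle_trans; [apply Rabs_triang|]. rewrite Rabs_Ropp.
      generalize (hp _ _ h1 k2) (hp _ _ h2 k1). lra. }
    unfold Rminus. eapply Rle_trans; [apply Rabs_triang|]. rewrite Rabs_Ropp, !Rabs_mult.
    assert (Rabs (f1 th) * Rabs (kr n th) <= M * 4) by (apply Rmult_le_compat; auto using Rabs_pos).
    assert (Rabs (f2 th) * Rabs (ki n th) <= M * 4) by (apply Rmult_le_compat; auto using Rabs_pos).
    lra. }
  assert (Hsum : forall n, sum_n (fun n => c n * s ^ n) n = K 0%nat - s ^ (S n) * K (S n)).
  { induction n as [|n IH].
    - rewrite sum_O. rewrite (HK 0%nat). simpl. ring.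
    - rewrite sum_Sn, IH, (HK (S n)). unfold plus; simpl. ring. }
  replace (RInt (fun th => f1 th * kap_re s th - f2 th * kap_im s th) 0 (2 * PI)) with (K 0%nat).
  2:{ unfold K, kr, ki. apply RInt_ext_all. intros th. simpl. rewrite Rmult_0_l, cos_0, sin_0. ring. }
  apply (is_series_of_lim _ _ _ Hsum).
  replace (Finite (K 0%nat)) with (Finite (K 0%nat - 0)) by (f_equal; ring).
  apply is_lim_seq_minus'; [apply is_lim_seq_const|].
  apply is_lim_seq_abs_0.
  apply is_lim_seq_le_le with (u := fun _ => 0) (w := fun n => (2 * PI * (8 * M)) * (1 / 2) ^ S n).
  { intros n. split; [apply Rabs_pos|]. rewrite Rabs_mult, Rmult_comm.
    apply Rmult_le_compat; auto using Rabs_pos. rewrite <- RPow_abs. apply pow_incr. split; [apply Rabs_pos|assumption]. }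
  { apply is_lim_seq_const. }
  replace (Finite 0) with (Rbar_mult (2 * PI * (8 * M)) 0) by (simpl; f_equal; ring).
  apply is_lim_seq_scal_l. apply (is_lim_seq_incr_1 (fun n => (1 / 2) ^ n)).
  apply is_lim_seq_geom. rewrite Rabs_pos_eq; lra.
Qed.

(** The expansion of the kernel applied to F = 1, where only the coefficient of index 0 survives. *)
Lemma kap_re_integral s : Rabs s <= 1 / 2 -> RInt (kap_re s) 0 (2 * PI) = 2 * PI.
Proof.
  intros Hs.
  assert (H := kernel_expansion (fun _ => 1) (fun _ => 0) 1 s Hs
     (fun th => continuous_const _ _) (fun th => continuous_const _ _)).
  assert (H' := H ltac:(intros; cbv beta; rewrite Rabs_R1; lra) ltac:(intros; cbv beta; rewrite Rabs_R0; lra)). clear H.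
  rewrite (RInt_ext_all (fun th => 1 * kap_re s th - 0 * kap_im s th) (kap_re s)) in H' by (intros; ring).
  rewrite <- (is_series_unique _ _ H'). apply is_series_unique.
  apply (is_series_ext (fun n => if Nat.eqb n 0 then 2 * PI else 0)).
  - intros n. symmetry.
    rewrite (RInt_ext_all _ (fun th => cos (INR n * th))) by (intros; ring).
    destruct n as [|n]; simpl Nat.eqb; cbv iota.
    + rewrite (RInt_ext_all _ (fun th => 1)) by (intros; simpl; rewrite Rmult_0_l; apply cos_0).
      rewrite (RInt_const (V := R_CompleteNormedModule)). unfold scal; simpl. unfold mult; simpl. ring.
    + assert (Hn : INR (S n) <> 0) by (apply not_0_INR; lia).
      replace 0 with (0 * s ^ S n) at 2 by ring. f_equal.
      apply is_RInt_unique.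
      assert (Hper : sin (INR (S n) * (2 * PI)) = 0).
      { replace (INR (S n) * (2 * PI)) with (0 + 2 * INR (S n) * PI) by ring. rewrite sin_period. apply sin_0. }
      revert Hn Hper. generalize (INR (S n)). intros m Hn Hper.
      replace 0 with (sin (m * (2 * PI)) / m - sin (m * 0) / m) at 2.
      * apply (is_RInt_derive (V := R_CompleteNormedModule) (fun th => sin (m * th) / m)).
        -- intros th _. auto_derive; auto. field. assumption.
        -- intros th _. apply (ex_derive_continuous (V := R_NormedModule)). auto_derive; auto.
      * rewrite Hper, Rmult_0_r, sin_0. field. assumption.
  - apply (is_series_of_lim _ (fun _ => 2 * PI)); [|apply is_lim_seq_const].
    induction n as [|n IH]; [now rewrite sum_O|]. rewrite sum_Sn, IH. unfold plus; simpl. ring.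
Qed.

(** Cauchy's formula for the point x + h, with s = h / r, expanded in powers of s; |h| <= r / 2 is
    |s| <= 1 / 2. The 2 in the estimate comes from bounding the real and the imaginary part
    separately. *)
Lemma cauchy_taylor (P Q : R -> R -> R) (x r rho M : R) :
  0 < r < rho ->
  (forall u v, Rabs v < rho -> holo_at P Q u v) ->
  (forall u, Q u 0 = 0) ->
  (forall th, Rabs (P (x + r * cos th) (r * sin th)) <= M /\ Rabs (Q (x + r * cos th) (r * sin th)) <= M) ->
  exists a : nat -> R, (forall n, Rabs (a n) <= 2 * M / r ^ n) /\
    forall h, Rabs h <= r / 2 -> is_pseries a h (P (x + h) 0).
Proof.
  intros Hr Hholo HQ HM.
  assert (HPI := PI_RGT_0).
  set (f1 := fun th => P (x + r * cos th) (r * sin th)).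
  set (f2 := fun th => Q (x + r * cos th) (r * sin th)).
  assert (HC : forall th, continuous f1 th /\ continuous f2 th).
  { assert (Hlip : forall th y, Rabs (r * cos y - r * cos th) <= r * Rabs (y - th) /\ Rabs (r * sin y - r * sin th) <= r * Rabs (y - th)).
    { intros th y. split.
      - apply (bounded_variation (fun u => r * cos u) (fun u => r * - sin u)). intros u _. split.
        + auto_derive; auto. ring.
        + rewrite Rabs_mult, Rabs_Ropp, (Rabs_pos_eq r) by lra.
          assert (Rabs (sin u) <= 1) by (apply Rabs_le; apply SIN_bound). nra.
      - apply (bounded_variation (fun u => r * sin u) (fun u => r * cos u)). intros u _. split.
        + auto_derive; auto. ring.
        + rewrite Rabs_mult, (Rabs_pos_eq r) by lra.
          assert (Rabs (cos u) <= 1) by (apply Rabs_le; apply COS_bound). nra. }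
    assert (Hd : forall th e, 0 < e -> exists d, 0 < d /\ forall y, Rabs (y - th) < d -> Rabs (f1 y - f1 th) < e /\ Rabs (f2 y - f2 th) < e).
    { intros th e He.
      destruct (holo_cont P Q (x + r * cos th) (r * sin th)) with (e := e) as (d & Hd & Hd'); [|assumption|].
      { apply Hholo. rewrite Rabs_mult, (Rabs_pos_eq r) by lra.
        assert (Rabs (sin th) <= 1) by (apply Rabs_le; apply SIN_bound). nra. }
      exists (d / r). split; [apply Rdiv_lt_0_compat; lra|]. intros y Hy.
      destruct (Hlip th y) as [l1 l2].
      assert (l3 : r * Rabs (y - th) < d).
      { apply Rmult_lt_compat_l with (r := r) in Hy; [|lra].
        replace (r * (d / r)) with d in Hy by (field; lra). lra. }
      destruct (Hd' (r * cos y - r * cos th) (r * sin y - r * sin th)) as [q1 q2]; [lra|lra|].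
      replace (x + r * cos th + (r * cos y - r * cos th)) with (x + r * cos y) in q1, q2 by ring.
      replace (r * sin th + (r * sin y - r * sin th)) with (r * sin y) in q1, q2 by ring.
      split; assumption. }
    intros th. split; apply continuous_of_eps; intros e He; destruct (Hd th e He) as (d & h1 & h2);
      exists d; (split; [assumption|]); intros y Hy; apply h2; assumption. }
  set (c := fun n => RInt (fun th => f1 th * cos (INR n * th) + f2 th * sin (INR n * th)) 0 (2 * PI)).
  exists (fun n => c n / (2 * PI) / r ^ n). split.
  - intros n. assert (Hrn : 0 < r ^ n) by (apply pow_lt; lra).
    unfold Rdiv. rewrite !Rabs_mult, (Rabs_pos_eq (/ r ^ n)) by (left; apply Rinv_0_lt_compat; assumption).
    apply Rmult_le_compat_r; [left; apply Rinv_0_lt_compat; assumption|].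
    rewrite (Rabs_pos_eq (/ (2 * PI))) by (left; apply Rinv_0_lt_compat; lra).
    apply Rle_trans with (((2 * PI - 0) * (2 * M)) * / (2 * PI)).
    + apply Rmult_le_compat_r; [left; apply Rinv_0_lt_compat; lra|].
      apply abs_RInt_le_const; [lra| |].
      * apply (ex_RInt_continuous (V := R_CompleteNormedModule)). intros th _. destruct (HC th).
        apply (continuous_plus (V := R_NormedModule)); apply continuous_Rmult; auto;
          apply (ex_derive_continuous (V := R_NormedModule)); auto_derive; auto.
      * intros th _. eapply Rle_trans; [apply Rabs_triang|]. rewrite !Rabs_mult.
        destruct (HM th) as [m1 m2].
        assert (Rabs (cos (INR n * th)) <= 1) by (apply Rabs_le; apply COS_bound).
        assert (Rabs (sin (INR n * th)) <= 1) by (apply Rabs_le; apply SIN_bound).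
        assert (Rabs (f1 th) * Rabs (cos (INR n * th)) <= M * 1) by (apply Rmult_le_compat; auto using Rabs_pos).
        assert (Rabs (f2 th) * Rabs (sin (INR n * th)) <= M * 1) by (apply Rmult_le_compat; auto using Rabs_pos).
        lra.
    + right. field. lra.
  - intros h Hh.
    set (s := h / r).
    assert (Hs : Rabs s <= 1 / 2).
    { unfold s, Rdiv. rewrite Rabs_mult, (Rabs_pos_eq (/ r)) by (left; apply Rinv_0_lt_compat; lra).
      apply Rmult_le_reg_r with r; [lra|]. rewrite Rmult_assoc, Rinv_l by lra. lra. }
    assert (E : s * r = h) by (unfold s; field; lra).
    assert (F := cauchy_formula P Q x r rho s Hr Hs Hholo HQ).
    rewrite kap_re_integral, E in F by assumption.
    assert (G := kernel_expansion f1 f2 M s Hs (fun th => proj1 (HC th)) (fun th => proj2 (HC th))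
       (fun th => proj1 (HM th)) (fun th => proj2 (HM th))).
    unfold f1, f2 in G. rewrite F in G. fold f1 f2 in G.
    assert (G' := is_series_scal_l (/ (2 * PI)) _ _ G).
    replace (P (x + h) 0) with (/ (2 * PI) * (P (x + h) 0 * (2 * PI))) by (field; lra).
    apply is_pseries_R. eapply is_series_ext; [|exact G'].
    intros n. unfold scal; simpl. unfold mult; simpl. unfold s, Rdiv.
    rewrite Rpow_mult_distr, pow_inv. unfold c, f1, f2. field. repeat split; try (apply pow_nonzero); lra.
Qed.

Lemma CV_radius_ge (a : nat -> R) (C r : R) : 0 < r ->
  (forall n, Rabs (a n) <= C / r ^ n) -> Rbar_le r (CV_radius a).
Proof.
  intros Hr Ha. destruct (CV_radius_bounded a) as [H _]. apply (H r).
  exists C. intros n. assert (0 < r ^ n) by (apply pow_lt; lra).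
  rewrite Rabs_mult, (Rabs_pos_eq (r ^ n)) by lra.
  apply Rle_trans with (C / r ^ n * r ^ n); [apply Rmult_le_compat_r; [lra|apply Ha]|].
  right. field. lra.
Qed.

(** * Decay and Taylor coefficients of the potential *)

(** The shift by 1 makes the weight bounded at the origin, so that one inequality covers the whole
    line. *)
Definition decay (tau x : R) : R := Rpower (1 + Rabs x) (-1 - tau).

Lemma decay_pos tau x : 0 < decay tau x.
Proof. apply exp_pos. Qed.

(** Used with y the modulus of a distant point, with y = 1 on a bounded set, and with y the weight
    base 1 + |x'| of a nearby abscissa x'. *)
Lemma decay_le (tau x y c : R) : 0 < tau -> 0 < y -> 0 < c -> 1 + Rabs x <= c * y ->
  Rpower y (-1 - tau) <= Rpower c (1 + tau) * decay tau x.
Proof.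
  intros Ht Hy Hc H. unfold decay, Rpower. rewrite <- exp_plus.
  assert (ln (1 + Rabs x) <= ln c + ln y).
  { rewrite <- ln_mult by lra. apply ln_le; [generalize (Rabs_pos x); lra|assumption]. }
  assert (h : (-1 - tau) * ln y <= (1 + tau) * ln c + (-1 - tau) * ln (1 + Rabs x)) by nra.
  destruct h as [h|h]; [left; now apply exp_increasing|rewrite h; lra].
Qed.

Definition re_part (F : Cx -> Cx) (u v : R) : R := Cre (F (mkC u v)).
Definition im_part (F : Cx -> Cx) (u v : R) : R := Cim (F (mkC u v)).

Lemma Cmod_bounds z : Rabs (Cre z) <= Cmod z /\ Rabs (Cim z) <= Cmod z.
Proof.
  unfold Cmod. split; rewrite <- sqrt_Rsqr_abs; apply sqrt_le_1_alt; unfold Rsqr;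
    generalize (pow2_ge_0 (Cim z)) (pow2_ge_0 (Cre z)); nra.
Qed.

Lemma Cmod_le_sum z : Cmod z <= Rabs (Cre z) + Rabs (Cim z).
Proof.
  unfold Cmod. generalize (Rabs_pos (Cre z)) (Rabs_pos (Cim z)); intros p q.
  rewrite <- (sqrt_pow2 (Rabs (Cre z) + Rabs (Cim z))) by lra.
  apply sqrt_le_1_alt. rewrite <- (pow2_abs (Cre z)), <- (pow2_abs (Cim z)). nra.
Qed.

Lemma holo_of_differentiable F u v :
  C_differentiable_at F (mkC u v) -> holo_at (re_part F) (im_part F) u v.
Proof.
  intros [[br bi] H]. exists br, bi. intros e He.
  destruct (H e He) as (d & Hd & Hd'). exists (d / 2). split; [lra|].
  intros h k Hh Hk.
  destruct (classic (h = 0 /\ k = 0)) as [[-> ->]|Hn].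
  { rewrite !Rplus_0_r, Rabs_R0.
    replace (re_part F u v - re_part F u v - (br * 0 - bi * 0)) with 0 by ring.
    replace (im_part F u v - im_part F u v - (br * 0 + bi * 0)) with 0 by ring.
    rewrite Rabs_R0. lra. }
  assert (Hne : mkC h k <> C0) by (intros E; injection E; intros; tauto).
  assert (Hlt : Cmod (mkC h k) < d).
  { generalize (Cmod_le_sum (mkC h k)); simpl. lra. }
  specialize (Hd' _ Hne Hlt).
  assert (Hn2 : 0 < h ^ 2 + k ^ 2).
  { destruct (Req_dec h 0) as [->|h0]; [|generalize (pow2_gt_0 h h0) (pow2_ge_0 k); lra].
    destruct (Req_dec k 0) as [->|k0]; [tauto|]. generalize (pow2_gt_0 k k0). lra. }
  set (Z := Csub (Cdiv (Csub (F (Cadd (mkC u v) (mkC h k))) (F (mkC u v))) (mkC h k)) (mkC br bi)) in *.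
  destruct (Cmod_bounds Z) as [z1 z2].
  assert (E1 : re_part F (u + h) (v + k) - re_part F u v - (br * h - bi * k) = Cre Z * h - Cim Z * k).
  { unfold Z, re_part, Csub, Cdiv, Cmul, Cinv, Cadd, Copp; simpl. field. lra. }
  assert (E2 : im_part F (u + h) (v + k) - im_part F u v - (br * k + bi * h) = Cre Z * k + Cim Z * h).
  { unfold Z, im_part, Csub, Cdiv, Cmul, Cinv, Cadd, Copp; simpl. field. lra. }
  rewrite E1, E2.
  assert (m : forall a b, Rabs a <= e -> Rabs (a * b) <= e * Rabs b).
  { intros a b Ha. rewrite Rabs_mult. apply Rmult_le_compat_r; [apply Rabs_pos|assumption]. }
  assert (Ha1 : Rabs (Cre Z) <= e) by lra. assert (Ha2 : Rabs (Cim Z) <= e) by lra.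
  split.
  - unfold Rminus. eapply Rle_trans; [apply Rabs_triang|]. rewrite Rabs_Ropp.
    generalize (m _ h Ha1) (m _ k Ha2). lra.
  - eapply Rle_trans; [apply Rabs_triang|].
    generalize (m _ k Ha1) (m _ h Ha2). lra.
Qed.

(** The Cauchy estimate provides a coefficient sequence separately for each x. Identifying it with
    the derivatives [fn] turns the coefficients into differentiable functions of x. *)
Lemma taylor_coefficient (f : R -> R) (fn : nat -> R -> R) (a : nat -> R) (x C r : R) :
  0 < r -> fn 0%nat = f -> (forall n x, is_derive (fn n) x (fn (S n) x)) ->
  (forall n, Rabs (a n) <= C / r ^ n) ->
  (forall h, Rabs h <= r / 2 -> is_pseries a h (f (x + h))) ->
  forall n, fn n x = a n * INR (fact n).
Proof.
  intros Hr H0 Hd Ha Hs n.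
  assert (E : forall n y, Derive_n f n y = fn n y).
  { clear n. induction n as [|n IH]; intros y; simpl.
    - now rewrite H0.
    - rewrite (Derive_ext _ (fn n) _ IH). apply is_derive_unique, Hd. }
  rewrite <- E. rewrite <- (Derive_n_coef a n).
  2:{ apply Rbar_lt_le_trans with r; [exact Hr|]. now apply (CV_radius_ge a C). }
  replace (Derive_n f n x) with (Derive_n f n (0 + x)) by (f_equal; ring).
  rewrite <- Derive_n_comp_trans. apply Derive_n_ext_loc.
  exists (mkposreal (r / 2) ltac:(lra)). intros h Hh. unfold ball in Hh; simpl in Hh.
  unfold AbsRing_ball, abs, minus, plus, opp in Hh; simpl in Hh. rewrite Ropp_0, Rplus_0_r in Hh.
  symmetry. rewrite Rplus_comm. apply is_pseries_unique, Hs. lra.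
Qed.

Lemma A1_taylor (A : R -> R) : assumption_A1 A ->
  exists (An : nat -> R -> R) (r M tau : R), 0 < r /\ 0 < M /\ 0 < tau /\
    (forall x, An 0%nat x = A x) /\
    (forall n x, is_derive (An n) x (INR (S n) * An (S n) x)) /\
    (forall n x, Rabs (An n x) <= M * decay tau x / r ^ n).
Proof.
  intros (Hpos & (fn & Hf0 & Hfn) & rho0 & th0 & tau & Hrho & Hth & Htau & F & HF & HFA & K & R0 & HR0 & HK).
  set (P := re_part F). set (Q := im_part F).
  assert (Hholo : forall u v, Rabs v < rho0 -> holo_at P Q u v).
  { intros u v Hv. apply holo_of_differentiable, HF. unfold Dsector. simpl.
    generalize (Rmax_l rho0 (tan th0 * Rabs u)). lra. }
  assert (HP0 : forall u, P u 0 = A u) by (intros u; unfold P, re_part; change (mkC u 0) with (RtoC u); rewrite HFA; reflexivity).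
  assert (HQ0 : forall u, Q u 0 = 0) by (intros u; unfold Q, im_part; change (mkC u 0) with (RtoC u); rewrite HFA; reflexivity).
  (* Circles of radius r about real points stay in the strip, and r <= 1 / 2 keeps the weights at
     their centre and on the circle within a factor 2 of each other in the base. *)
  set (r := Rmin rho0 1 / 2).
  assert (Hr : 0 < r < rho0 /\ r <= 1 / 2).
  { unfold r. generalize (Rmin_l rho0 1) (Rmin_r rho0 1) (Rmin_glb_lt rho0 1 0 Hrho Rlt_0_1). lra. }
  destruct (holo_bounded P Q (- R0) R0 (- r) r) as (B & HB & HBd); [lra|lra| |].
  { intros x y _ Hy. apply Hholo. apply Rabs_def1; lra. }
  (* The first summand serves the points of modulus at least R0, through the decay in (A1); the
     second serves the remaining compact piece, through [B]. *)
  set (M0 := Rabs K * Rpower (1 + / R0) (1 + tau) + B * Rpower (1 + R0) (1 + tau)).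
  assert (iR : 0 < / R0) by (apply Rinv_0_lt_compat; lra).
  assert (pos1 : 0 <= Rabs K * Rpower (1 + / R0) (1 + tau)).
  { apply Rmult_le_pos; [apply Rabs_pos|left; apply exp_pos]. }
  assert (pos2 : 0 <= B * Rpower (1 + R0) (1 + tau)).
  { apply Rmult_le_pos; [assumption|left; apply exp_pos]. }
  assert (Hstrip : forall u v, Rabs v <= r -> Rabs (P u v) <= M0 * decay tau u /\ Rabs (Q u v) <= M0 * decay tau u).
  { intros u v Hv. assert (Hg := decay_pos tau u).
    destruct (Rle_dec R0 (Cmod (mkC u v))) as [Hz|Hz].
    - assert (HD : Dsector rho0 th0 (mkC u v)).
      { unfold Dsector. simpl. generalize (Rmax_l rho0 (tan th0 * Rabs u)). lra. }
      specialize (HK _ HD Hz). destruct (Cmod_bounds (F (mkC u v))) as [c1 c2].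
      assert (Hm : Cmod (F (mkC u v)) <= Rabs K * (Rpower (1 + / R0) (1 + tau) * decay tau u)).
      { eapply Rle_trans; [exact HK|].
        apply Rle_trans with (Rabs K * Rpower (Cmod (mkC u v)) (-1 - tau)).
        - apply Rmult_le_compat_r; [left; apply exp_pos|apply Rle_abs].
        - apply Rmult_le_compat_l; [apply Rabs_pos|]. apply decay_le; try lra.
          destruct (Cmod_bounds (mkC u v)) as [c3 _]; simpl in c3.
          assert (1 <= / R0 * Cmod (mkC u v)).
          { rewrite <- (Rinv_l R0) by lra. apply Rmult_le_compat_l; lra. }
          lra. }
      assert (Rabs K * (Rpower (1 + / R0) (1 + tau) * decay tau u) <= M0 * decay tau u).
      { rewrite <- Rmult_assoc. apply Rmult_le_compat_r; [lra|]. unfold M0. lra. }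
      unfold P, Q, re_part, im_part. lra.
    - assert (Hu : Rabs u <= R0).
      { destruct (Cmod_bounds (mkC u v)) as [c3 _]; simpl in c3. lra. }
      destruct (HBd u v) as [b1 b2]; [apply Rabs_le_between; lra|apply Rabs_le_between; lra|].
      assert (h := decay_le tau u 1 (1 + R0) Htau Rlt_0_1 ltac:(lra) ltac:(lra)).
      unfold Rpower at 1 in h. rewrite ln_1, Rmult_0_r, exp_0 in h.
      assert (B <= M0 * decay tau u).
      { apply Rle_trans with (B * (Rpower (1 + R0) (1 + tau) * decay tau u)).
        - rewrite <- (Rmult_1_r B) at 1. apply Rmult_le_compat_l; lra.
        - rewrite <- Rmult_assoc. apply Rmult_le_compat_r; [lra|]. unfold M0. lra. }
      lra. }
  assert (HP2 : 0 < Rpower 2 (1 + tau)) by apply exp_pos.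
  set (M1 := M0 * Rpower 2 (1 + tau)).
  assert (HM1 : 0 <= M1) by (apply Rmult_le_pos; [unfold M0|]; lra).
  assert (Hdisc : forall x th, Rabs (P (x + r * cos th) (r * sin th)) <= M1 * decay tau x /\
                               Rabs (Q (x + r * cos th) (r * sin th)) <= M1 * decay tau x).
  { intros x th.
    assert (hc : Rabs (cos th) <= 1) by (apply Rabs_le; apply COS_bound).
    assert (hs : Rabs (sin th) <= 1) by (apply Rabs_le; apply SIN_bound).
    destruct (Hstrip (x + r * cos th) (r * sin th)) as [s1 s2].
    { rewrite Rabs_mult, (Rabs_pos_eq r) by lra. nra. }
    assert (M0 * decay tau (x + r * cos th) <= M1 * decay tau x).
    { unfold M1. rewrite Rmult_assoc. apply Rmult_le_compat_l; [unfold M0; lra|].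
      apply decay_le; [lra| |lra|].
      - generalize (Rabs_pos (x + r * cos th)). lra.
      - assert (Rabs x <= Rabs (x + r * cos th) + 1 / 2).
        { replace x with ((x + r * cos th) + - (r * cos th)) at 1 by ring.
          eapply Rle_trans; [apply Rabs_triang|].
          rewrite Rabs_Ropp, Rabs_mult, (Rabs_pos_eq r) by lra. nra. }
        generalize (Rabs_pos (x + r * cos th)). lra. }
    lra. }
  (* The 2 is that of the Cauchy estimate; the added 1 turns 0 <= M1 into strict positivity. *)
  exists (fun n x => fn n x / INR (fact n)), r, (2 * M1 + 1), tau.
  split; [lra|]. split; [lra|]. split; [lra|]. split; [|split].
  - intros x. rewrite Hf0. simpl. field.
  - intros n x. generalize (INR_fact_neq_0 n) (INR_fact_neq_0 (S n)); intros q1 q2.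
    assert (q3 : INR (S n) <> 0) by (apply not_0_INR; lia).
    replace (INR (S n) * (fn (S n) x / INR (fact (S n)))) with (/ INR (fact n) * fn (S n) x).
    + apply (is_derive_ext (fun y => / INR (fact n) * fn n y)); [intros y; apply Rmult_comm|].
      apply (is_derive_scal (fn n)). apply is_derive_Reals, Hfn.
    + rewrite fact_simpl, mult_INR. field. split; assumption.
  - intros n x.
    destruct (cauchy_taylor P Q x r rho0 (M1 * decay tau x)) as (a & Ha & Hs); [lra|assumption|assumption|apply Hdisc|].
    rewrite (taylor_coefficient A fn a x (2 * (M1 * decay tau x)) r).
    + replace (a n * INR (fact n) / INR (fact n)) with (a n) by (field; apply INR_fact_neq_0).
      eapply Rle_trans; [apply Ha|]. apply Rmult_le_compat_r.
      * left. apply Rinv_0_lt_compat, pow_lt; lra.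
      * assert (Hg := decay_pos tau x). nra.
    + lra.
    + assumption.
    + intros k y. apply is_derive_Reals, Hfn.
    + assumption.
    + intros h Hh. rewrite <- HP0. now apply Hs.
Qed.

(** * Taylor coefficients of solutions *)

(** Course-of-values recursion: through the Cauchy product, the coefficient of index n + 1 depends
    on all earlier ones. The table of stage n is meaningful for indices up to n. *)
Fixpoint course_aux {X : Type} (x0 : X) (step : (nat -> X) -> nat -> X) (n : nat) : nat -> X :=
  match n with
  | O => fun _ => x0
  | S m => fun k => if Nat.leb k m then course_aux x0 step m k else step (course_aux x0 step m) m
  end.
Definition course {X : Type} (x0 : X) (step : (nat -> X) -> nat -> X) (n : nat) : X :=
  course_aux x0 step n n.

Lemma course_S {X : Type} (x0 : X) (step : (nat -> X) -> nat -> X) :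
  (forall f g n, (forall k, (k <= n)%nat -> f k = g k) -> step f n = step g n) ->
  forall n, course x0 step (S n) = step (course x0 step) n.
Proof.
  intros Hext.
  assert (H : forall n k, (k <= n)%nat -> course_aux x0 step n k = course x0 step k).
  { induction n as [|n IH]; intros k Hk.
    - replace k with 0%nat by lia. reflexivity.
    - destruct (Nat.eq_dec k (S n)) as [->|Hne]; [reflexivity|].
      simpl. replace (Nat.leb k n) with true by (symmetry; apply Nat.leb_le; lia). apply IH. lia. }
  intros n. unfold course at 1. simpl.
  replace (match n with O => false | S m' => Nat.leb n m' end) with false.
  2:{ destruct n; [reflexivity|]. symmetry. apply Nat.leb_gt. lia. }
  apply Hext. intros k Hk. now apply H.
Qed.

Lemma is_derive_sum_f (f : nat -> R -> R) (l : nat -> R) (N : nat) (x : R) :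
  (forall k, (k <= N)%nat -> is_derive (f k) x (l k)) ->
  is_derive (fun y => sum_f_R0 (fun k => f k y) N) x (sum_f_R0 l N).
Proof.
  induction N as [|N IH]; intros H; simpl.
  - apply H. lia.
  - apply (is_derive_plus (V := R_NormedModule) (fun y => sum_f_R0 (fun k => f k y) N) (f (S N))).
    + apply IH. intros k Hk. apply H. lia.
    + apply H. lia.
Qed.

(** The product rule in terms of coefficients: split N + 1 as i + (N + 1 - i) in each term of the
    Cauchy product and shift the index in one of the two sums. *)
Lemma conv_derivative_identity (a b : nat -> R) (N : nat) :
  sum_f_R0 (fun k => INR (S k) * a (S k) * b (N - k)%nat + a k * (INR (S (N - k)) * b (S (N - k)))) N
  = INR (S N) * PS_mult a b (S N).
Proof.
  unfold PS_mult. rewrite scal_sum.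
  rewrite (sum_eq (fun i => a i * b (S N - i)%nat * INR (S N))
     (fun i => INR i * a i * b (S N - i)%nat + INR (S N - i) * a i * b (S N - i)%nat)).
  2:{ intros i Hi. rewrite minus_INR by assumption. ring. }
  rewrite !sum_plus. f_equal.
  - rewrite (decomp_sum (fun i => INR i * a i * b (S N - i)%nat)) by lia. simpl pred.
    rewrite Rmult_0_l, Rmult_0_l, Rplus_0_l. apply sum_eq. intros i Hi. reflexivity.
  - rewrite tech5, Nat.sub_diag. simpl (INR 0). rewrite !Rmult_0_l, Rplus_0_r.
    apply sum_eq. intros i Hi. rewrite Nat.sub_succ_l by assumption. ring.
Qed.

(* The relation a_n' = (n+1) a_{n+1} expresses that the a_n(x) are the Taylor
   coefficients at x of a function; it passes to Cauchy products. *)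
Lemma conv_derive (a b : nat -> R -> R) (N : nat) (x : R) :
  (forall k, (k <= N)%nat -> is_derive (a k) x (INR (S k) * a (S k) x)) ->
  (forall k, (k <= N)%nat -> is_derive (b k) x (INR (S k) * b (S k) x)) ->
  is_derive (fun y => PS_mult (fun k => a k y) (fun k => b k y) N) x
    (INR (S N) * PS_mult (fun k => a k x) (fun k => b k x) (S N)).
Proof.
  intros Ha Hb. rewrite <- conv_derivative_identity. unfold PS_mult.
  apply (is_derive_sum_f (fun k y => a k y * b (N - k)%nat y)).
  intros k Hk.
  apply (is_derive_mult (a k) (b (N - k)%nat) x (INR (S k) * a (S k) x) (INR (S (N - k)) * b (S (N - k)) x)).
  - now apply Ha.
  - apply Hb. lia.
  - intros; apply Rmult_comm.
Qed.

Lemma conv_ext (a b c : nat -> R) n : (forall k, (k <= n)%nat -> b k = c k) -> PS_mult a b n = PS_mult a c n.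
Proof. intros H. unfold PS_mult. apply sum_eq. intros i Hi. rewrite H by lia. reflexivity. Qed.

(* The system for u = (p + i q, s + i t). *)
Definition ode4 (A p q s t : R -> R) (lam eps : R) : Prop := forall x,
  is_derive p x ((lam * q x + A x * s x) / eps) /\
  is_derive q x ((- lam * p x + A x * t x) / eps) /\
  is_derive s x ((- lam * t x - A x * p x) / eps) /\
  is_derive t x ((lam * s x - A x * q x) / eps).

(** The recursion will say that the extension solves the equation in the complex variable; the
    derivative relations tie together the series at different real centres. *)
Definition taylor4 (An pn qn sn tn : nat -> R -> R) (lam eps : R) : Prop := forall n x,
  (INR (S n) * pn (S n) x = (lam * qn n x + PS_mult (fun k => An k x) (fun k => sn k x) n) / eps /\
   INR (S n) * qn (S n) x = (- lam * pn n x + PS_mult (fun k => An k x) (fun k => tn k x) n) / eps /\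
   INR (S n) * sn (S n) x = (- lam * tn n x - PS_mult (fun k => An k x) (fun k => pn k x) n) / eps /\
   INR (S n) * tn (S n) x = (lam * sn n x - PS_mult (fun k => An k x) (fun k => qn k x) n) / eps) /\
  (is_derive (pn n) x (INR (S n) * pn (S n) x) /\
   is_derive (qn n) x (INR (S n) * qn (S n) x) /\
   is_derive (sn n) x (INR (S n) * sn (S n) x) /\
   is_derive (tn n) x (INR (S n) * tn (S n) x)).

(** The coefficients are defined by the recursion. The derivative relation then follows by
    induction: index 0 is the equation itself, and differentiating the recursion at n gives the
    relation at n + 1. *)
Lemma taylor4_exists (An : nat -> R -> R) (p q s t : R -> R) (lam eps : R) :
  0 < eps ->
  (forall n x, is_derive (An n) x (INR (S n) * An (S n) x)) ->
  ode4 (An 0%nat) p q s t lam eps ->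
  exists pn qn sn tn : nat -> R -> R,
    pn 0%nat = p /\ qn 0%nat = q /\ sn 0%nat = s /\ tn 0%nat = t /\ taylor4 An pn qn sn tn lam eps.
Proof.
  intros Heps HA Hode.
  set (step := fun x (f : nat -> R * R * R * R) n =>
    let p := fun k => fst (fst (fst (f k))) in let q := fun k => snd (fst (fst (f k))) in
    let s := fun k => snd (fst (f k)) in let t := fun k => snd (f k) in
    let a := fun k => An k x in
    ((lam * q n + PS_mult a s n) / eps / INR (S n),
     (- lam * p n + PS_mult a t n) / eps / INR (S n),
     (- lam * t n - PS_mult a p n) / eps / INR (S n),
     (lam * s n - PS_mult a q n) / eps / INR (S n))).
  set (F := fun x => course (p x, q x, s x, t x) (step x)).
  assert (HF : forall x n, F x (S n) = step x (F x) n).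
  { intros x. apply course_S. intros f g n Hfg. unfold step.
    rewrite (Hfg n) by lia.
    rewrite (conv_ext _ (fun k => snd (fst (f k))) (fun k => snd (fst (g k))) n) by (intros k Hk; now rewrite Hfg).
    rewrite (conv_ext _ (fun k => snd (f k)) (fun k => snd (g k)) n) by (intros k Hk; now rewrite Hfg).
    rewrite (conv_ext _ (fun k => fst (fst (fst (f k)))) (fun k => fst (fst (fst (g k)))) n) by (intros k Hk; now rewrite Hfg).
    rewrite (conv_ext _ (fun k => snd (fst (fst (f k)))) (fun k => snd (fst (fst (g k)))) n) by (intros k Hk; now rewrite Hfg).
    reflexivity. }
  set (pn := fun n x => fst (fst (fst (F x n)))). set (qn := fun n x => snd (fst (fst (F x n)))).
  set (sn := fun n x => snd (fst (F x n))). set (tn := fun n x => snd (F x n)).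
  exists pn, qn, sn, tn. repeat (split; [reflexivity|]).
  assert (Hrec : forall n x,
   INR (S n) * pn (S n) x = (lam * qn n x + PS_mult (fun k => An k x) (fun k => sn k x) n) / eps /\
   INR (S n) * qn (S n) x = (- lam * pn n x + PS_mult (fun k => An k x) (fun k => tn k x) n) / eps /\
   INR (S n) * sn (S n) x = (- lam * tn n x - PS_mult (fun k => An k x) (fun k => pn k x) n) / eps /\
   INR (S n) * tn (S n) x = (lam * sn n x - PS_mult (fun k => An k x) (fun k => qn k x) n) / eps).
  { intros n x. assert (Hn : INR (S n) <> 0) by (apply not_0_INR; lia).
    change (pn (S n) x) with (fst (fst (fst (F x (S n))))). change (qn (S n) x) with (snd (fst (fst (F x (S n))))).
    change (sn (S n) x) with (snd (fst (F x (S n)))). change (tn (S n) x) with (snd (F x (S n))). rewrite HF. unfold step. cbn [fst snd].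
    fold (pn n x) (qn n x) (sn n x) (tn n x).
    repeat split; unfold Rdiv; rewrite <- Rmult_assoc, (Rmult_comm (INR (S n))), Rmult_assoc, Rinv_r, Rmult_1_r by assumption; reflexivity. }
  assert (Hder : forall n k, (k <= n)%nat -> forall x,
   is_derive (pn k) x (INR (S k) * pn (S k) x) /\ is_derive (qn k) x (INR (S k) * qn (S k) x) /\
   is_derive (sn k) x (INR (S k) * sn (S k) x) /\ is_derive (tn k) x (INR (S k) * tn (S k) x)).
  { induction n as [|n IH]; intros k Hk x.
    - replace k with 0%nat by lia. destruct (Hrec 0%nat x) as (-> & -> & -> & ->).
      apply Hode.
    - destruct (Nat.eq_dec k (S n)) as [->|Hne]; [|apply IH; lia].
      destruct (IH n ltac:(lia) x) as (d1 & d2 & d3 & d4).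
      assert (Hn : INR (S n) <> 0) by (apply not_0_INR; lia).
      assert (C : forall bn : nat -> R -> R, (forall k, (k <= n)%nat -> is_derive (bn k) x (INR (S k) * bn (S k) x)) ->
        is_derive (fun y => PS_mult (fun k => An k y) (fun k => bn k y) n) x
           (INR (S n) * PS_mult (fun k => An k x) (fun k => bn k x) (S n))).
      { intros bn Hbn. apply conv_derive; auto. }
      assert (c1 := C sn (fun k Hk => proj1 (proj2 (proj2 (IH k Hk x))))).
      assert (c2 := C tn (fun k Hk => proj2 (proj2 (proj2 (IH k Hk x))))).
      assert (c3 := C pn (fun k Hk => proj1 (IH k Hk x))).
      assert (c4 := C qn (fun k Hk => proj1 (proj2 (IH k Hk x)))).
      destruct (Hrec (S n) x) as (e1 & e2 & e3 & e4). rewrite e1, e2, e3, e4.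
      (* The derivatives of both inputs carry the factor n + 1, which cancels the n + 1 on the left
         of the recursion. *)
      assert (LIN : forall (f g h : R -> R) (l f' g' : R) , (forall y, INR (S n) * h y = (l * f y + g y) / eps) ->
         is_derive f x (INR (S n) * f') -> is_derive g x (INR (S n) * g') -> is_derive h x ((l * f' + g') / eps)).
      { intros f g h l f' g' E Hf Hg.
        apply (is_derive_ext (fun y => (/ eps * / INR (S n)) * (l * f y + g y))).
        - intros y. apply Rmult_eq_reg_l with (INR (S n)); [|assumption]. rewrite E. field. repeat split; try assumption; lra.
        - replace ((l * f' + g') / eps) with ((/ eps * / INR (S n)) * (l * (INR (S n) * f') + INR (S n) * g')) by (field; repeat split; try assumption; lra).
          apply (is_derive_scal (fun y => l * f y + g y)).
          apply (is_derive_plus (V := R_NormedModule) (fun y => l * f y) g); [|assumption].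
          now apply (is_derive_scal f). }
      assert (OPP : forall (g : R -> R) g', is_derive g x (INR (S n) * g') -> is_derive (fun y => - g y) x (INR (S n) * - g')).
      { intros g g' Hg. replace (INR (S n) * - g') with (- (INR (S n) * g')) by ring. now apply (is_derive_opp (V := R_NormedModule) g). }
      split; [|split; [|split]].
      + apply (LIN _ _ _ lam _ _ (fun y => proj1 (Hrec n y)) d2 c1).
      + apply (LIN _ _ _ (- lam) _ _ (fun y => proj1 (proj2 (Hrec n y))) d1 c2).
      + apply (LIN _ _ _ (- lam) _ _ (fun y => proj1 (proj2 (proj2 (Hrec n y)))) d4 (OPP _ _ c3)).
      + apply (LIN _ _ _ lam _ _ (fun y => proj2 (proj2 (proj2 (Hrec n y)))) d3 (OPP _ _ c4)). }
  intros n x. split; [apply Hrec|apply (Hder n n (Nat.le_refl n))].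
Qed.

(** Factors D / k below 1 are replaced by 1, so that the sequence is monotone and dominates a
    running maximum; it becomes constant once k exceeds D. *)
Fixpoint majorant (D : R) (n : nat) : R :=
  match n with O => 1 | S k => majorant D k * Rmax 1 (D / INR (S k)) end.

Lemma sum_half n : sum_f_R0 (fun k => (/ 2) ^ k) n <= 2.
Proof.
  assert (H : sum_f_R0 (fun k => (/ 2) ^ k) n = 2 - (/ 2) ^ n).
  { induction n as [|n IH]; simpl in *; [field|]. rewrite IH. field. }
  rewrite H. assert (0 < (/ 2) ^ n) by (apply pow_lt; lra). lra.
Qed.

(* Multiplying by (r/2)^n turns the recursion into one whose right-hand side is
   at most L r times the running maximum, so that the growth factor L r / n is
   harmless once n > L r. *)
Lemma geometric_growth (L r : R) : 0 < L -> 0 < r -> exists C, 0 < C /\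
  forall m : nat -> R, (forall n, 0 <= m n) ->
  (forall n, INR (S n) * m (S n) <= L * sum_f_R0 (fun k => m (n - k)%nat / r ^ k) n) ->
  forall n, m n <= C * m 0%nat / (r / 2) ^ n.
Proof.
  intros HL Hr. set (D := L * r). assert (HD : 0 < D) by (apply Rmult_lt_0_compat; assumption).
  assert (Hpos : forall n, 1 <= majorant D n).
  { induction n as [|n IH]; simpl; [lra|]. assert (h := Rmax_l 1 (D / match n with O => 1 | S _ => INR n + 1 end)). nra. }
  assert (Hmono : forall n k, majorant D n <= majorant D (n + k)).
  { intros n k. induction k as [|k IH]; [rewrite Nat.add_0_r; lra|]. rewrite Nat.add_succ_r.
    cbn [majorant]. assert (h := Rmax_l 1 (D / INR (S (n + k)))). generalize (Hpos (n + k)%nat). nra. }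
  destruct (nfloor_ex D) as [N0 HN0]; [lra|].
  assert (Hstop : forall k, majorant D (S N0 + k) = majorant D (S N0)).
  { induction k as [|k IH]; [now rewrite Nat.add_0_r|]. rewrite Nat.add_succ_r. cbn [majorant].
    rewrite IH. rewrite Rmax_left; [cbn [majorant]; ring|].
    assert (INR N0 + 1 <= INR (S (S N0 + k))) by (rewrite <- S_INR; apply le_INR; lia).
    assert (h : 0 < INR (S (S N0 + k))) by (apply lt_0_INR; lia).
    apply Rmult_le_reg_r with (INR (S (S N0 + k))); [assumption|]. unfold Rdiv.
    rewrite Rmult_assoc, Rinv_l by lra. lra. }
  exists (majorant D (S N0)). split; [generalize (Hpos (S N0)); lra|].
  intros m Hm Hrec.
  assert (Hle : forall n, majorant D n <= majorant D (S N0)).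
  { intros n. destruct (Nat.le_ge_cases n (S N0)) as [h|h].
    - replace (S N0) with (n + (S N0 - n))%nat by lia. apply Hmono.
    - replace n with (S N0 + (n - S N0))%nat by lia. rewrite Hstop. lra. }
  assert (Hp : forall n, 0 < (r / 2) ^ n) by (intros; apply pow_lt; lra).
  assert (Hb : forall n k, (k <= n)%nat -> m k * (r / 2) ^ k <= majorant D k * m 0%nat).
  { induction n as [|n IH]; intros k Hk.
    - replace k with 0%nat by lia. simpl. lra.
    - destruct (Nat.eq_dec k (S n)) as [->|Hne]; [|apply IH; lia].
      assert (Hn : 0 < INR (S n)) by (apply lt_0_INR; lia).
      assert (S1 : sum_f_R0 (fun k => m (n - k)%nat / r ^ k) n * (r / 2) ^ n <= 2 * (majorant D n * m 0%nat)).
      { rewrite Rmult_comm, scal_sum.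
        apply Rle_trans with (sum_f_R0 (fun k => (/ 2) ^ k * (majorant D n * m 0%nat)) n).
        - apply sum_Rle. intros j Hj.
          assert (Hrj : 0 < r ^ j) by (apply pow_lt; lra).
          replace (m (n - j)%nat / r ^ j * (r / 2) ^ n) with ((/ 2) ^ j * (m (n - j)%nat * (r / 2) ^ (n - j))).
          2:{ replace ((r / 2) ^ n) with ((r / 2) ^ (n - j) * (r / 2) ^ j) by (rewrite <- pow_add; f_equal; lia).
              replace ((r / 2) ^ j) with (r ^ j * (/ 2) ^ j) by (rewrite <- Rpow_mult_distr; reflexivity).
              field. lra. }
          apply Rmult_le_compat_l; [left; apply pow_lt; lra|].
          eapply Rle_trans; [apply IH; lia|]. apply Rmult_le_compat_r; [apply Hm|].
          replace n with (n - j + j)%nat at 2 by lia. apply Hmono.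
        - rewrite <- (scal_sum (fun k => (/ 2) ^ k) n (majorant D n * m 0%nat)). rewrite Rmult_comm.
          apply Rmult_le_compat_r; [|apply sum_half].
          apply Rmult_le_pos; [generalize (Hpos n); lra|apply Hm]. }
      assert (S2 : INR (S n) * (m (S n) * (r / 2) ^ S n) <= D * (majorant D n * m 0%nat)).
      { replace (INR (S n) * (m (S n) * (r / 2) ^ S n)) with (INR (S n) * m (S n) * ((r / 2) ^ n * (r / 2))) by (simpl pow; ring).
        apply Rle_trans with (L * sum_f_R0 (fun k => m (n - k)%nat / r ^ k) n * ((r / 2) ^ n * (r / 2))).
        - apply Rmult_le_compat_r; [|apply Hrec]. generalize (Hp n); intros; apply Rmult_le_pos; lra.
        - replace (L * sum_f_R0 (fun k => m (n - k)%nat / r ^ k) n * ((r / 2) ^ n * (r / 2))) with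
            (D / 2 * (sum_f_R0 (fun k => m (n - k)%nat / r ^ k) n * (r / 2) ^ n)) by (unfold D; field).
          replace (D * (majorant D n * m 0%nat)) with (D / 2 * (2 * (majorant D n * m 0%nat))) by field.
          apply Rmult_le_compat_l; [lra|assumption]. }
      apply Rmult_le_reg_l with (INR (S n)); [assumption|].
      eapply Rle_trans; [exact S2|]. cbn [majorant].
      replace (D * (majorant D n * m 0%nat)) with (INR (S n) * (D / INR (S n) * (majorant D n * m 0%nat))) by (field; lra).
      apply Rmult_le_compat_l; [lra|].
      replace (majorant D n * Rmax 1 (D / INR (S n)) * m 0%nat) with (Rmax 1 (D / INR (S n)) * (majorant D n * m 0%nat)) by ring.
      apply Rmult_le_compat_r; [|apply Rmax_r].
      apply Rmult_le_pos; [generalize (Hpos n); lra|apply Hm]. }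
  intros n. apply Rmult_le_reg_r with ((r / 2) ^ n); [apply Hp|].
  replace (majorant D (S N0) * m 0%nat / (r / 2) ^ n * (r / 2) ^ n) with (majorant D (S N0) * m 0%nat).
  2:{ generalize (Hp n). generalize ((r / 2) ^ n). intros w Hw. field. lra. }
  eapply Rle_trans; [apply (Hb n n); lia|]. apply Rmult_le_compat_r; [apply Hm|apply Hle].
Qed.

Lemma conv_bound (a b : nat -> R) (M r : R) n : 0 < r -> (forall k, Rabs (a k) <= M / r ^ k) ->
  Rabs (PS_mult a b n) <= M * sum_f_R0 (fun k => Rabs (b (n - k)%nat) / r ^ k) n.
Proof.
  intros Hr Ha. unfold PS_mult. eapply Rle_trans; [apply Rsum_abs|]. rewrite scal_sum.
  apply sum_Rle. intros k _. rewrite Rabs_mult.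
  replace (Rabs (b (n - k)%nat) / r ^ k * M) with (M / r ^ k * Rabs (b (n - k)%nat)).
  - apply Rmult_le_compat_r; [apply Rabs_pos|apply Ha].
  - field. apply pow_nonzero; lra.
Qed.

(** C is uniform in x because [geometric_growth] fixes its constant before the sequence. It depends
    on lam and eps through the Lipschitz-type constant [L]; the radius r / 2 does not. *)
Lemma taylor4_bound (An pn qn sn tn : nat -> R -> R) (lam eps M r : R) :
  0 < eps -> 0 < M -> 0 < r -> (forall n x, Rabs (An n x) <= M / r ^ n) ->
  taylor4 An pn qn sn tn lam eps ->
  exists C, 0 < C /\ forall n x,
    Rabs (pn n x) + Rabs (qn n x) + Rabs (sn n x) + Rabs (tn n x)
    <= C * (Rabs (pn 0%nat x) + Rabs (qn 0%nat x) + Rabs (sn 0%nat x) + Rabs (tn 0%nat x)) / (r / 2) ^ n.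
Proof.
  intros Heps HM Hr HA HT.
  set (L := (Rabs lam + M) / eps).
  assert (HL : 0 < L) by (apply Rdiv_lt_0_compat; [generalize (Rabs_pos lam)|]; lra).
  destruct (geometric_growth L r HL Hr) as (C & HC & H). exists C. split; [assumption|].
  intros n x. apply (H (fun n => Rabs (pn n x) + Rabs (qn n x) + Rabs (sn n x) + Rabs (tn n x))).
  { intros k. generalize (Rabs_pos (pn k x)) (Rabs_pos (qn k x)) (Rabs_pos (sn k x)) (Rabs_pos (tn k x)). lra. }
  clear n. intros n. destruct (HT n x) as ((e1 & e2 & e3 & e4) & _).
  assert (Hn : 0 < INR (S n)) by (apply lt_0_INR; lia).
  set (a := fun k => An k x). assert (Ha : forall k, Rabs (a k) <= M / r ^ k) by (intros; apply HA).
  set (cp := sum_f_R0 (fun k => Rabs (pn (n - k)%nat x) / r ^ k) n).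
  set (cq := sum_f_R0 (fun k => Rabs (qn (n - k)%nat x) / r ^ k) n).
  set (cs := sum_f_R0 (fun k => Rabs (sn (n - k)%nat x) / r ^ k) n).
  set (ct := sum_f_R0 (fun k => Rabs (tn (n - k)%nat x) / r ^ k) n).
  assert (E : sum_f_R0 (fun k => (Rabs (pn (n - k)%nat x) + Rabs (qn (n - k)%nat x) + Rabs (sn (n - k)%nat x) + Rabs (tn (n - k)%nat x)) / r ^ k) n = cp + cq + cs + ct).
  { unfold cp, cq, cs, ct. rewrite <- !sum_plus. apply sum_eq. intros i _. field. apply pow_nonzero; lra. }
  (* The term with factor lam is absorbed as the summand k = 0 of the convolution. *)
  assert (F : forall b : nat -> R, Rabs (b n) <= sum_f_R0 (fun k => Rabs (b (n - k)%nat) / r ^ k) n).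
  { intros b. assert (forall N, (N <= n)%nat -> Rabs (b n) <= sum_f_R0 (fun k => Rabs (b (n - k)%nat) / r ^ k) N).
    { induction N as [|N IH]; intros HN; simpl.
      - rewrite Nat.sub_0_r. lra.
      - assert (0 <= Rabs (b (n - S N)%nat) / (r * r ^ N)).
        { apply Rmult_le_pos; [apply Rabs_pos|]. left. apply Rinv_0_lt_compat. apply (pow_lt r (S N)). lra. }
        specialize (IH ltac:(lia)). lra. }
    apply H0. lia. }
  assert (B : forall l u v w cu cv, l = lam \/ l = - lam -> INR (S n) * u = (l * v + w) / eps ->
     Rabs v <= cu -> Rabs w <= M * cv -> INR (S n) * Rabs u <= (Rabs lam * cu + M * cv) / eps).
  { intros l u v w cu cv Hl Eu Hv Hw. rewrite <- (Rabs_pos_eq (INR (S n))) by lra.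
    rewrite <- Rabs_mult, Eu. unfold Rdiv. rewrite Rabs_mult, (Rabs_pos_eq (/ eps)) by (left; apply Rinv_0_lt_compat; lra).
    apply Rmult_le_compat_r; [left; apply Rinv_0_lt_compat; lra|].
    eapply Rle_trans; [apply Rabs_triang|]. rewrite Rabs_mult.
    replace (Rabs l) with (Rabs lam) by (destruct Hl as [-> | ->]; [|rewrite Rabs_Ropp]; reflexivity).
    assert (Rabs lam * Rabs v <= Rabs lam * cu) by (apply Rmult_le_compat_l; [apply Rabs_pos|assumption]). lra. }
  assert (b1 := B lam _ _ _ cq cs (or_introl eq_refl) e1 (F (fun k => qn k x)) (conv_bound a (fun k => sn k x) M r n Hr Ha)).
  assert (b2 := B (- lam) _ _ _ cp ct (or_intror eq_refl) e2 (F (fun k => pn k x)) (conv_bound a (fun k => tn k x) M r n Hr Ha)).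
  assert (b3 := B (- lam) _ _ _ ct cp (or_intror eq_refl) e3 (F (fun k => tn k x)) ltac:(rewrite Rabs_Ropp; apply (conv_bound a (fun k => pn k x) M r n Hr Ha))).
  assert (b4 := B lam _ _ _ cs cq (or_introl eq_refl) e4 (F (fun k => sn k x)) ltac:(rewrite Rabs_Ropp; apply (conv_bound a (fun k => qn k x) M r n Hr Ha))).
  cbv beta. rewrite E. unfold L.
  replace ((Rabs lam + M) / eps * (cp + cq + cs + ct)) with ((Rabs lam * cq + M * cs) / eps + (Rabs lam * cp + M * ct) / eps + (Rabs lam * ct + M * cp) / eps + (Rabs lam * cs + M * cq) / eps) by (field; lra).
  lra.
Qed.

(** * Holomorphic extension from the real axis *)

(** A tail of the series is Lipschitz with the tail of m as constant, so its difference quotient and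
    its formal derivative are both below e / 4; the finite part is differentiated directly. *)
Lemma is_derive_Series (f f' : nat -> R -> R) (m : nat -> R) :
  (forall n x, is_derive (f n) x (f' n x)) -> (forall n x, Rabs (f' n x) <= m n) ->
  ex_series m -> (forall x, ex_series (fun n => f n x)) ->
  forall x, is_derive (fun x => Series (fun n => f n x)) x (Series (fun n => f' n x)).
Proof.
  intros Hd Hm Hs Hf x.
  assert (Hf' : ex_series (fun n => f' n x)).
  { apply (ex_series_le (V := R_CompleteNormedModule)) with m; [|assumption]. intros n. apply Hm. }
  apply is_derive_Reals. intros e He.
  assert (Hlip : forall n a b, Rabs (f n b - f n a) <= m n * Rabs (b - a)).
  { intros n a b. apply (bounded_variation (f n) (f' n)). intros u _. split; [apply Hd|apply Hm]. }
  assert (Hm0 : forall n, 0 <= m n) by (intros n; apply Rle_trans with (2 := Hm n x); apply Rabs_pos).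
  assert (Htail : exists N, Series (fun k => m (S N + k)%nat) < e / 4).
  { assert (H : is_lim_seq (sum_n m) (Series m)) by exact (Series_correct _ Hs). apply is_lim_seq_spec in H.
    destruct (H (mkposreal (e / 4) ltac:(lra))) as [N HN]. exists N. specialize (HN N (Nat.le_refl _)).
    simpl in HN. rewrite (Series_incr_n m (S N)) in HN by (lia || assumption). simpl pred in HN.
    rewrite sum_n_Reals in HN. apply Rabs_def2 in HN. lra. }
  destruct Htail as [N HN].
  assert (HD : is_derive (fun y => sum_f_R0 (fun k => f k y) N) x (sum_f_R0 (fun k => f' k x) N)).
  { apply is_derive_sum_f. intros; apply Hd. }
  apply is_derive_Reals in HD. destruct (HD (e / 4)) as [d Hd']; [lra|].
  exists d. intros h Hh Hhd. specialize (Hd' h Hh Hhd).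
  rewrite (Series_incr_n (fun n => f n (x + h)) (S N)), (Series_incr_n (fun n => f n x) (S N)),
    (Series_incr_n (fun n => f' n x) (S N)) by (lia || apply Hf || apply Hf').
  simpl pred.
  assert (Xt : forall u : nat -> R, ex_series u -> ex_series (fun k => u (S N + k)%nat)).
  { intros u Hu. now apply (ex_series_incr_n u (S N)). }
  set (T1 := Series (fun k => f (S N + k)%nat (x + h))). set (T0 := Series (fun k => f (S N + k)%nat x)).
  set (T' := Series (fun k => f' (S N + k)%nat x)). set (mt := Series (fun k => m (S N + k)%nat)) in *.
  assert (B1 : Rabs (T1 - T0) <= mt * Rabs h).
  { unfold T1, T0, mt. rewrite <- (Series_minus _ _ (Xt _ (Hf (x + h))) (Xt _ (Hf x))). rewrite <- Series_scal_r.
    assert (hb : forall k, Rabs (f (S N + k)%nat (x + h) - f (S N + k)%nat x) <= m (S N + k)%nat * Rabs h).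
    { intros k. replace h with (x + h - x) at 2 by ring. apply Hlip. }
    assert (hx : ex_series (fun k => m (S N + k)%nat * Rabs h)).
    { apply (ex_series_scal_r (Rabs h) (fun k => m (S N + k)%nat)). exact (Xt _ Hs). }
    eapply Rle_trans; [apply Series_Rabs|].
    - apply (ex_series_le (V := R_CompleteNormedModule)) with (2 := hx). intros k.
      unfold norm; simpl. unfold abs; simpl. rewrite Rabs_Rabsolu. apply hb.
    - apply Series_le; [|exact hx]. intros k. split; [apply Rabs_pos|apply hb]. }
  assert (B2 : Rabs T' <= mt).
  { unfold T', mt. eapply Rle_trans; [apply Series_Rabs|].
    - apply (ex_series_le (V := R_CompleteNormedModule)) with (2 := Xt _ Hs). intros k.
      unfold norm; simpl. unfold abs; simpl. rewrite Rabs_Rabsolu. apply Hm.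
    - apply Series_le; [|exact (Xt _ Hs)]. intros k. split; [apply Rabs_pos|apply Hm]. }
  set (F1 := sum_f_R0 (fun n => f n (x + h)) N) in *. set (F0 := sum_f_R0 (fun n => f n x) N) in *.
  set (F' := sum_f_R0 (fun n => f' n x) N) in *.
  replace ((F1 + T1 - (F0 + T0)) / h - (F' + T')) with (((F1 - F0) / h - F') + ((T1 - T0) / h + - T')) by (field; assumption).
  eapply Rle_lt_trans; [apply Rabs_triang|].
  assert (B3 : Rabs ((T1 - T0) / h) <= mt).
  { unfold Rdiv. rewrite Rabs_mult, Rabs_inv. apply Rmult_le_reg_r with (Rabs h); [now apply Rabs_pos_lt|].
    rewrite Rmult_assoc, Rinv_l, Rmult_1_r by now apply Rabs_no_R0. assumption. }
  assert (B4 := Rabs_triang ((T1 - T0) / h) (- T')). rewrite Rabs_Ropp in B4. lra.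
Qed.

Lemma INR_S_le_pow2 n : INR (S n) <= 2 ^ n.
Proof.
  induction n as [|n IH]; [simpl; lra|]. rewrite S_INR. assert (1 <= 2 ^ n) by (apply pow_R1_Rle; lra).
  simpl pow. lra.
Qed.

(** The factor n + 1 <= 2^n is paid for with half of the radius. *)
Lemma geometric_bound_derive (a : nat -> R) (C r : R) : 0 < r -> (forall n, Rabs (a n) <= C / r ^ n) ->
  forall n, Rabs (PS_derive a n) <= (C / r) / (r / 2) ^ n.
Proof.
  intros Hr Ha n. unfold PS_derive. rewrite Rabs_mult, (Rabs_pos_eq (INR (S n))) by apply pos_INR.
  assert (HC : 0 <= C) by (generalize (Ha 0%nat) (Rabs_pos (a 0%nat)); simpl; lra).
  assert (Hp : 0 < r ^ n) by (apply pow_lt; lra). assert (H2 : 0 < 2 ^ n) by (apply pow_lt; lra).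
  apply Rle_trans with (2 ^ n * (C / r ^ S n)).
  - apply Rmult_le_compat; [apply pos_INR|apply Rabs_pos|apply INR_S_le_pow2|apply Ha].
  - right. unfold Rdiv at 4. rewrite Rpow_mult_distr, pow_inv. simpl pow. field. lra.
Qed.

(** For |y| <= r / 2 the terms are dominated by C / 2^n, whose sum is 2 C; removing two terms
    extracts (y / r)^2. The second bound is the source of every O(y0^2) error in the energy
    estimate. *)
Lemma PSeries_bounds (c : nat -> R) (C r y : R) : 0 < r -> Rabs y <= r / 2 ->
  (forall n, Rabs (c n) <= C / r ^ n) ->
  Rabs (PSeries c y) <= 2 * C /\ Rabs (PSeries c y - c 0%nat - c 1%nat * y) <= 2 * C * (y / r) ^ 2.
Proof.
  intros Hr Hy Hc.
  assert (HC : 0 <= C) by (generalize (Hc 0%nat) (Rabs_pos (c 0%nat)); simpl; lra).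
  assert (Hq : Rabs y / r <= 1 / 2).
  { apply Rmult_le_reg_r with r; [lra|]. unfold Rdiv. rewrite Rmult_assoc, Rinv_l by lra. lra. }
  assert (Hb : forall n, Rabs (c n * y ^ n) <= C * (1 / 2) ^ n).
  { intros n. rewrite Rabs_mult, <- RPow_abs.
    assert (Hp : 0 < r ^ n) by (apply pow_lt; lra).
    apply Rle_trans with (C / r ^ n * Rabs y ^ n).
    - apply Rmult_le_compat_r; [apply pow_le, Rabs_pos|apply Hc].
    - replace (C / r ^ n * Rabs y ^ n) with (C * (Rabs y / r) ^ n).
      + apply Rmult_le_compat_l; [assumption|]. apply pow_incr. split; [|assumption].
        apply Rmult_le_pos; [apply Rabs_pos|left; apply Rinv_0_lt_compat; lra].
      + unfold Rdiv. rewrite Rpow_mult_distr, pow_inv. ring. }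
  assert (HG : is_series (fun n => (1 / 2) ^ n) 2).
  { assert (h := is_series_geom (1 / 2) ltac:(rewrite Rabs_pos_eq; lra)).
    replace (/ (1 - 1 / 2)) with 2 in h by field. exact h. }
  assert (Bnd : forall (u : nat -> R) K, 0 <= K -> (forall n, Rabs (u n) <= K * (1 / 2) ^ n) -> ex_series u /\ Rabs (Series u) <= 2 * K).
  { intros u K HK Hu.
    assert (hx : is_series (fun n => K * (1 / 2) ^ n) (K * 2)) by (apply (is_series_scal_l K _ 2 HG)).
    assert (hx' : ex_series (fun n => K * (1 / 2) ^ n)) by (eexists; exact hx).
    split.
    - apply (ex_series_le (V := R_CompleteNormedModule)) with (2 := hx'). apply Hu.
    - replace (2 * K) with (Series (fun n => K * (1 / 2) ^ n)) by (rewrite (is_series_unique _ _ hx); ring).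
      eapply Rle_trans; [apply Series_Rabs|].
      + apply (ex_series_le (V := R_CompleteNormedModule)) with (2 := hx'). intros k.
        unfold norm; simpl. unfold abs; simpl. rewrite Rabs_Rabsolu. apply Hu.
      + apply Series_le; [|exact hx']. intros k. split; [apply Rabs_pos|apply Hu]. }
  destruct (Bnd (fun n => c n * y ^ n) C HC Hb) as [X1 X2].
  split; [exact X2|].
  unfold PSeries. rewrite (Series_incr_n _ 2) by (lia || assumption).
  replace (sum_f_R0 (fun n => c n * y ^ n) (pred 2)) with (c 0%nat + c 1%nat * y) by (simpl; ring).
  replace (c 0%nat + c 1%nat * y + Series (fun k => c (2 + k)%nat * y ^ (2 + k)) - c 0%nat - c 1%nat * y)
    with (Series (fun k => c (2 + k)%nat * y ^ (2 + k))) by ring.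
  replace (2 * C * (y / r) ^ 2) with (2 * (C * (y / r) ^ 2)) by ring.
  apply Bnd.
  - apply Rmult_le_pos; [assumption|apply pow2_ge_0].
  - intros n. rewrite Rabs_mult, <- RPow_abs, pow_add.
    assert (Hp : 0 < r ^ n) by (apply pow_lt; lra).
    apply Rle_trans with (C / r ^ (2 + n) * (Rabs y ^ 2 * Rabs y ^ n)).
    + apply Rmult_le_compat_r; [|apply Hc]. apply Rmult_le_pos; apply pow_le, Rabs_pos.
    + replace (C / r ^ (2 + n) * (Rabs y ^ 2 * Rabs y ^ n)) with (C * (y / r) ^ 2 * (Rabs y / r) ^ n).
      * apply Rmult_le_compat_l; [apply Rmult_le_pos; [assumption|apply pow2_ge_0]|]. apply pow_incr. split; [|assumption].
        apply Rmult_le_pos; [apply Rabs_pos|left; apply Rinv_0_lt_compat; lra].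
      * rewrite pow2_abs, pow_add. unfold Rdiv. rewrite !Rpow_mult_distr, !pow_inv. field. lra.
Qed.

(** Writing the powers of i with cosine and sine, rather than splitting by parity, reduces products
    to the addition formulas and index shifts to a quarter turn. *)
Definition re_seq (a : nat -> R) (n : nat) : R := cos (INR n * (PI / 2)) * a n.
Definition im_seq (a : nat -> R) (n : nat) : R := sin (INR n * (PI / 2)) * a n.

(* Real and imaginary parts of sum a_n (i y)^n: the holomorphic extension to x + iy
   of a real function whose Taylor coefficients at x are a_n. *)
Definition ext_re (a : nat -> R) (y : R) : R := PSeries (re_seq a) y.
Definition ext_im (a : nat -> R) (y : R) : R := PSeries (im_seq a) y.

Lemma re_im_seq_bound (a : nat -> R) n : Rabs (re_seq a n) <= Rabs (a n) /\ Rabs (im_seq a n) <= Rabs (a n).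
Proof.
  assert (Rabs (cos (INR n * (PI / 2))) <= 1) by (apply Rabs_le; apply COS_bound).
  assert (Rabs (sin (INR n * (PI / 2))) <= 1) by (apply Rabs_le; apply SIN_bound).
  unfold re_seq, im_seq. rewrite !Rabs_mult. generalize (Rabs_pos (a n)). split; nra.
Qed.

Lemma quarter_turn n : cos (INR (S n) * (PI / 2)) = - sin (INR n * (PI / 2)) /\
  sin (INR (S n) * (PI / 2)) = cos (INR n * (PI / 2)).
Proof.
  rewrite S_INR, Rmult_plus_distr_r, Rmult_1_l, cos_plus, sin_plus, cos_PI2, sin_PI2. split; ring.
Qed.

Lemma ext_radius (a : nat -> R) (C r y : R) : 0 < r -> Rabs y < r -> (forall n, Rabs (a n) <= C / r ^ n) ->
  Rbar_lt (Rabs y) (CV_radius (re_seq a)) /\ Rbar_lt (Rabs y) (CV_radius (im_seq a)).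
Proof.
  intros Hr Hy Ha. split; (apply Rbar_lt_le_trans with r; [exact Hy|]); apply (CV_radius_ge _ C); auto;
    intros n; destruct (re_im_seq_bound a n); generalize (Ha n); lra.
Qed.

Lemma ext_bounds (a : nat -> R) (C r y : R) : 0 < r -> Rabs y <= r / 2 -> (forall n, Rabs (a n) <= C / r ^ n) ->
  Rabs (ext_re a y) <= 2 * C /\ Rabs (ext_im a y) <= 2 * C /\
  Rabs (ext_re a y - a 0%nat) <= 2 * C * (y / r) ^ 2 /\
  Rabs (ext_im a y - a 1%nat * y) <= 2 * C * (y / r) ^ 2.
Proof.
  intros Hr Hy Ha.
  destruct (PSeries_bounds (re_seq a) C r y Hr Hy) as [h1 h2].
  { intros n. destruct (re_im_seq_bound a n); generalize (Ha n); lra. }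
  destruct (PSeries_bounds (im_seq a) C r y Hr Hy) as [h3 h4].
  { intros n. destruct (re_im_seq_bound a n); generalize (Ha n); lra. }
  unfold re_seq at 2 3 in h2. unfold im_seq at 2 3 in h4. simpl INR in h2, h4.
  rewrite Rmult_0_l, Rmult_1_l, cos_0, cos_PI2 in h2. rewrite Rmult_0_l, Rmult_1_l, sin_0, sin_PI2 in h4.
  repeat split; [assumption|assumption| |]; unfold ext_re, ext_im.
  - replace (PSeries (re_seq a) y - a 0%nat) with (PSeries (re_seq a) y - 1 * a 0%nat - 0 * a 1%nat * y) by ring. assumption.
  - replace (PSeries (im_seq a) y - a 1%nat * y) with (PSeries (im_seq a) y - 0 * a 0%nat - 1 * a 1%nat * y) by ring. assumption.
Qed.

(** Each term of the Cauchy product is split by i^n = i^k i^(n - k). *)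
Lemma ext_mult (a b : nat -> R) (C r y : R) : 0 < r -> Rabs y < r ->
  (forall n, Rabs (a n) <= C / r ^ n) -> (forall n, Rabs (b n) <= C / r ^ n) ->
  ext_re (PS_mult a b) y = ext_re a y * ext_re b y - ext_im a y * ext_im b y /\
  ext_im (PS_mult a b) y = ext_re a y * ext_im b y + ext_im a y * ext_re b y.
Proof.
  intros Hr Hy Ha Hb.
  destruct (ext_radius a C r y Hr Hy Ha) as [a1 a2]. destruct (ext_radius b C r y Hr Hy Hb) as [b1 b2].
  assert (Split : forall n k, (k <= n)%nat -> INR n * (PI / 2) = INR k * (PI / 2) + INR (n - k) * (PI / 2)).
  { intros n k Hk. rewrite minus_INR by assumption. ring. }
  unfold ext_re, ext_im. rewrite <- !PSeries_mult by assumption. split.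
  - rewrite <- PSeries_minus by (apply ex_pseries_mult; assumption).
    apply PSeries_ext. intros n. unfold PS_minus, PS_plus, PS_opp, plus, opp; simpl.
    unfold re_seq at 1. unfold PS_mult. rewrite scal_sum.
    rewrite <- (Rmult_1_l (- _)), Rmult_comm with (r1 := 1). rewrite Rmult_1_r.
    apply Rminus_diag_uniq.
    match goal with |- ?u - (?v + - ?w) = 0 => replace (u - (v + - w)) with (u - (v - w)) by ring end.
    rewrite <- minus_sum. apply Rminus_diag_eq. apply sum_eq. intros k Hk.
    unfold re_seq, im_seq. rewrite (Split n k Hk), cos_plus. ring.
  - rewrite <- PSeries_plus by (apply ex_pseries_mult; assumption).
    apply PSeries_ext. intros n. unfold PS_plus, plus; simpl.
    unfold im_seq at 1. unfold PS_mult. rewrite scal_sum, <- sum_plus. apply sum_eq. intros k Hk.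
    unfold re_seq, im_seq. rewrite (Split n k Hk), sin_plus. ring.
Qed.

Lemma ext_lin (a b : nat -> R) (C r y l m : R) : 0 < r -> Rabs y < r ->
  (forall n, Rabs (a n) <= C / r ^ n) -> Rbar_lt (Rabs y) (CV_radius (re_seq b)) -> Rbar_lt (Rabs y) (CV_radius (im_seq b)) ->
  ext_re (fun n => l * a n + m * b n) y = l * ext_re a y + m * ext_re b y /\
  ext_im (fun n => l * a n + m * b n) y = l * ext_im a y + m * ext_im b y.
Proof.
  intros Hr Hy Ha Hb1 Hb2.
  destruct (ext_radius a C r y Hr Hy Ha) as [a1 a2].
  unfold ext_re, ext_im. rewrite <- !PSeries_scal.
  split; rewrite <- PSeries_plus.
  - apply PSeries_ext. intros n. unfold PS_plus, PS_scal, plus, scal, re_seq; simpl. unfold mult; simpl. ring.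
  - apply ex_pseries_scal; [apply Rmult_comm|]. now apply CV_radius_inside.
  - apply ex_pseries_scal; [apply Rmult_comm|]. now apply CV_radius_inside.
  - apply PSeries_ext. intros n. unfold PS_plus, PS_scal, plus, scal, im_seq; simpl. unfold mult; simpl. ring.
  - apply ex_pseries_scal; [apply Rmult_comm|]. now apply CV_radius_inside.
  - apply ex_pseries_scal; [apply Rmult_comm|]. now apply CV_radius_inside.
Qed.

(** This is d/dy F(x + i y) = i F'(x + i y), with the factor i coming from the index shift. *)
Lemma ext_derive_vertical (a : nat -> R) (C r y : R) : 0 < r -> Rabs y < r ->
  (forall n, Rabs (a n) <= C / r ^ n) ->
  is_derive (ext_re a) y (- ext_im (PS_derive a) y) /\ is_derive (ext_im a) y (ext_re (PS_derive a) y).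
Proof.
  intros Hr Hy Ha. destruct (ext_radius a C r y Hr Hy Ha) as [a1 a2]. split.
  - replace (- ext_im (PS_derive a) y) with (PSeries (PS_derive (re_seq a)) y); [now apply is_derive_PSeries|].
    unfold ext_im. rewrite <- PSeries_opp. apply PSeries_ext. intros n.
    unfold PS_derive, PS_opp, opp, re_seq, im_seq, PS_derive; simpl opp. destruct (quarter_turn n) as [-> _]. simpl opp. unfold opp; simpl. ring.
  - replace (ext_re (PS_derive a) y) with (PSeries (PS_derive (im_seq a)) y); [now apply is_derive_PSeries|].
    apply PSeries_ext. intros n.
    unfold PS_derive, re_seq, im_seq, PS_derive. destruct (quarter_turn n) as [_ ->]. ring.
Qed.

(* Applied with w_n = cos (n pi/2) and w_n = sin (n pi/2), the real and imaginary
   parts of i^n. *)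
Lemma weighted_series_derive (w : nat -> R) (a : nat -> R -> R) (y dy : R -> R) (C r Y : R) :
  0 < r -> 0 <= Y -> (forall n, Rabs (w n) <= 1) ->
  (forall n x, is_derive (a n) x (INR (S n) * a (S n) x)) ->
  (forall n x, Rabs (a n x) <= C / r ^ n) ->
  (forall x, is_derive y x (dy x)) -> (forall x, Rabs (y x) <= r / 4) -> (forall x, Rabs (dy x) <= Y) ->
  forall x, is_derive (fun x => PSeries (fun n => w n * a n x) (y x)) x
    (PSeries (fun n => w n * PS_derive (fun k => a k x) n) (y x)
     + dy x * PSeries (fun n => w (S n) * PS_derive (fun k => a k x) n) (y x)).
Proof.
  intros Hr HY Hw Ha HC Hy Hyr HdY x.
  assert (HC0 : 0 <= C) by (generalize (HC 0%nat x) (Rabs_pos (a 0%nat x)); simpl; lra).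
  set (f := fun n x => w n * a n x * y x ^ n).
  set (f' := fun n x => w n * (INR (S n) * a (S n) x) * y x ^ n + dy x * (w n * a n x * (INR n * y x ^ pred n))).
  (* Here |y| <= r / 4 is used: n + 1 <= 2^n against (1 / 4)^n still leaves (1 / 2)^n. The summand
     with Y majorises the term containing the derivative of y. *)
  set (m := fun n => (C / r + 4 * C * Y / r) * (1 / 2) ^ n).
  assert (Hrinv : 0 < / r) by (apply Rinv_0_lt_compat; lra).
  assert (Hder : forall n x, is_derive (f n) x (f' n x)).
  { intros n z. unfold f, f'.
    replace (w n * (INR (S n) * a (S n) z) * y z ^ n + dy z * (w n * a n z * (INR n * y z ^ pred n)))
      with ((w n * (INR (S n) * a (S n) z)) * y z ^ n + (w n * a n z) * (INR n * dy z * y z ^ pred n)) by ring.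
    apply (is_derive_mult (fun z => w n * a n z) (fun z => y z ^ n)).
    - apply (is_derive_scal (a n)). apply Ha.
    - apply (is_derive_pow y n z (dy z)). apply Hy.
    - intros; apply Rmult_comm. }
  assert (Hpow : forall n z, Rabs (y z ^ n) <= (r / 4) ^ n).
  { intros n z. rewrite <- RPow_abs. apply pow_incr. split; [apply Rabs_pos|apply Hyr]. }
  assert (Hbound : forall n x, Rabs (f' n x) <= m n).
  { intros n z. unfold f', m. eapply Rle_trans; [apply Rabs_triang|].
    rewrite Rmult_plus_distr_r. apply Rplus_le_compat.
    - rewrite !Rabs_mult, (Rabs_pos_eq (INR (S n))) by apply pos_INR.
      apply Rle_trans with ((1 * (2 ^ n * (C / r ^ S n))) * (r / 4) ^ n).
      + apply Rmult_le_compat; [|apply Rabs_pos| |apply Hpow].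
        * apply Rmult_le_pos; [apply Rabs_pos|]. apply Rmult_le_pos; [apply pos_INR|apply Rabs_pos].
        * apply Rmult_le_compat; [apply Rabs_pos| |apply Hw|].
          -- apply Rmult_le_pos; [apply pos_INR|apply Rabs_pos].
          -- apply Rmult_le_compat; [apply pos_INR|apply Rabs_pos|apply INR_S_le_pow2|apply HC].
      + right. assert (0 < r ^ n) by (apply pow_lt; lra).
        replace ((r / 4) ^ n) with (r ^ n * (1 / 2) ^ n * (1 / 2) ^ n) by (rewrite <- !Rpow_mult_distr; f_equal; field).
        simpl pow at 2. replace ((1 / 2) ^ n) with (/ 2 ^ n) by (rewrite <- pow_inv; f_equal; field).
        field. split; [apply pow_nonzero|split]; lra.
    - destruct n as [|n].
      + simpl. rewrite !Rmult_0_l, !Rmult_0_r, Rabs_R0. rewrite Rmult_1_r. apply Rmult_le_pos; [|lra]. apply Rmult_le_pos; [|lra]. lra.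
      + rewrite !Rabs_mult, (Rabs_pos_eq (INR (S n))) by apply pos_INR. simpl pred.
        apply Rle_trans with (Y * (1 * (C / r ^ S n) * (2 ^ n * (r / 4) ^ n))).
        * apply Rmult_le_compat; [apply Rabs_pos| |apply HdY|].
          -- apply Rmult_le_pos; [apply Rmult_le_pos; apply Rabs_pos|]. apply Rmult_le_pos; [apply pos_INR|apply Rabs_pos].
          -- apply Rmult_le_compat; [apply Rmult_le_pos; apply Rabs_pos| | |].
             ++ apply Rmult_le_pos; [apply pos_INR|apply Rabs_pos].
             ++ apply Rmult_le_compat; [apply Rabs_pos|apply Rabs_pos|apply Hw|apply HC].
             ++ apply Rmult_le_compat; [apply pos_INR|apply Rabs_pos|apply INR_S_le_pow2|apply Hpow].
        * assert (Hp : 0 < r ^ n) by (apply pow_lt; lra). assert (H2 : 0 < 2 ^ n) by (apply pow_lt; lra).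
          replace ((r / 4) ^ n) with (r ^ n * (1 / 2) ^ n * (1 / 2) ^ n) by (rewrite <- !Rpow_mult_distr; f_equal; field).
          simpl pow. replace ((1 / 2) ^ n) with (/ 2 ^ n) by (rewrite <- pow_inv; f_equal; field).
          replace (Y * (1 * (C / (r * r ^ n)) * (2 ^ n * (r ^ n * / 2 ^ n * / 2 ^ n)))) with (C * Y / r * / 2 ^ n) by (field; lra).
          replace (4 * C * Y / r * (1 / 2 * / 2 ^ n)) with (2 * (C * Y / r * / 2 ^ n)) by (field; lra).
          assert (0 <= C * Y / r * / 2 ^ n).
          { apply Rmult_le_pos; [|left; apply Rinv_0_lt_compat; lra]. apply Rmult_le_pos; [|lra]. now apply Rmult_le_pos. }
          lra. }
  assert (Hm : ex_series m).
  { apply (ex_series_scal_l (C / r + 4 * C * Y / r) (fun n => (1 / 2) ^ n)). apply ex_series_geom. rewrite Rabs_pos_eq; lra. }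
  assert (Wb : forall (v b : nat -> R), (forall n, Rabs (v n) <= 1) -> forall n, Rabs (v n * b n) <= Rabs (b n)).
  { intros v b Hv n. rewrite Rabs_mult. rewrite <- (Rmult_1_l (Rabs (b n))) at 2. apply Rmult_le_compat_r; [apply Rabs_pos|apply Hv]. }
  assert (Hsum : forall z, ex_series (fun n => f n z)).
  { intros z. assert (h : ex_pseries (fun n => w n * a n z) (y z)).
    { apply CV_radius_inside. apply Rbar_lt_le_trans with r.
      - simpl. generalize (Hyr z). lra.
      - apply (CV_radius_ge _ C); [assumption|]. intros n. eapply Rle_trans; [apply (Wb w (fun n => a n z) Hw)|apply HC]. }
    apply ex_pseries_R in h. exact h. }
  assert (G := is_derive_Series f f' m Hder Hbound Hm Hsum x).
  replace (PSeries (fun n => w n * PS_derive (fun k => a k x) n) (y x)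
     + dy x * PSeries (fun n => w (S n) * PS_derive (fun k => a k x) n) (y x)) with (Series (fun n => f' n x)).
  { exact G. }
  assert (Xd : forall v : nat -> R, (forall n, Rabs (v n) <= 1) -> ex_series (fun n => v n * PS_derive (fun k => a k x) n * y x ^ n)).
  { intros v Hv. apply ex_pseries_R. apply CV_radius_inside. apply Rbar_lt_le_trans with (r / 2).
    - simpl. generalize (Hyr x). lra.
    - apply (CV_radius_ge _ (C / r)); [lra|]. intros n. eapply Rle_trans; [apply (Wb v _ Hv)|].
      apply geometric_bound_derive; [assumption|]. intros k. apply HC. }
  assert (Xs : ex_series (fun n => w n * a n x * (INR n * y x ^ pred n))).
  { apply ex_series_incr_1.
    assert (E : forall n, w (S n) * PS_derive (fun k => a k x) n * y x ^ n = w (S n) * a (S n) x * (INR (S n) * y x ^ pred (S n))).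
    { intros n. unfold PS_derive. simpl pred. ring. }
    exact (ex_series_ext _ _ E (Xd (fun n => w (S n)) (fun n => Hw (S n)))). }
  unfold f'. rewrite Series_plus; [|apply (Xd w Hw)|exact (ex_series_scal_l (dy x) _ Xs)].
  f_equal. rewrite Series_scal_l. f_equal.
  rewrite Series_incr_1 by assumption. simpl (INR 0). rewrite Rmult_0_l, Rmult_0_r, Rplus_0_l.
  apply Series_ext. intros n. unfold PS_derive. simpl pred. ring.
Qed.

(** This is d/dx F(x + i y(x)) = (1 + i y') F'(x + i y(x)). The centre and the increment move
    together, and the relation a_n' = (n + 1) a_{n+1} makes both contributions values of the same
    F'. *)
Lemma ext_derive_along (a : nat -> R -> R) (y dy : R -> R) (C r Y : R) :
  0 < r -> 0 <= Y ->
  (forall n x, is_derive (a n) x (INR (S n) * a (S n) x)) ->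
  (forall n x, Rabs (a n x) <= C / r ^ n) ->
  (forall x, is_derive y x (dy x)) -> (forall x, Rabs (y x) <= r / 4) -> (forall x, Rabs (dy x) <= Y) ->
  forall x, let b := PS_derive (fun k => a k x) in
    is_derive (fun x => ext_re (fun k => a k x) (y x)) x (ext_re b (y x) - dy x * ext_im b (y x)) /\
    is_derive (fun x => ext_im (fun k => a k x) (y x)) x (ext_im b (y x) + dy x * ext_re b (y x)).
Proof.
  intros Hr HY Ha HC Hy Hyr HdY x b.
  assert (h1 := weighted_series_derive (fun n => cos (INR n * (PI / 2))) a y dy C r Y Hr HY
    (fun n => Rabs_le _ _ (COS_bound _)) Ha HC Hy Hyr HdY x).
  assert (h2 := weighted_series_derive (fun n => sin (INR n * (PI / 2))) a y dy C r Y Hr HY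
    (fun n => Rabs_le _ _ (SIN_bound _)) Ha HC Hy Hyr HdY x).
  split.
  - replace (ext_re b (y x) - dy x * ext_im b (y x)) with (PSeries (fun n => cos (INR n * (PI / 2)) * b n) (y x)
       + dy x * PSeries (fun n => cos (INR (S n) * (PI / 2)) * b n) (y x)); [exact h1|].
    unfold ext_re, ext_im, Rminus. f_equal. rewrite Ropp_mult_distr_r. f_equal.
    rewrite <- PSeries_opp. apply PSeries_ext. intros n. destruct (quarter_turn n) as [-> _].
    unfold PS_opp, im_seq, opp; simpl. ring.
  - replace (ext_im b (y x) + dy x * ext_re b (y x)) with (PSeries (fun n => sin (INR n * (PI / 2)) * b n) (y x)
       + dy x * PSeries (fun n => sin (INR (S n) * (PI / 2)) * b n) (y x)); [exact h2|].
    unfold ext_re, ext_im. f_equal. f_equal. apply PSeries_ext. intros n. destruct (quarter_turn n) as [_ ->]. reflexivity.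
Qed.

(* The generic lemmas of Coquelicot leave equations in a carrier that [field] does not recognise. *)
Ltac eq_in_R := match goal with |- @eq _ ?a ?b => change (@eq R a b) end.

(* Real and imaginary parts of the extension of p + i q, where p and q are real on
   the real axis. *)
Definition val_re (pn qn : nat -> R -> R) (x y : R) : R :=
  ext_re (fun k => pn k x) y - ext_im (fun k => qn k x) y.
Definition val_im (pn qn : nat -> R -> R) (x y : R) : R :=
  ext_im (fun k => pn k x) y + ext_re (fun k => qn k x) y.

Lemma ext_ext (a b : nat -> R) y : (forall n, a n = b n) -> ext_re a y = ext_re b y /\ ext_im a y = ext_im b y.
Proof. intros H. split; apply PSeries_ext; intros n; unfold re_seq, im_seq; now rewrite H. Qed.

Lemma ext_rhs (a f g : nat -> R) (C r y l m : R) : 0 < r -> Rabs y < r ->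
  (forall n, Rabs (a n) <= C / r ^ n) -> (forall n, Rabs (f n) <= C / r ^ n) -> (forall n, Rabs (g n) <= C / r ^ n) ->
  ext_re (fun n => l * f n + m * PS_mult a g n) y = l * ext_re f y + m * (ext_re a y * ext_re g y - ext_im a y * ext_im g y) /\
  ext_im (fun n => l * f n + m * PS_mult a g n) y = l * ext_im f y + m * (ext_re a y * ext_im g y + ext_im a y * ext_re g y).
Proof.
  intros Hr Hy Ha Hf Hg.
  destruct (ext_mult a g C r y Hr Hy Ha Hg) as [<- <-].
  (* A Cauchy product of two sequences of order r^(-n) may carry an extra factor n + 1, so its
     geometric bound is taken at a radius strictly between |y| and r. *)
  set (r' := (Rabs y + r) / 2).
  assert (Hr' : Rabs y < r' < r) by (unfold r'; lra).
  assert (Hy0 := Rabs_pos y).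
  assert (Hb : exists C', forall n, Rabs (PS_mult a g n) <= C' / r' ^ n).
  { assert (X : ex_series (fun n => PS_mult a g n * r' ^ n)).
    { apply ex_pseries_R. apply ex_pseries_mult; (rewrite Rabs_pos_eq by lra);
      (apply Rbar_lt_le_trans with r; [simpl; lra|]); now apply (CV_radius_ge _ C). }
    assert (L := ex_series_lim_0 _ X).
    destruct (filterlim_bounded (K := R_AbsRing) (V := R_NormedModule) (fun n => PS_mult a g n * r' ^ n)) as [M HM].
    { exists 0. exact L. }
    exists M. intros n. assert (Hp : 0 < r' ^ n) by (apply pow_lt; lra).
    specialize (HM n). unfold norm in HM; simpl in HM. unfold abs in HM; simpl in HM.
    rewrite Rabs_mult, (Rabs_pos_eq (r' ^ n)) in HM by lra.
    apply Rmult_le_reg_r with (r' ^ n); [assumption|].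
    replace (M / r' ^ n * r' ^ n) with M by (field; lra). assumption. }
  destruct Hb as [C' HC'].
  destruct (ext_radius (PS_mult a g) C' r' y ltac:(lra) ltac:(lra) HC') as [c1 c2].
  now apply (ext_lin f (PS_mult a g) C r y l m).
Qed.

(** Summing the recursion against (i y)^n: its left side becomes the complex derivative and its
    convolutions become complex products with the extended potential. *)
Lemma ext_taylor4 (An pn qn sn tn : nat -> R -> R) (lam eps C r x y : R) :
  0 < eps -> 0 < r -> Rabs y < r -> taylor4 An pn qn sn tn lam eps ->
  (forall n, Rabs (An n x) <= C / r ^ n) ->
  (forall n, Rabs (pn n x) <= C / r ^ n /\ Rabs (qn n x) <= C / r ^ n /\
             Rabs (sn n x) <= C / r ^ n /\ Rabs (tn n x) <= C / r ^ n) ->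
  let Fr := fun f : nat -> R -> R => ext_re (fun k => f k x) y in
  let Fi := fun f : nat -> R -> R => ext_im (fun k => f k x) y in
  let Dr := fun f : nat -> R -> R => ext_re (PS_derive (fun k => f k x)) y in
  let Di := fun f : nat -> R -> R => ext_im (PS_derive (fun k => f k x)) y in
  (Dr pn = (lam * Fr qn + (Fr An * Fr sn - Fi An * Fi sn)) / eps /\
   Di pn = (lam * Fi qn + (Fr An * Fi sn + Fi An * Fr sn)) / eps) /\
  (Dr qn = (- lam * Fr pn + (Fr An * Fr tn - Fi An * Fi tn)) / eps /\
   Di qn = (- lam * Fi pn + (Fr An * Fi tn + Fi An * Fr tn)) / eps) /\
  (Dr sn = (- lam * Fr tn - (Fr An * Fr pn - Fi An * Fi pn)) / eps /\
   Di sn = (- lam * Fi tn - (Fr An * Fi pn + Fi An * Fr pn)) / eps) /\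
  (Dr tn = (lam * Fr sn - (Fr An * Fr qn - Fi An * Fi qn)) / eps /\
   Di tn = (lam * Fi sn - (Fr An * Fi qn + Fi An * Fr qn)) / eps).
Proof.
  intros Heps Hr Hy HT HA Hb Fr Fi Dr Di.
  assert (G : forall (u f g : nat -> R -> R) l m,
    (forall n, INR (S n) * u (S n) x = l / eps * f n x + m / eps * PS_mult (fun k => An k x) (fun k => g k x) n) ->
    (forall n, Rabs (f n x) <= C / r ^ n) -> (forall n, Rabs (g n x) <= C / r ^ n) ->
    Dr u = (l * Fr f + m * (Fr An * Fr g - Fi An * Fi g)) / eps /\
    Di u = (l * Fi f + m * (Fr An * Fi g + Fi An * Fr g)) / eps).
  { intros u f g l m E Hf Hg.
    destruct (ext_ext (PS_derive (fun k => u k x)) (fun n => l / eps * f n x + m / eps * PS_mult (fun k => An k x) (fun k => g k x) n) y E) as [e1 e2].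
    destruct (ext_rhs (fun k => An k x) (fun k => f k x) (fun k => g k x) C r y (l / eps) (m / eps) Hr Hy HA Hf Hg) as [e3 e4].
    unfold Dr, Di. rewrite e1, e2, e3, e4. unfold Fr, Fi. split; field; lra. }
  split; [|split; [|split]].
  - destruct (G pn qn sn lam 1) as [h1 h2]; try (intros n; apply Hb).
    + intros n. destruct (HT n x) as ((e & _) & _). rewrite e. field. lra.
    + rewrite h1, h2. split; field; lra.
  - destruct (G qn pn tn (- lam) 1) as [h1 h2]; try (intros n; apply Hb).
    + intros n. destruct (HT n x) as ((_ & e & _) & _). rewrite e. field. lra.
    + rewrite h1, h2. split; field; lra.
  - destruct (G sn tn pn (- lam) (-1)) as [h1 h2]; try (intros n; apply Hb).
    + intros n. destruct (HT n x) as ((_ & _ & e & _) & _). rewrite e. field. lra.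
    + rewrite h1, h2. split; field; lra.
  - destruct (G tn sn qn lam (-1)) as [h1 h2]; try (intros n; apply Hb).
    + intros n. destruct (HT n x) as ((_ & _ & _ & e) & _). rewrite e. field. lra.
    + rewrite h1, h2. split; field; lra.
Qed.

Lemma is_derive_Rplus (f g : R -> R) x a b : is_derive f x a -> is_derive g x b -> is_derive (fun t => f t + g t) x (a + b).
Proof. exact (is_derive_plus (V := R_NormedModule) f g x a b). Qed.
Lemma is_derive_Rminus (f g : R -> R) x a b : is_derive f x a -> is_derive g x b -> is_derive (fun t => f t - g t) x (a - b).
Proof. exact (is_derive_minus (V := R_NormedModule) f g x a b). Qed.
Lemma is_derive_Rmult (f g : R -> R) x a b : is_derive f x a -> is_derive g x b -> is_derive (fun t => f t * g t) x (a * g x + f x * b).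
Proof. intros Hf Hg. apply (is_derive_mult f g x a b Hf Hg). intros; apply Rmult_comm. Qed.
Lemma is_derive_eq (f : R -> R) x a b : is_derive f x a -> a = b -> is_derive f x b.
Proof. now intros H <-. Qed.

(* The components v1 and v2 of u(x + i y(x)) solve the system multiplied by 1 + i y',
   and be + i ga = (1 + i y') A(x + i y). *)
Lemma extension_along (An pn qn sn tn : nat -> R -> R) (lam eps C r Y : R) (y dy : R -> R) :
  0 < eps -> 0 < r -> 0 <= Y -> taylor4 An pn qn sn tn lam eps ->
  (forall n x, Rabs (An n x) <= C / r ^ n) ->
  (forall n x, Rabs (pn n x) <= C / r ^ n /\ Rabs (qn n x) <= C / r ^ n /\
             Rabs (sn n x) <= C / r ^ n /\ Rabs (tn n x) <= C / r ^ n) ->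
  (forall x, is_derive y x (dy x)) -> (forall x, Rabs (y x) <= r / 4) -> (forall x, Rabs (dy x) <= Y) ->
  forall x,
  let ar := ext_re (fun k => An k x) (y x) in let ai := ext_im (fun k => An k x) (y x) in
  let be := ar - dy x * ai in let ga := ai + dy x * ar in
  let v1r := val_re pn qn x (y x) in let v1i := val_im pn qn x (y x) in
  let v2r := val_re sn tn x (y x) in let v2i := val_im sn tn x (y x) in
  is_derive (fun x => val_re pn qn x (y x)) x ((lam * dy x * v1r + lam * v1i + be * v2r - ga * v2i) / eps) /\
  is_derive (fun x => val_im pn qn x (y x)) x ((lam * dy x * v1i - lam * v1r + be * v2i + ga * v2r) / eps) /\
  is_derive (fun x => val_re sn tn x (y x)) x ((- lam * dy x * v2r - lam * v2i - be * v1r + ga * v1i) / eps) /\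
  is_derive (fun x => val_im sn tn x (y x)) x ((- lam * dy x * v2i + lam * v2r - be * v1i - ga * v1r) / eps).
Proof.
  intros Heps Hr HY HT HA Hb Hy Hyr HdY x ar ai be ga v1r v1i v2r v2i.
  assert (Hyx : Rabs (y x) < r) by (generalize (Hyr x); lra).
  destruct (ext_taylor4 An pn qn sn tn lam eps C r x (y x) Heps Hr Hyx HT (fun n => HA n x) (fun n => Hb n x))
    as ((P1 & P2) & (Q1 & Q2) & (S1 & S2) & (T1 & T2)).
  destruct (ext_derive_along pn y dy C r Y Hr HY (fun n z => proj1 (proj2 (HT n z))) (fun n z => proj1 (Hb n z)) Hy Hyr HdY x) as [p1 p2].
  destruct (ext_derive_along qn y dy C r Y Hr HY (fun n z => proj1 (proj2 (proj2 (HT n z)))) (fun n z => proj1 (proj2 (Hb n z))) Hy Hyr HdY x) as [q1 q2].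
  destruct (ext_derive_along sn y dy C r Y Hr HY (fun n z => proj1 (proj2 (proj2 (proj2 (HT n z))))) (fun n z => proj1 (proj2 (proj2 (Hb n z)))) Hy Hyr HdY x) as [s1 s2].
  destruct (ext_derive_along tn y dy C r Y Hr HY (fun n z => proj2 (proj2 (proj2 (proj2 (HT n z))))) (fun n z => proj2 (proj2 (proj2 (Hb n z)))) Hy Hyr HdY x) as [t1 t2].
  rewrite P1, P2 in p1, p2. rewrite Q1, Q2 in q1, q2. rewrite S1, S2 in s1, s2. rewrite T1, T2 in t1, t2.
  unfold v1r, v1i, v2r, v2i, be, ga, ar, ai, val_re, val_im.
  split; [|split; [|split]].
  - apply (is_derive_eq _ _ _ _ (is_derive_Rminus _ _ _ _ _ p1 q2)). eq_in_R. field. lra.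
  - apply (is_derive_eq _ _ _ _ (is_derive_Rplus _ _ _ _ _ p2 q1)). eq_in_R. field. lra.
  - apply (is_derive_eq _ _ _ _ (is_derive_Rminus _ _ _ _ _ s1 t2)). eq_in_R. field. lra.
  - apply (is_derive_eq _ _ _ _ (is_derive_Rplus _ _ _ _ _ s2 t1)). eq_in_R. field. lra.
Qed.

(** The complex equation multiplied by i. It carries information from the real axis to height y at a
    fixed abscissa. *)
Lemma extension_vertical (An pn qn sn tn : nat -> R -> R) (lam eps C r x y : R) :
  0 < eps -> 0 < r -> Rabs y < r -> taylor4 An pn qn sn tn lam eps ->
  (forall n, Rabs (An n x) <= C / r ^ n) ->
  (forall n, Rabs (pn n x) <= C / r ^ n /\ Rabs (qn n x) <= C / r ^ n /\
             Rabs (sn n x) <= C / r ^ n /\ Rabs (tn n x) <= C / r ^ n) ->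
  let ar := ext_re (fun k => An k x) y in let ai := ext_im (fun k => An k x) y in
  let v1r := val_re pn qn x y in let v1i := val_im pn qn x y in
  let v2r := val_re sn tn x y in let v2i := val_im sn tn x y in
  is_derive (val_re pn qn x) y ((lam * v1r - (ar * v2i + ai * v2r)) / eps) /\
  is_derive (val_im pn qn x) y ((lam * v1i + (ar * v2r - ai * v2i)) / eps) /\
  is_derive (val_re sn tn x) y ((- lam * v2r + (ar * v1i + ai * v1r)) / eps) /\
  is_derive (val_im sn tn x) y ((- lam * v2i - (ar * v1r - ai * v1i)) / eps).
Proof.
  intros Heps Hr Hy HT HA Hb ar ai v1r v1i v2r v2i.
  destruct (ext_taylor4 An pn qn sn tn lam eps C r x y Heps Hr Hy HT HA Hb)
    as ((P1 & P2) & (Q1 & Q2) & (S1 & S2) & (T1 & T2)).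
  destruct (ext_derive_vertical (fun k => pn k x) C r y Hr Hy (fun n => proj1 (Hb n))) as [p1 p2].
  destruct (ext_derive_vertical (fun k => qn k x) C r y Hr Hy (fun n => proj1 (proj2 (Hb n)))) as [q1 q2].
  destruct (ext_derive_vertical (fun k => sn k x) C r y Hr Hy (fun n => proj1 (proj2 (proj2 (Hb n))))) as [s1 s2].
  destruct (ext_derive_vertical (fun k => tn k x) C r y Hr Hy (fun n => proj2 (proj2 (proj2 (Hb n))))) as [t1 t2].
  rewrite P1 in p2. rewrite P2 in p1. rewrite Q1 in q2. rewrite Q2 in q1.
  rewrite S1 in s2. rewrite S2 in s1. rewrite T1 in t2. rewrite T2 in t1.
  unfold v1r, v1i, v2r, v2i, ar, ai, val_re, val_im.
  split; [|split; [|split]].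
  - apply (is_derive_eq _ _ _ _ (is_derive_Rminus _ _ _ _ _ p1 q2)). eq_in_R. field. lra.
  - apply (is_derive_eq _ _ _ _ (is_derive_Rplus _ _ _ _ _ p2 q1)). eq_in_R. field. lra.
  - apply (is_derive_eq _ _ _ _ (is_derive_Rminus _ _ _ _ _ s1 t2)). eq_in_R. field. lra.
  - apply (is_derive_eq _ _ _ _ (is_derive_Rplus _ _ _ _ _ s2 t1)). eq_in_R. field. lra.
Qed.

(** * The energy estimate *)

Lemma exp_le_mono x y : x <= y -> exp x <= exp y.
Proof. intros [h| ->]; [left; now apply exp_increasing|lra]. Qed.

Lemma gronwall (E dE G dG : R -> R) (a b c : R) : a <= b ->
  (forall x, a <= x <= b -> is_derive E x (dE x)) -> (forall x, a <= x <= b -> is_derive G x (dG x)) ->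
  (forall x, a <= x <= b -> dE x <= c * dG x * E x) ->
  E b <= E a * exp (c * (G b - G a)).
Proof.
  intros Hab HE HG Hle.
  set (h := fun x => E x * exp (- (c * G x))).
  set (dh := fun x => (dE x - c * dG x * E x) * exp (- (c * G x))).
  assert (Hd : forall x, a <= x <= b -> is_derive h x (dh x)).
  { intros x Hx. unfold h, dh.
    assert (He : is_derive (fun x => exp (- (c * G x))) x (- (c * dG x) * exp (- (c * G x)))).
    { apply (is_derive_comp exp (fun x => - (c * G x)) x (exp (- (c * G x))) (- (c * dG x))); [apply is_derive_exp|].
      apply (is_derive_opp (V := R_NormedModule) (fun x => c * G x)). apply (is_derive_scal G). now apply HG. }
    apply (is_derive_eq _ _ _ _ (is_derive_Rmult _ _ _ _ _ (HE x Hx) He)). eq_in_R. ring. }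
  assert (Hh : h b <= h a).
  { destruct (MVT_gen h a b dh) as [z [Hz Ez]].
    - rewrite Rmin_left, Rmax_right by assumption. intros x Hx. apply Hd. lra.
    - rewrite Rmin_left, Rmax_right by assumption. intros x Hx.
      apply continuity_pt_filterlim. apply (ex_derive_continuous (V := R_NormedModule)). eexists. now apply Hd.
    - rewrite Rmin_left, Rmax_right in Hz by assumption.
      assert (dh z <= 0).
      { unfold dh. specialize (Hle z Hz). generalize (exp_pos (- (c * G z))). nra. }
      nra. }
  unfold h in Hh. apply Rmult_le_compat_r with (r := exp (c * G b)) in Hh; [|left; apply exp_pos].
  rewrite !Rmult_assoc, <- !exp_plus in Hh.
  replace (- (c * G b) + c * G b) with 0 in Hh by ring. rewrite exp_0, Rmult_1_r in Hh.
  replace (- (c * G a) + c * G b) with (c * (G b - G a)) in Hh by ring. exact Hh.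
Qed.

(** The weight has mass 1 / tau on each half line, by the primitives of (1 + x)^(-1 - tau) and (1 -
    x)^(-1 - tau). The interval is cut at 0, where |x| changes its formula. *)
Lemma gronwall_decay (E dE : R -> R) (tau c : R) : 0 < tau -> 0 <= c ->
  (forall x, 0 <= E x) -> (forall x, is_derive E x (dE x)) ->
  (forall x, dE x <= c * decay tau x * E x) ->
  forall x1 x2, x1 <= 0 <= x2 -> E x2 <= E x1 * exp (2 * c / tau).
Proof.
  intros Ht Hc Hpos HE Hle x1 x2 Hx.
  assert (Hit : 0 < / tau) by (apply Rinv_0_lt_compat; lra).
  assert (R1 : E x2 <= E 0 * exp (c / tau)).
  { apply Rle_trans with (E 0 * exp (c * (- (Rpower (1 + x2) (- tau) / tau) - - (Rpower (1 + 0) (- tau) / tau)))).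
    - apply (gronwall E dE (fun x => - (Rpower (1 + x) (- tau) / tau)) (decay tau) 0 x2 c); [lra|auto| |auto].
      intros x Hx'. unfold decay, Rpower. rewrite Rabs_pos_eq by lra. auto_derive; [lra|].
      replace ((-1 - tau) * ln (1 + x)) with (- tau * ln (1 + x) + - ln (1 + x)) by ring.
      rewrite exp_plus, exp_Ropp, exp_ln by lra. field. lra.
    - apply Rmult_le_compat_l; [apply Hpos|].
      apply exp_le_mono. unfold Rdiv. apply Rmult_le_compat_l; [assumption|].
      unfold Rpower. rewrite Rplus_0_r, ln_1, Rmult_0_r, exp_0.
      generalize (exp_pos (- tau * ln (1 + x2))). nra. }
  assert (R2 : E 0 <= E x1 * exp (c / tau)).
  { apply Rle_trans with (E x1 * exp (c * (Rpower (1 - 0) (- tau) / tau - Rpower (1 - x1) (- tau) / tau))).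
    - apply (gronwall E dE (fun x => Rpower (1 - x) (- tau) / tau) (decay tau) x1 0 c); [lra|auto| |auto].
      intros x Hx'. unfold decay, Rpower. rewrite Rabs_left1 by lra. auto_derive; [lra|].
      replace ((-1 - tau) * ln (1 + - x)) with (- tau * ln (1 + - x) + - ln (1 + - x)) by ring.
      rewrite exp_plus, exp_Ropp, exp_ln by lra. unfold Rminus. field. lra.
    - apply Rmult_le_compat_l; [apply Hpos|].
      apply exp_le_mono. unfold Rdiv. apply Rmult_le_compat_l; [assumption|].
      unfold Rpower. rewrite Rminus_0_r, ln_1, Rmult_0_r, exp_0.
      generalize (exp_pos (- tau * ln (1 - x1))). nra. }
  replace (2 * c / tau) with (c / tau + c / tau) by (field; lra). rewrite exp_plus, <- Rmult_assoc.
  eapply Rle_trans; [exact R1|]. apply Rmult_le_compat_r; [left; apply exp_pos|assumption].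
Qed.

(* D = |v1|^2 - |v2|^2 and Im (v1 conj v2) are the factors of the 1/eps terms. *)
Lemma energy_derive (v1r v1i v2r v2i kap : R -> R) (x lam eps dy be ga dkap : R) : 0 < eps ->
  is_derive v1r x ((lam * dy * v1r x + lam * v1i x + be * v2r x - ga * v2i x) / eps) ->
  is_derive v1i x ((lam * dy * v1i x - lam * v1r x + be * v2i x + ga * v2r x) / eps) ->
  is_derive v2r x ((- lam * dy * v2r x - lam * v2i x - be * v1r x + ga * v1i x) / eps) ->
  is_derive v2i x ((- lam * dy * v2i x + lam * v2r x - be * v1i x - ga * v1r x) / eps) ->
  is_derive kap x dkap ->
  is_derive (fun z => v1r z * v1r z + v1i z * v1i z + v2r z * v2r z + v2i z * v2i z
                      + kap z * (v1r z * v2r z + v1i z * v2i z)) x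
   (((2 * lam * dy - kap x * be) * (v1r x * v1r x + v1i x * v1i x - v2r x * v2r x - v2i x * v2i x)
     + (4 * ga + 2 * kap x * lam) * (v1i x * v2r x - v1r x * v2i x)) / eps
    + dkap * (v1r x * v2r x + v1i x * v2i x)).
Proof.
  intros He a b c d k.
  apply (is_derive_eq _ _ _ _ (is_derive_Rplus _ _ _ _ _
    (is_derive_Rplus _ _ _ _ _ (is_derive_Rplus _ _ _ _ _ (is_derive_Rplus _ _ _ _ _
      (is_derive_Rmult _ _ _ _ _ a a) (is_derive_Rmult _ _ _ _ _ b b)) (is_derive_Rmult _ _ _ _ _ c c))
      (is_derive_Rmult _ _ _ _ _ d d))
    (is_derive_Rmult _ _ _ _ _ k (is_derive_Rplus _ _ _ _ _ (is_derive_Rmult _ _ _ _ _ a c) (is_derive_Rmult _ _ _ _ _ b d))))).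
  eq_in_R. field. lra.
Qed.

(** With v1 = a + i b and v2 = c + i d, the real and imaginary parts of v1 conj v2 are at most S / 2
    and | |v1|^2 - |v2|^2 | is at most S. So |k| <= 1 keeps E comparable with S, and S <= 2 E
    accounts for the factors 2. *)
Lemma energy_bounds (a b c d k D X n1 n2 n3 N1 N2 N3 eps : R) : 0 < eps ->
  let S := a * a + b * b + c * c + d * d in
  let E := S + k * (a * c + b * d) in
  Rabs k <= 1 -> Rabs n1 <= N1 -> Rabs n2 <= N2 -> Rabs n3 <= N3 ->
  D = a * a + b * b - c * c - d * d -> X = b * c - a * d ->
  S / 2 <= E <= 3 / 2 * S /\
  (n1 * D + n2 * X) / eps + n3 * (a * c + b * d) <= (2 * (N1 + N2) / eps + 2 * N3) * E.
Proof.
  intros He S E Hk H1 H2 H3 -> ->.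
  assert (hS : 0 <= S) by (unfold S; nra).
  assert (Z : Rabs (a * c + b * d) <= S / 2).
  { apply Rabs_le. unfold S. generalize (pow2_ge_0 (a + c)) (pow2_ge_0 (a - c)) (pow2_ge_0 (b + d)) (pow2_ge_0 (b - d)). nra. }
  assert (X : Rabs (b * c - a * d) <= S / 2).
  { apply Rabs_le. unfold S. generalize (pow2_ge_0 (b + c)) (pow2_ge_0 (b - c)) (pow2_ge_0 (a + d)) (pow2_ge_0 (a - d)). nra. }
  assert (D : Rabs (a * a + b * b - c * c - d * d) <= S) by (apply Rabs_le; unfold S; nra).
  assert (P : forall u v U V, Rabs u <= U -> Rabs v <= V -> Rabs (u * v) <= U * V).
  { intros u v U V Hu Hv. rewrite Rabs_mult. apply Rmult_le_compat; auto using Rabs_pos. }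
  assert (hE : S / 2 <= E <= 3 / 2 * S).
  { assert (h := P _ _ _ _ Hk Z). apply Rabs_le_between in h. unfold E. lra. }
  split; [exact hE|].
  assert (h1 := P _ _ _ _ H1 D). assert (h2 := P _ _ _ _ H2 X). assert (h3 := P _ _ _ _ H3 Z).
  apply Rabs_le_between in h1. apply Rabs_le_between in h2. apply Rabs_le_between in h3.
  assert (p1 := Rle_trans _ _ _ (Rabs_pos _) H1). assert (p2 := Rle_trans _ _ _ (Rabs_pos _) H2).
  assert (p3 := Rle_trans _ _ _ (Rabs_pos _) H3).
  assert (g1 : n1 * (a * a + b * b - c * c - d * d) + n2 * (b * c - a * d) <= 2 * (N1 + N2) * E) by nra.
  assert (g3 : n3 * (a * c + b * d) <= 2 * N3 * E) by nra.
  rewrite Rmult_plus_distr_r. apply Rplus_le_compat; [|exact g3].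
  unfold Rdiv. rewrite (Rmult_assoc _ (/ eps)), (Rmult_comm (/ eps)), <- Rmult_assoc.
  apply Rmult_le_compat_r; [left; apply Rinv_0_lt_compat; lra|exact g1].
Qed.

Lemma decay_le_1 tau x : 0 < tau -> decay tau x <= 1.
Proof.
  intros Ht. unfold decay, Rpower. apply Rle_trans with (exp 0); [apply exp_le_mono|rewrite exp_0; lra].
  assert (0 <= ln (1 + Rabs x)).
  { rewrite <- ln_1. apply ln_le; generalize (Rabs_pos x); lra. }
  nra.
Qed.

Lemma Rabs_mult_le u v U V : Rabs u <= U -> Rabs v <= V -> Rabs (u * v) <= U * V.
Proof. intros Hu Hv. rewrite Rabs_mult. apply Rmult_le_compat; auto using Rabs_pos. Qed.

Definition inv_mu (lam a : R) : R := / sqrt (lam ^ 2 + a ^ 2).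

Lemma inv_mu_facts lam a delta : 0 < delta -> delta <= Rabs lam ->
  0 < inv_mu lam a <= / delta /\ inv_mu lam a ^ 2 * (lam ^ 2 + a ^ 2) = 1 /\
  Rabs (lam * inv_mu lam a) <= 1 /\ Rabs (a * inv_mu lam a) <= 1.
Proof.
  intros Hd Hl. assert (HL : delta ^ 2 <= lam ^ 2) by (rewrite <- (pow2_abs lam); apply pow_incr; lra).
  assert (Hd2 : 0 < delta ^ 2) by (apply pow_lt; lra). assert (Ha := pow2_ge_0 a).
  assert (Hs : delta <= sqrt (lam ^ 2 + a ^ 2)).
  { rewrite <- (sqrt_pow2 delta) by lra. apply sqrt_le_1_alt. lra. }
  assert (Hq : sqrt (lam ^ 2 + a ^ 2) ^ 2 = lam ^ 2 + a ^ 2) by (apply pow2_sqrt; lra).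
  unfold inv_mu. set (m := sqrt (lam ^ 2 + a ^ 2)) in *.
  assert (Him : 0 < / m) by (apply Rinv_0_lt_compat; lra).
  assert (E : (/ m) ^ 2 * (lam ^ 2 + a ^ 2) = 1) by (rewrite <- Hq; field; lra).
  split; [split; [assumption|apply Rinv_le_contravar; lra]|]. split; [exact E|].
  split; apply Rabs_le; nra.
Qed.

Lemma inv_mu_derive (A : R -> R) (x lam a1 : R) : lam <> 0 -> is_derive A x a1 ->
  is_derive (fun x => inv_mu lam (A x)) x (- (A x * a1 * inv_mu lam (A x) ^ 3)).
Proof.
  intros Hl HA.
  assert (Hp : 0 < lam ^ 2 + A x ^ 2) by (generalize (pow2_gt_0 lam Hl) (pow2_ge_0 (A x)); lra).
  assert (Hs := sqrt_lt_R0 _ Hp).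
  assert (Hin : is_derive (fun b => inv_mu lam b) (A x) (- (A x * inv_mu lam (A x) ^ 3))).
  { unfold inv_mu. auto_derive.
    - replace (lam * (lam * 1) + A x * (A x * 1)) with (lam ^ 2 + A x ^ 2) by ring. split; [assumption|]. split; [|trivial]. lra.
    - replace (lam * (lam * 1) + A x * (A x * 1)) with (lam ^ 2 + A x ^ 2) by ring. field. lra. }
  apply (is_derive_eq _ _ _ _ (is_derive_comp (fun b => inv_mu lam b) A x _ _ Hin HA)).
  unfold scal; simpl. unfold mult; simpl. ring.
Qed.

Definition norm2 (pn qn sn tn : nat -> R -> R) (x y : R) : R :=
  val_re pn qn x y * val_re pn qn x y + val_im pn qn x y * val_im pn qn x y +
  val_re sn tn x y * val_re sn tn x y + val_im sn tn x y * val_im sn tn x y.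

(* To first order in y0 the curve y = y0 lam / mu is a level line of
   Im int sqrt (lam^2 + A^2); the correction kap Re (v1 conj v2) of the energy
   cancels the remaining terms of order y0 / eps. *)
Lemma energy_growth (An : nat -> R -> R) (r M tau delta : R) :
  0 < r -> 0 < M -> 0 < tau -> 0 < delta ->
  (forall n x, is_derive (An n) x (INR (S n) * An (S n) x)) ->
  (forall n x, Rabs (An n x) <= M * decay tau x / r ^ n) ->
  exists K ymax, 0 < K /\ 0 < ymax /\ ymax <= r / 8 /\
  forall y0 eps lam pn qn sn tn C, 0 < y0 <= ymax -> 0 < eps -> delta <= Rabs lam -> 0 <= C ->
  taylor4 An pn qn sn tn lam eps ->
  (forall n x, Rabs (pn n x) <= C / (r / 2) ^ n /\ Rabs (qn n x) <= C / (r / 2) ^ n /\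
             Rabs (sn n x) <= C / (r / 2) ^ n /\ Rabs (tn n x) <= C / (r / 2) ^ n) ->
  let y := fun x => y0 * (lam * inv_mu lam (An 0%nat x)) in
  forall x1 x2, x1 <= 0 <= x2 ->
    norm2 pn qn sn tn x2 (y x2) <= 3 * norm2 pn qn sn tn x1 (y x1) * exp (K + K * y0 ^ 2 / eps).
Proof.
  intros Hr HM Htau Hdel HdA HA.
  set (m1 := M / r). set (m2 := M / r ^ 2). set (i := / delta).
  assert (Hm1 : 0 < m1) by (apply Rdiv_lt_0_compat; lra).
  assert (Hm2 : 0 < m2) by (apply Rdiv_lt_0_compat; [lra|apply pow_lt; lra]).
  assert (Hi : 0 < i) by (apply Rinv_0_lt_compat; lra).
  set (K3 := 2 * M / r + 2 * M * (m1 * i)).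
  assert (HK3 : 0 < K3).
  { unfold K3. assert (0 < 2 * M / r) by (apply Rdiv_lt_0_compat; lra).
    assert (0 < m1 * i) by (apply Rmult_lt_0_compat; lra). nra. }
  (* [Ka] collects the O(y0^2 / eps) bounds on the two factors, [Kb] the bound on the derivative of
     kap, both with the factor 2 of [energy_bounds]. *)
  set (Ka := 2 * (2 * (m1 * i) * K3 + 16 * M / r ^ 2)).
  set (Kb := 4 * (2 * m2 * i + 3 * (m1 * i) ^ 2)).
  assert (Hmi : 0 < m1 * i) by (apply Rmult_lt_0_compat; lra).
  assert (HKa : 0 < Ka).
  { unfold Ka. assert (0 < 16 * M / r ^ 2) by (apply Rdiv_lt_0_compat; [lra|apply pow_lt; lra]). nra. }
  assert (HKb : 0 < Kb) by (unfold Kb; generalize (Rmult_lt_0_compat _ _ Hm2 Hi); nra).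
  (* The bound r / 8 keeps the curve within a quarter of the radius r / 2; the last bound gives |y'|
     <= 1 / 2 and |kap| <= 1. *)
  exists (2 / tau * (Ka + Kb)), (Rmin (Rmin 1 (r / 8)) (/ (2 * (m1 * i)))).
  assert (Ht2 : 0 < 2 / tau) by (apply Rdiv_lt_0_compat; lra).
  split; [apply Rmult_lt_0_compat; lra|].
  split.
  { apply Rmin_glb_lt; [apply Rmin_glb_lt; lra|]. apply Rinv_0_lt_compat; lra. }
  split.
  { eapply Rle_trans; [apply Rmin_l|apply Rmin_r]. }
  intros y0 eps lam pn qn sn tn C Hy0 Heps Hlam HC HT Hb y.
  assert (Y1 : y0 <= 1) by (eapply Rle_trans; [apply Hy0|]; eapply Rle_trans; [apply Rmin_l|apply Rmin_l]).
  assert (Y2 : y0 <= r / 8) by (eapply Rle_trans; [apply Hy0|]; eapply Rle_trans; [apply Rmin_l|apply Rmin_r]).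
  assert (Y3 : y0 * (m1 * i) <= 1 / 2).
  { apply Rle_trans with (/ (2 * (m1 * i)) * (m1 * i)).
    - apply Rmult_le_compat_r; [lra|]. eapply Rle_trans; [apply Hy0|apply Rmin_r].
    - right. field. lra. }
  assert (Hlam0 : lam <> 0) by (intros ->; rewrite Rabs_R0 in Hlam; lra).
  set (w := fun x => inv_mu lam (An 0%nat x)).
  assert (Hw : forall x, 0 < w x <= i /\ w x ^ 2 * (lam ^ 2 + An 0%nat x ^ 2) = 1 /\
     Rabs (lam * w x) <= 1 /\ Rabs (An 0%nat x * w x) <= 1) by (intros; now apply inv_mu_facts).
  (* Here [An 1] is A' and [An 2] is A'' / 2. The factors are grouped with w = 1 / mu so that each
     group has a bound independent of lam. *)
  set (dy := fun x => - (y0 * (lam * w x) * (An 0%nat x * w x) * (An 1%nat x * w x))).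
  set (kap := fun x => - (2 * y0 * (lam ^ 2 * (An 1%nat x * w x ^ 3)))).
  set (dkap := fun x => - (2 * y0 * ((lam * w x) * (lam * w x) * (2 * (An 2%nat x * w x)
      - 3 * (An 0%nat x * w x) * ((An 1%nat x * w x) * (An 1%nat x * w x)))))).
  assert (H01 : forall x, is_derive (An 0%nat) x (An 1%nat x)).
  { intros x. apply (is_derive_eq _ _ _ _ (HdA 0%nat x)). simpl. ring. }
  assert (H12 : forall x, is_derive (An 1%nat) x (2 * An 2%nat x)).
  { intros x. apply (is_derive_eq _ _ _ _ (HdA 1%nat x)). simpl. ring. }
  assert (Hdw : forall x, is_derive w x (- (An 0%nat x * An 1%nat x * w x ^ 3))).
  { intros x. apply inv_mu_derive; auto. }
  assert (Hdy : forall x, is_derive y x (dy x)).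
  { intros x. unfold y. apply (is_derive_eq _ _ _ _ (is_derive_scal _ x y0 _ (is_derive_scal _ x lam _ (Hdw x)))).
    unfold dy. eq_in_R. ring. }
  assert (Hdk : forall x, is_derive kap x (dkap x)).
  { intros x. unfold kap.
    assert (W3 : is_derive (fun x => w x ^ 3) x (3 * - (An 0%nat x * An 1%nat x * w x ^ 3) * w x ^ 2)).
    { apply (is_derive_eq _ _ _ _ (is_derive_pow w 3 x _ (Hdw x))). simpl. ring. }
    assert (P := is_derive_scal _ x (2 * y0) _ (is_derive_scal _ x (lam ^ 2) _ (is_derive_Rmult _ _ _ _ _ (H12 x) W3))).
    apply (is_derive_eq _ _ _ _ (is_derive_opp (V := R_NormedModule) _ _ _ P)).
    unfold dkap, opp; simpl. ring. }
  set (g := decay tau).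
  assert (Hg : forall x, 0 < g x <= 1) by (intros x; split; [apply decay_pos|now apply decay_le_1]).
  assert (B1 : forall x, Rabs (An 1%nat x * w x) <= m1 * i * g x).
  { intros x. replace (m1 * i * g x) with (m1 * g x * i) by ring.
    apply Rabs_mult_le; [|rewrite Rabs_pos_eq; [apply Hw|left; apply Hw]].
    eapply Rle_trans; [apply HA|]. right. unfold m1, g. field. lra. }
  assert (B2 : forall x, Rabs (An 2%nat x * w x) <= m2 * i * g x).
  { intros x. replace (m2 * i * g x) with (m2 * g x * i) by ring.
    apply Rabs_mult_le; [|rewrite Rabs_pos_eq; [apply Hw|left; apply Hw]].
    eapply Rle_trans; [apply HA|]. right. unfold m2, g. field. lra. }
  assert (By : forall x, Rabs (y x) <= y0).
  { intros x. unfold y. replace y0 with (y0 * 1) at 2 by ring. apply Rabs_mult_le; [rewrite Rabs_pos_eq; lra|apply Hw]. }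
  assert (Bdy : forall x, Rabs (dy x) <= y0 * (m1 * i * g x)).
  { intros x. unfold dy. rewrite Rabs_Ropp. replace (y0 * (m1 * i * g x)) with (y0 * 1 * 1 * (m1 * i * g x)) by ring.
    apply Rabs_mult_le; [|apply B1]. apply Rabs_mult_le; [|apply Hw]. apply Rabs_mult_le; [rewrite Rabs_pos_eq; lra|apply Hw]. }
  assert (Bdy1 : forall x, Rabs (dy x) <= 1 / 2).
  { intros x. eapply Rle_trans; [apply Bdy|]. generalize (Hg x); intros. nra. }
  assert (Bk : forall x, Rabs (kap x) <= 2 * y0 * (m1 * i * g x)).
  { intros x. unfold kap. rewrite Rabs_Ropp.
    replace (2 * y0 * (lam ^ 2 * (An 1%nat x * w x ^ 3))) with (2 * y0 * ((lam * w x) * (lam * w x) * (An 1%nat x * w x))) by ring.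
    replace (2 * y0 * (m1 * i * g x)) with (2 * y0 * (1 * 1 * (m1 * i * g x))) by ring.
    apply Rabs_mult_le; [rewrite Rabs_pos_eq; lra|]. apply Rabs_mult_le; [|apply B1]. apply Rabs_mult_le; apply Hw. }
  assert (Bk1 : forall x, Rabs (kap x) <= 1).
  { intros x. eapply Rle_trans; [apply Bk|]. generalize (Hg x); intros. nra. }
  assert (Bdk : forall x, Rabs (dkap x) <= 2 * y0 * ((2 * m2 * i + 3 * (m1 * i) ^ 2) * g x)).
  { intros x. unfold dkap. rewrite Rabs_Ropp. apply Rabs_mult_le; [rewrite Rabs_pos_eq; lra|].
    rewrite <- (Rmult_1_l ((2 * m2 * i + _) * _)). rewrite <- (Rmult_1_l 1) at 1.
    apply Rabs_mult_le; [apply Rabs_mult_le; apply Hw|].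
    unfold Rminus. eapply Rle_trans; [apply Rabs_triang|]. rewrite Rabs_Ropp.
    assert (b1 : Rabs (2 * (An 2%nat x * w x)) <= 2 * (m2 * i * g x)).
    { apply Rabs_mult_le; [rewrite Rabs_pos_eq; lra|apply B2]. }
    assert (b2 : Rabs (3 * (An 0%nat x * w x) * ((An 1%nat x * w x) * (An 1%nat x * w x))) <= 3 * 1 * ((m1 * i * g x) * (m1 * i * g x))).
    { apply Rabs_mult_le; [apply Rabs_mult_le; [rewrite Rabs_pos_eq; lra|apply Hw]|apply Rabs_mult_le; apply B1]. }
    assert (b3 : (m1 * i * g x) * (m1 * i * g x) <= (m1 * i) ^ 2 * g x).
    { replace ((m1 * i) ^ 2 * g x) with ((m1 * i) * (m1 * i) * g x * 1) by ring.
      replace ((m1 * i * g x) * (m1 * i * g x)) with ((m1 * i) * (m1 * i) * g x * g x) by ring.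
      apply Rmult_le_compat_l; [|apply Hg]. generalize (Hg x); intros.
      apply Rmult_le_pos; [apply Rmult_le_pos|]; lra. }
    lra. }
  set (C1 := M + C).
  assert (Hb1 : forall n x, Rabs (pn n x) <= C1 / (r / 2) ^ n /\ Rabs (qn n x) <= C1 / (r / 2) ^ n /\
             Rabs (sn n x) <= C1 / (r / 2) ^ n /\ Rabs (tn n x) <= C1 / (r / 2) ^ n).
  { intros n x. assert (C / (r / 2) ^ n <= C1 / (r / 2) ^ n).
    { apply Rmult_le_compat_r; [left; apply Rinv_0_lt_compat, pow_lt; lra|unfold C1; lra]. }
    destruct (Hb n x) as (h1 & h2 & h3 & h4). repeat split; lra. }
  assert (HA1 : forall n x, Rabs (An n x) <= C1 / (r / 2) ^ n).
  { intros n x. eapply Rle_trans; [apply HA|].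
    assert (p1 : 0 < (r / 2) ^ n) by (apply pow_lt; lra).
    assert (p2 : (r / 2) ^ n <= r ^ n) by (apply pow_incr; lra).
    unfold Rdiv at 1 2. apply Rmult_le_compat.
    - generalize (Hg x); unfold g; intros; nra.
    - left. apply Rinv_0_lt_compat. lra.
    - unfold C1. generalize (Hg x); unfold g; intros; nra.
    - apply Rinv_le_contravar; assumption. }
  assert (Hyr : forall x, Rabs (y x) <= r / 2 / 4) by (intros x; generalize (By x); lra).
  assert (Hder := extension_along An pn qn sn tn lam eps C1 (r / 2) (1 / 2) y dy Heps ltac:(lra) ltac:(lra)
     HT HA1 Hb1 Hdy Hyr Bdy1).
  set (ar := fun x => ext_re (fun k => An k x) (y x)). set (ai := fun x => ext_im (fun k => An k x) (y x)).
  set (v1r := fun x => val_re pn qn x (y x)) in *. set (v1i := fun x => val_im pn qn x (y x)) in *.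
  set (v2r := fun x => val_re sn tn x (y x)) in *. set (v2i := fun x => val_im sn tn x (y x)) in *.
  set (be := fun x => ar x - dy x * ai x). set (ga := fun x => ai x + dy x * ar x).
  set (E := fun z => v1r z * v1r z + v1i z * v1i z + v2r z * v2r z + v2i z * v2i z
                      + kap z * (v1r z * v2r z + v1i z * v2i z)).
  set (dE := fun x => ((2 * lam * dy x - kap x * be x) * (v1r x * v1r x + v1i x * v1i x - v2r x * v2r x - v2i x * v2i x)
     + (4 * ga x + 2 * kap x * lam) * (v1i x * v2r x - v1r x * v2i x)) / eps
    + dkap x * (v1r x * v2r x + v1i x * v2i x)).
  assert (HE : forall x, is_derive E x (dE x)).
  { intros x. destruct (Hder x) as (d1 & d2 & d3 & d4). unfold E, dE. apply energy_derive; auto. }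
  assert (Hcoef : forall x, Rabs (2 * lam * dy x - kap x * be x) <= 2 * y0 * (m1 * i * g x) * (K3 * y0) /\
                            Rabs (4 * ga x + 2 * kap x * lam) <= 16 * M * g x * (y0 / r) ^ 2).
  { intros x.
    destruct (ext_bounds (fun k => An k x) (M * g x) r (y x)) as (e1 & e2 & e3 & e4).
    { lra. } { generalize (By x); lra. } { intros n. apply HA. }
    fold (ar x) in e1, e3. fold (ai x) in e2, e4.
    destruct (Hw x) as (w1 & w2 & w3 & w4).
    assert (yr : (y x / r) ^ 2 <= (y0 / r) ^ 2).
    { rewrite <- (pow2_abs (y x / r)). apply pow_incr. split; [apply Rabs_pos|].
      unfold Rdiv. rewrite Rabs_mult, (Rabs_pos_eq (/ r)) by (left; apply Rinv_0_lt_compat; lra).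
      apply Rmult_le_compat_r; [left; apply Rinv_0_lt_compat; lra|apply By]. }
    assert (yr2 : (y0 / r) ^ 2 <= y0 / r).
    { assert (0 <= y0 / r) by (apply Rmult_le_pos; [lra|left; apply Rinv_0_lt_compat; lra]).
      assert (y0 / r <= 1) by (apply Rmult_le_reg_r with r; [lra|]; unfold Rdiv; rewrite Rmult_assoc, Rinv_l by lra; lra).
      nra. }
    assert (Mg : 0 <= M * g x <= M) by (generalize (Hg x); intros; nra).
    assert (e3' : Rabs (ar x - An 0%nat x) <= 2 * (M * g x) * (y0 / r) ^ 2).
    { eapply Rle_trans; [exact e3|]. apply Rmult_le_compat_l; lra. }
    assert (e4' : Rabs (ai x - An 1%nat x * y x) <= 2 * (M * g x) * (y0 / r) ^ 2).
    { eapply Rle_trans; [exact e4|]. apply Rmult_le_compat_l; lra. }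
    split.
    (* First cancellation: 2 lam y' = kap A, which leaves kap times the deviation of be from A, both
       of order y0. *)
    - replace (2 * lam * dy x - kap x * be x) with (kap x * (An 0%nat x - ar x + dy x * ai x)) by (unfold be, kap, dy; ring).
      apply Rabs_mult_le; [apply Bk|]. eapply Rle_trans; [apply Rabs_triang|].
      rewrite <- (Rabs_Ropp (An 0%nat x - ar x)), Ropp_minus_distr.
      assert (q1 : Rabs (dy x * ai x) <= y0 * (m1 * i) * (2 * M)).
      { apply Rabs_mult_le; [|lra]. eapply Rle_trans; [apply Bdy|]. apply Rmult_le_compat_l; [lra|]. rewrite <- (Rmult_1_r (m1 * i)) at 2. apply Rmult_le_compat_l; [lra|apply Hg]. }
      assert (q2 : 2 * (M * g x) * (y0 / r) ^ 2 <= 2 * M * (y0 / r)).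
      { apply Rmult_le_compat; [lra|apply pow2_ge_0|lra|exact yr2]. }
      replace (K3 * y0) with (2 * M * (y0 / r) + y0 * (m1 * i) * (2 * M)) by (unfold K3, Rdiv; ring). lra.
    (* Second cancellation: 4 (A y)' = - 2 kap lam, because 1 - A^2 w^2 = lam^2 w^2. Only
       second-order Taylor remainders of A are left. *)
    - replace (4 * ga x + 2 * kap x * lam) with (4 * (ai x - An 1%nat x * y x) + 4 * (dy x * (ar x - An 0%nat x))).
      2:{ assert (Z : 4 * (An 1%nat x * y x) + 4 * (dy x * An 0%nat x) = - (2 * kap x * lam)).
          { transitivity (4 * y0 * lam * An 1%nat x * w x * (1 - An 0%nat x ^ 2 * w x ^ 2)); [unfold y, dy; fold (w x); ring|].
            replace (1 - An 0%nat x ^ 2 * w x ^ 2) with (lam ^ 2 * w x ^ 2) by (rewrite <- w2; ring).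
            unfold kap. ring. }
          unfold ga. lra. }
      assert (q1 : Rabs (dy x * (ar x - An 0%nat x)) <= 1 / 2 * (2 * (M * g x) * (y0 / r) ^ 2)).
      { apply Rabs_mult_le; [apply Bdy1|exact e3']. }
      eapply Rle_trans; [apply Rabs_triang|]. rewrite !Rabs_mult in *. rewrite (Rabs_pos_eq 4) by lra.
      assert (0 <= M * g x * (y0 / r) ^ 2) by (apply Rmult_le_pos; [lra|apply pow2_ge_0]). lra. }
  set (c := Ka * y0 ^ 2 / eps + Kb * y0).
  assert (Hc : 0 <= c).
  { unfold c. assert (0 <= Ka * y0 ^ 2 / eps).
    { apply Rmult_le_pos; [|left; apply Rinv_0_lt_compat; lra]. apply Rmult_le_pos; [lra|apply pow2_ge_0]. } nra. }
  assert (HEb : forall x, (norm2 pn qn sn tn x (y x) / 2 <= E x <= 3 / 2 * norm2 pn qn sn tn x (y x)) /\ dE x <= c * g x * E x).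
  { intros x. destruct (Hcoef x) as [k1 k2].
    destruct (energy_bounds (v1r x) (v1i x) (v2r x) (v2i x) (kap x) _ _ _ _ _ _ _ _ eps Heps (Bk1 x) k1 k2 (Bdk x) eq_refl eq_refl) as [f1 f2].
    split; [exact f1|].
    replace (c * g x) with (2 * (2 * y0 * (m1 * i * g x) * (K3 * y0) + 16 * M * g x * (y0 / r) ^ 2) / eps +
       2 * (2 * y0 * ((2 * m2 * i + 3 * (m1 * i) ^ 2) * g x))); [exact f2|].
    unfold c, Ka, Kb. field. lra. }
  assert (Epos : forall x, 0 <= E x).
  { intros x. destruct (HEb x) as [[f1 _] _]. unfold norm2 in f1.
    generalize (Rle_0_sqr (val_re pn qn x (y x))) (Rle_0_sqr (val_im pn qn x (y x))) (Rle_0_sqr (val_re sn tn x (y x))) (Rle_0_sqr (val_im sn tn x (y x))).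
    unfold Rsqr. lra. }
  intros x1 x2 Hx.
  assert (GR := gronwall_decay E dE tau c Htau Hc Epos HE (fun x => proj2 (HEb x)) x1 x2 Hx).
  destruct (HEb x1) as [[_ f1] _]. destruct (HEb x2) as [[f2 _] _].
  assert (Hexp : exp (2 * c / tau) <= exp (2 / tau * (Ka + Kb) + 2 / tau * (Ka + Kb) * y0 ^ 2 / eps)).
  { apply exp_le_mono.
    replace (2 * c / tau) with (2 / tau * (Ka * y0 ^ 2 / eps + Kb * y0)) by (unfold c; field; lra).
    replace (2 / tau * (Ka + Kb) + 2 / tau * (Ka + Kb) * y0 ^ 2 / eps) with
      (2 / tau * ((Ka + Kb) + (Ka * y0 ^ 2 / eps + Kb * y0 ^ 2 / eps))) by (field; lra).
    apply Rmult_le_compat_l; [lra|].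
    assert (0 <= Kb * y0 ^ 2 / eps).
    { apply Rmult_le_pos; [|left; apply Rinv_0_lt_compat; lra]. apply Rmult_le_pos; [lra|apply pow2_ge_0]. } nra. }
  assert (h := exp_pos (2 * c / tau)).
  assert (n1 : 0 <= norm2 pn qn sn tn x1 (y x1)) by (generalize (Epos x1); lra).
  apply Rle_trans with (2 * (E x1 * exp (2 * c / tau))); [lra|].
  apply Rle_trans with (3 * norm2 pn qn sn tn x1 (y x1) * exp (2 * c / tau)); [nra|].
  apply Rmult_le_compat_l; [lra|exact Hexp].
Qed.

(** * Asymptotics and the reflection coefficient *)

(** [Cmod] and the operations unfold to those of Coquelicot's complex pairs, so its facts transfer
    by conversion. *)
Lemma Cmod_add z w : Cmod (Cadd z w) <= Cmod z + Cmod w.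
Proof. exact (Complex.Cmod_triangle (Cre z, Cim z) (Cre w, Cim w)). Qed.

Lemma Cmod_mul z w : Cmod (Cmul z w) = Cmod z * Cmod w.
Proof. exact (Complex.Cmod_mult (Cre z, Cim z) (Cre w, Cim w)). Qed.

Lemma Cmod_pos z : 0 <= Cmod z.
Proof. apply sqrt_pos. Qed.

Lemma Cmod_sqr z : Cmod z ^ 2 = Cre z ^ 2 + Cim z ^ 2.
Proof. apply pow2_sqrt. generalize (pow2_ge_0 (Cre z)) (pow2_ge_0 (Cim z)). lra. Qed.

Lemma Cmod_expi t : Cmod (Cexpi t) = 1.
Proof.
  unfold Cmod, Cexpi; simpl Cre; simpl Cim.
  replace (cos t ^ 2 + sin t ^ 2) with 1; [apply sqrt_1|].
  rewrite <- (sin2_cos2 t). unfold Rsqr. ring.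
Qed.

Lemma Cmod_near z w e : Cmod (Csub z w) < e -> Cmod w - e <= Cmod z <= Cmod w + e.
Proof.
  intros H. split.
  - assert (h := Cmod_add z (Csub w z)).
    replace (Cadd z (Csub w z)) with w in h by (destruct z, w; unfold Cadd, Csub, Copp; simpl; f_equal; ring).
    replace (Cmod (Csub w z)) with (Cmod (Csub z w)) in h; [lra|].
    unfold Cmod, Csub, Cadd, Copp; simpl Cre; simpl Cim. f_equal. ring.
  - assert (h := Cmod_add w (Csub z w)).
    replace (Cadd w (Csub z w)) with z in h by (destruct z, w; unfold Cadd, Csub, Copp; simpl; f_equal; ring). lra.
Qed.

Lemma Cmod_div z w : / 2 <= Cmod w -> Cmod (Cdiv z w) <= 2 * Cmod z.
Proof.
  intros Hw. assert (Hp : 0 < Cmod w) by lra.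
  assert (Hn : 0 < Cre w ^ 2 + Cim w ^ 2) by (rewrite <- Cmod_sqr; now apply pow_lt).
  assert (E : Cmod (Cinv w) * Cmod w = 1).
  { rewrite <- Cmod_mul. unfold Cmod, Cmul, Cinv; simpl Cre; simpl Cim.
    transitivity (sqrt 1); [f_equal|apply sqrt_1]. field. lra. }
  unfold Cdiv. rewrite Cmod_mul. rewrite (Rmult_comm 2). apply Rmult_le_compat_l; [apply Cmod_pos|].
  generalize (Cmod_pos (Cinv w)). nra.
Qed.

Lemma ZS_ode4 A eps lam u : 0 < eps -> ZS_solution A eps lam u ->
  ode4 A (fun x => Cre (fst (u x))) (fun x => Cim (fst (u x)))
         (fun x => Cre (snd (u x))) (fun x => Cim (snd (u x))) lam eps.
Proof.
  intros He H x. destruct (H x) as ([d1r d1i] & [d2r d2i] & [p1 p2] & [s1 s2] & e1 & e2).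
  simpl in p1, p2, s1, s2.
  unfold Cdiv, Cmul, Cinv, Cadd, Copp, RtoC, Ci in e1, e2; simpl in e1, e2.
  injection e1 as a1 a2. injection e2 as b1 b2.
  split; [|split; [|split]]; apply is_derive_Reals.
  - replace ((lam * Cim (fst (u x)) + A x * Cre (snd (u x))) / eps) with d1r; [exact p1|].
    apply Rmult_eq_reg_r with eps; [|lra]. unfold Rdiv at 1. rewrite Rmult_assoc, Rinv_l by lra. lra.
  - replace ((- lam * Cre (fst (u x)) + A x * Cim (snd (u x))) / eps) with d1i; [exact p2|].
    apply Rmult_eq_reg_r with eps; [|lra]. unfold Rdiv at 1. rewrite Rmult_assoc, Rinv_l by lra. lra.
  - replace ((- lam * Cim (snd (u x)) - A x * Cre (fst (u x))) / eps) with d2r; [exact s1|].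
    apply Rmult_eq_reg_r with eps; [|lra]. unfold Rdiv at 1. rewrite Rmult_assoc, Rinv_l by lra. lra.
  - replace ((lam * Cre (snd (u x)) - A x * Cim (fst (u x))) / eps) with d2i; [exact s2|].
    apply Rmult_eq_reg_r with eps; [|lra]. unfold Rdiv at 1. rewrite Rmult_assoc, Rinv_l by lra. lra.
Qed.

Lemma ode4_conserved A p q s t lam eps : 0 < eps -> ode4 A p q s t lam eps ->
  forall x, p x ^ 2 + q x ^ 2 + s x ^ 2 + t x ^ 2 = p 0 ^ 2 + q 0 ^ 2 + s 0 ^ 2 + t 0 ^ 2.
Proof.
  intros He H x.
  set (h := fun x => p x * p x + q x * q x + s x * s x + t x * t x).
  assert (Hd : forall z, is_derive h z 0).
  { intros z. destruct (H z) as (a & b & c & d).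
    apply (is_derive_eq _ _ _ _ (is_derive_Rplus _ _ _ _ _ (is_derive_Rplus _ _ _ _ _ (is_derive_Rplus _ _ _ _ _
      (is_derive_Rmult _ _ _ _ _ a a) (is_derive_Rmult _ _ _ _ _ b b)) (is_derive_Rmult _ _ _ _ _ c c)) (is_derive_Rmult _ _ _ _ _ d d))).
    eq_in_R. field. lra. }
  assert (B : Rabs (h x - h 0) <= 0 * Rabs (x - 0)).
  { apply (bounded_variation h (fun _ => 0)). intros z _. split; [apply Hd|rewrite Rabs_R0; lra]. }
  rewrite Rmult_0_l in B. assert (E : h x - h 0 = 0).
  { apply Rabs_eq_0. generalize (Rabs_pos (h x - h 0)). lra. }
  unfold h in E. simpl. lra.
Qed.

(** The integrating factor exp (- l z / eps) removes f from the right-hand side, and |y| <= 1 bounds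
    the factor along the segment. *)
Lemma linear_ode_bound (f k : R -> R) (l eps B y : R) : 0 < eps -> Rabs y <= 1 ->
  (forall z, Rabs z <= Rabs y -> is_derive f z ((l * f z + k z) / eps) /\ Rabs (k z) <= B) ->
  Rabs (f y * exp (- (l / eps * y)) - f 0) <= B * (exp (Rabs l / eps) / eps).
Proof.
  intros He Hy H.
  assert (Hie : 0 < / eps) by (apply Rinv_0_lt_compat; lra).
  assert (HB : 0 <= B) by (destruct (H y (Rle_refl _)) as [_ h]; generalize (Rabs_pos (k y)); lra).
  assert (V : Rabs (f y * exp (- (l / eps * y)) - f 0 * exp (- (l / eps * 0))) <= B * (exp (Rabs l / eps) / eps) * Rabs (y - 0)).
  { apply (bounded_variation (fun z => f z * exp (- (l / eps * z))) (fun z => k z / eps * exp (- (l / eps * z)))).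
    intros z Hz. rewrite !Rminus_0_r in Hz. destruct (H z Hz) as [h1 h2]. split.
    - assert (e : is_derive (fun z => exp (- (l / eps * z))) z (- (l / eps) * exp (- (l / eps * z)))).
      { auto_derive; auto. ring. }
      apply (is_derive_eq _ _ _ _ (is_derive_Rmult _ _ _ _ _ h1 e)). eq_in_R. field. lra.
    - unfold Rdiv at 1. rewrite Rmult_assoc. apply Rabs_mult_le; [exact h2|].
      rewrite Rabs_pos_eq by (apply Rmult_le_pos; [lra|left; apply exp_pos]).
      unfold Rdiv at 2. rewrite Rmult_comm. apply Rmult_le_compat_r; [lra|]. apply exp_le_mono.
      eapply Rle_trans; [apply Rle_abs|]. rewrite Rabs_Ropp, Rabs_mult. unfold Rdiv. rewrite Rabs_mult, (Rabs_pos_eq (/ eps)) by lra.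
      assert (0 <= Rabs l * / eps) by (apply Rmult_le_pos; [apply Rabs_pos|lra]). nra. }
  rewrite !Rmult_0_r, Ropp_0, exp_0, Rmult_1_r in V. rewrite Rminus_0_r in V.
  assert (0 <= B * (exp (Rabs l / eps) / eps)).
  { apply Rmult_le_pos; [assumption|]. apply Rmult_le_pos; [left; apply exp_pos|lra]. }
  nra.
Qed.

Lemma ext_at_0 (a : nat -> R) (C r : R) : 0 < r -> (forall n, Rabs (a n) <= C / r ^ n) ->
  ext_re a 0 = a 0%nat /\ ext_im a 0 = 0.
Proof.
  intros Hr Ha. destruct (ext_bounds a C r 0 Hr) as (_ & _ & h1 & h2); [rewrite Rabs_R0; lra|exact Ha|].
  unfold Rdiv in h1, h2. rewrite Rmult_0_l in h1, h2. replace (2 * C * 0 ^ 2) with 0 in h1, h2 by ring.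
  rewrite Rmult_0_r, Rminus_0_r in h2.
  split.
  - apply Rminus_diag_uniq, Rabs_eq_0. generalize (Rabs_pos (ext_re a 0 - a 0%nat)). lra.
  - apply Rabs_eq_0. generalize (Rabs_pos (ext_im a 0)). lra.
Qed.

(* Off the real axis the potential still decays, so at infinity the extension is
   the free evolution of the boundary values. *)
Lemma extension_free (An pn qn sn tn : nat -> R -> R) (lam eps M r tau C : R) :
  0 < eps -> 0 < r -> 0 < M -> 0 <= C -> 0 < tau -> taylor4 An pn qn sn tn lam eps ->
  (forall n x, Rabs (An n x) <= M * decay tau x / r ^ n) ->
  (forall n x, Rabs (pn n x) <= C / (r / 2) ^ n /\ Rabs (qn n x) <= C / (r / 2) ^ n /\
             Rabs (sn n x) <= C / (r / 2) ^ n /\ Rabs (tn n x) <= C / (r / 2) ^ n) ->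
  exists D, 0 <= D /\ forall x y, Rabs y <= 1 -> Rabs y <= r / 8 ->
    Rabs (val_re pn qn x y * exp (- (lam / eps * y)) - pn 0%nat x) <= D * decay tau x /\
    Rabs (val_im pn qn x y * exp (- (lam / eps * y)) - qn 0%nat x) <= D * decay tau x /\
    Rabs (val_re sn tn x y * exp (lam / eps * y) - sn 0%nat x) <= D * decay tau x /\
    Rabs (val_im sn tn x y * exp (lam / eps * y) - tn 0%nat x) <= D * decay tau x.
Proof.
  intros Heps Hr HM HC Htau HT HA Hb.
  set (C1 := M + C).
  assert (Hg : forall x, 0 < decay tau x <= 1) by (intros x; split; [apply decay_pos|now apply decay_le_1]).
  assert (Hb1 : forall n x, Rabs (pn n x) <= C1 / (r / 2) ^ n /\ Rabs (qn n x) <= C1 / (r / 2) ^ n /\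
             Rabs (sn n x) <= C1 / (r / 2) ^ n /\ Rabs (tn n x) <= C1 / (r / 2) ^ n).
  { intros n x. assert (C / (r / 2) ^ n <= C1 / (r / 2) ^ n).
    { apply Rmult_le_compat_r; [left; apply Rinv_0_lt_compat, pow_lt; lra|unfold C1; lra]. }
    destruct (Hb n x) as (h1 & h2 & h3 & h4). repeat split; lra. }
  assert (HA1 : forall n x, Rabs (An n x) <= C1 / (r / 2) ^ n).
  { intros n x. eapply Rle_trans; [apply HA|].
    assert (p1 : 0 < (r / 2) ^ n) by (apply pow_lt; lra).
    assert (p2 : (r / 2) ^ n <= r ^ n) by (apply pow_incr; lra).
    unfold Rdiv at 1 2. apply Rmult_le_compat.
    - generalize (Hg x); intros; nra.
    - left. apply Rinv_0_lt_compat. lra.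
    - unfold C1. generalize (Hg x); intros; nra.
    - apply Rinv_le_contravar; assumption. }
  assert (HC1 : 0 < C1) by (unfold C1; lra).
  (* The inhomogeneity is a sum of two products of a potential part, at most 2 M times the weight,
     and a solution part, at most 4 C1. *)
  exists (16 * M * C1 * (exp (Rabs lam / eps) / eps)).
  split.
  { apply Rmult_le_pos; [nra|]. apply Rmult_le_pos; [left; apply exp_pos|left; now apply Rinv_0_lt_compat]. }
  intros x y Hy1 Hy2.
  assert (Hv : forall z, Rabs z <= Rabs y ->
    (Rabs (val_re pn qn x z) <= 4 * C1 /\ Rabs (val_im pn qn x z) <= 4 * C1 /\
     Rabs (val_re sn tn x z) <= 4 * C1 /\ Rabs (val_im sn tn x z) <= 4 * C1) /\
    Rabs (ext_re (fun k => An k x) z) <= 2 * (M * decay tau x) /\ Rabs (ext_im (fun k => An k x) z) <= 2 * (M * decay tau x)).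
  { intros z Hz.
    destruct (ext_bounds (fun k => pn k x) C1 (r / 2) z) as (p1 & p2 & _); [lra|lra|intros; apply Hb1|].
    destruct (ext_bounds (fun k => qn k x) C1 (r / 2) z) as (q1 & q2 & _); [lra|lra|intros; apply Hb1|].
    destruct (ext_bounds (fun k => sn k x) C1 (r / 2) z) as (s1 & s2 & _); [lra|lra|intros; apply Hb1|].
    destruct (ext_bounds (fun k => tn k x) C1 (r / 2) z) as (t1 & t2 & _); [lra|lra|intros; apply Hb1|].
    destruct (ext_bounds (fun k => An k x) (M * decay tau x) r z) as (a1 & a2 & _); [lra|lra|intros; apply HA|].
    unfold val_re, val_im, Rminus.
    repeat split; try assumption; (eapply Rle_trans; [apply Rabs_triang|]); rewrite ?Rabs_Ropp; lra. }
  assert (Hder : forall z, Rabs z <= Rabs y -> _) by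
    (intros z Hz; exact (extension_vertical An pn qn sn tn lam eps C1 (r / 2) x z Heps ltac:(lra) ltac:(lra) HT (fun n => HA1 n x) (fun n => Hb1 n x))).
  destruct (ext_at_0 (fun k => pn k x) C1 (r / 2) ltac:(lra) (fun n => proj1 (Hb1 n x))) as [p0 p0'].
  destruct (ext_at_0 (fun k => qn k x) C1 (r / 2) ltac:(lra) (fun n => proj1 (proj2 (Hb1 n x)))) as [q0 q0'].
  destruct (ext_at_0 (fun k => sn k x) C1 (r / 2) ltac:(lra) (fun n => proj1 (proj2 (proj2 (Hb1 n x))))) as [s0 s0'].
  destruct (ext_at_0 (fun k => tn k x) C1 (r / 2) ltac:(lra) (fun n => proj2 (proj2 (proj2 (Hb1 n x))))) as [t0 t0'].
  assert (Hp : forall a b c d, Rabs a <= 2 * (M * decay tau x) -> Rabs c <= 2 * (M * decay tau x) -> Rabs b <= 4 * C1 -> Rabs d <= 4 * C1 ->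
     Rabs (a * b + c * d) <= 16 * M * C1 * decay tau x).
  { intros a b c d h1 h2 h3 h4. eapply Rle_trans; [apply Rabs_triang|].
    generalize (Rabs_mult_le _ _ _ _ h1 h3) (Rabs_mult_le _ _ _ _ h2 h4). lra. }
  replace (16 * M * C1 * (exp (Rabs lam / eps) / eps) * decay tau x) with ((16 * M * C1 * decay tau x) * (exp (Rabs lam / eps) / eps)) by ring.
  split; [|split; [|split]].
  - replace (pn 0%nat x) with (val_re pn qn x 0) by (unfold val_re; rewrite p0, q0'; ring).
    apply (linear_ode_bound (val_re pn qn x) (fun z => - (ext_re (fun k => An k x) z * val_im sn tn x z + ext_im (fun k => An k x) z * val_re sn tn x z))); [assumption|assumption|].
    intros z Hz. destruct (Hv z Hz) as ((b1 & b2 & b3 & b4) & a1 & a2). split.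
    + apply (is_derive_eq _ _ _ _ (proj1 (Hder z Hz))). eq_in_R. unfold Rdiv. ring.
    + rewrite Rabs_Ropp. now apply Hp.
  - replace (qn 0%nat x) with (val_im pn qn x 0) by (unfold val_im; rewrite p0', q0; ring).
    apply (linear_ode_bound (val_im pn qn x) (fun z => ext_re (fun k => An k x) z * val_re sn tn x z + ext_im (fun k => An k x) z * - val_im sn tn x z)); [assumption|assumption|].
    intros z Hz. destruct (Hv z Hz) as ((b1 & b2 & b3 & b4) & a1 & a2). split.
    + apply (is_derive_eq _ _ _ _ (proj1 (proj2 (Hder z Hz)))). eq_in_R. unfold Rdiv. ring.
    + apply Hp; rewrite ?Rabs_Ropp; assumption.
  - replace (sn 0%nat x) with (val_re sn tn x 0) by (unfold val_re; rewrite s0, t0'; ring).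
    replace (lam / eps * y) with (- (- lam / eps * y)) by (unfold Rdiv; ring).
    rewrite <- (Rabs_Ropp lam).
    apply (linear_ode_bound (val_re sn tn x) (fun z => ext_re (fun k => An k x) z * val_im pn qn x z + ext_im (fun k => An k x) z * val_re pn qn x z)); [assumption|assumption|].
    intros z Hz. destruct (Hv z Hz) as ((b1 & b2 & b3 & b4) & a1 & a2). split.
    + apply (is_derive_eq _ _ _ _ (proj1 (proj2 (proj2 (Hder z Hz))))). eq_in_R. unfold Rdiv. ring.
    + now apply Hp.
  - replace (tn 0%nat x) with (val_im sn tn x 0) by (unfold val_im; rewrite s0', t0; ring).
    replace (lam / eps * y) with (- (- lam / eps * y)) by (unfold Rdiv; ring).
    rewrite <- (Rabs_Ropp lam).
    apply (linear_ode_bound (val_im sn tn x) (fun z => - (ext_re (fun k => An k x) z * val_re pn qn x z + ext_im (fun k => An k x) z * - val_im pn qn x z))); [assumption|assumption|].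
    intros z Hz. destruct (Hv z Hz) as ((b1 & b2 & b3 & b4) & a1 & a2). split.
    + apply (is_derive_eq _ _ _ _ (proj2 (proj2 (proj2 (Hder z Hz))))). eq_in_R. unfold Rdiv. ring.
    + rewrite Rabs_Ropp. apply Hp; rewrite ?Rabs_Ropp; assumption.
Qed.

Lemma decay_vanishes tau e : 0 < tau -> 0 < e -> forall x, / e < Rabs x -> decay tau x < e.
Proof.
  intros Ht He x Hx.
  assert (Hp := Rabs_pos x).
  apply Rle_lt_trans with (/ (1 + Rabs x)).
  - unfold decay, Rpower. rewrite <- (exp_ln (1 + Rabs x)) at 2 by lra. rewrite <- exp_Ropp. apply exp_le_mono.
    assert (0 <= ln (1 + Rabs x)) by (rewrite <- ln_1; apply ln_le; lra). nra.
  - rewrite <- (Rinv_inv e). assert (0 < / e) by (apply Rinv_0_lt_compat; lra).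
    apply Rinv_lt_contravar; [apply Rmult_lt_0_compat; lra|lra].
Qed.

Lemma sum_sqr_upper a b th ph k : Rabs th <= k -> Rabs ph <= k ->
  (a + th) ^ 2 + (b + ph) ^ 2 <= 2 * (a ^ 2 + b ^ 2) + 4 * k ^ 2.
Proof.
  intros H1 H2. apply Rabs_le_between in H1. apply Rabs_le_between in H2.
  generalize (pow2_ge_0 (a - th)) (pow2_ge_0 (b - ph)). nra.
Qed.

Lemma sum_sqr_lower a b th ph k : Rabs th <= k -> Rabs ph <= k ->
  (a ^ 2 + b ^ 2) / 2 - 2 * k ^ 2 <= (a + th) ^ 2 + (b + ph) ^ 2.
Proof.
  intros H1 H2. apply Rabs_le_between in H1. apply Rabs_le_between in H2.
  generalize (pow2_ge_0 (a + 2 * th)) (pow2_ge_0 (b + 2 * ph)). nra.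
Qed.

(** The last conclusion compares the conserved |u|^2 at the two ends: it tends to 1 at -oo and is at
    most |a|^2 + |b|^2 in the limit at +oo. This is the direction that keeps |a| away from 0. *)
Lemma transmission_reflection_norms A eps lam (frp frm flp : R -> Cx * Cx) (a b : Cx) :
  0 < eps -> ZS_solution A eps lam flp ->
  asymp_plus frp (jost_plus eps lam) -> asymp_plus frm (jost_minus eps lam) ->
  asymp_minus flp (jost_plus eps lam) ->
  (forall x, flp x = (Cadd (Cmul a (fst (frp x))) (Cmul b (fst (frm x))),
                      Cadd (Cmul a (snd (frp x))) (Cmul b (snd (frm x))))) ->
  (forall e, 0 < e -> exists X, forall x, X <= x ->
     Cmod b - e <= Cmod (fst (flp x)) <= Cmod b + e /\ Cmod (snd (flp x)) <= Cmod a + e) /\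
  (forall e, 0 < e -> exists X, forall x, x <= X ->
     Cmod (fst (flp x)) <= e /\ 1 - e <= Cmod (snd (flp x)) <= 1 + e) /\
  1 <= Cmod a ^ 2 + Cmod b ^ 2.
Proof.
  intros Heps Hsol Hp Hm Hl Hrel.
  assert (Ca := Cmod_pos a). assert (Cb := Cmod_pos b).
  assert (Hplus : forall e, 0 < e -> exists X, forall x, X <= x ->
     Cmod b - e <= Cmod (fst (flp x)) <= Cmod b + e /\ Cmod (snd (flp x)) <= Cmod a + e).
  { intros e He. set (k := e / (2 * (Cmod a + Cmod b + 1))).
    assert (Hk : 0 < k) by (apply Rdiv_lt_0_compat; lra).
    assert (Ek : (Cmod a + Cmod b + 1) * k = e / 2) by (unfold k; field; lra).
    destruct (Hp k Hk) as [X1 H1]. destruct (Hm k Hk) as [X2 H2].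
    exists (Rmax X1 X2). intros x Hx.
    destruct (H1 x) as [h1 h2]; [eapply Rle_trans; [apply Rmax_l|exact Hx]|].
    destruct (H2 x) as [h3 h4]; [eapply Rle_trans; [apply Rmax_r|exact Hx]|].
    (* In each component one Jost solution tends to 0 and the other to a unimodular phase; [near] is
       applied with the roles of a and b exchanged for the second component. *)
    unfold jost_plus, jost_minus in h1, h2, h3, h4; simpl fst in h1, h3; simpl snd in h2, h4.
    rewrite Hrel; simpl fst; simpl snd.
    assert (near : forall c1 c2 w1 w2 v, Cmod (Csub w1 C0) < k -> Cmod (Csub w2 v) < k -> Cmod c1 + Cmod c2 <= Cmod a + Cmod b ->
      Cmod (Csub (Cadd (Cmul c1 w1) (Cmul c2 w2)) (Cmul c2 v)) < e).
    { intros c1 c2 w1 w2 v q1 q2 q3.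
      replace (Csub (Cadd (Cmul c1 w1) (Cmul c2 w2)) (Cmul c2 v)) with (Cadd (Cmul c1 (Csub w1 C0)) (Cmul c2 (Csub w2 v))).
      2:{ destruct c1, c2, w1, w2, v. unfold Csub, Cadd, Cmul, Copp, C0, RtoC; simpl. f_equal; ring. }
      eapply Rle_lt_trans; [apply Cmod_add|]. rewrite !Cmod_mul.
      assert (Cmod c1 * Cmod (Csub w1 C0) <= Cmod c1 * k) by (apply Rmult_le_compat_l; [apply Cmod_pos|lra]).
      assert (Cmod c2 * Cmod (Csub w2 v) <= Cmod c2 * k) by (apply Rmult_le_compat_l; [apply Cmod_pos|lra]).
      assert ((Cmod c1 + Cmod c2) * k <= (Cmod a + Cmod b) * k) by (apply Rmult_le_compat_r; lra). lra. }
    assert (n1 := Cmod_near _ _ _ (near a b _ _ _ h1 h3 ltac:(lra))).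
    rewrite Cmod_mul, Cmod_expi, Rmult_1_r in n1.
    assert (n2 := Cmod_near _ _ _ (near b a _ _ _ h4 h2 ltac:(lra))).
    rewrite Cmod_mul, Cmod_expi, Rmult_1_r in n2.
    replace (Cadd (Cmul a (snd (frp x))) (Cmul b (snd (frm x)))) with (Cadd (Cmul b (snd (frm x))) (Cmul a (snd (frp x)))).
    2:{ unfold Cadd; simpl. f_equal; ring. }
    lra. }
  assert (Hminus : forall e, 0 < e -> exists X, forall x, x <= X ->
     Cmod (fst (flp x)) <= e /\ 1 - e <= Cmod (snd (flp x)) <= 1 + e).
  { intros e He. destruct (Hl e He) as [X H]. exists X. intros x Hx. destruct (H x Hx) as [h1 h2].
    unfold jost_plus in h1, h2; simpl fst in h1; simpl snd in h2.
    apply Cmod_near in h1. apply Cmod_near in h2. rewrite Cmod_expi in h2.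
    replace (Cmod C0) with 0 in h1. { lra. }
    unfold Cmod, C0, RtoC; simpl. rewrite !Rmult_0_l, Rplus_0_r. symmetry. apply sqrt_0. }
  split; [exact Hplus|]. split; [exact Hminus|].
  assert (Hcons := ode4_conserved _ _ _ _ _ _ _ Heps (ZS_ode4 A eps lam flp Heps Hsol)).
  set (c0 := Cre (fst (flp 0)) ^ 2 + Cim (fst (flp 0)) ^ 2 + Cre (snd (flp 0)) ^ 2 + Cim (snd (flp 0)) ^ 2) in *.
  assert (Hc : forall x, Cmod (fst (flp x)) ^ 2 + Cmod (snd (flp x)) ^ 2 = c0).
  { intros x. rewrite !Cmod_sqr, <- (Hcons x). ring. }
  apply Rle_trans with c0.
  - apply le_epsilon. intros e He. set (k := Rmin 1 (e / 2)).
    assert (Hk : 0 < k <= 1 /\ k <= e / 2) by (unfold k; repeat split; [apply Rmin_glb_lt; lra|apply Rmin_l|apply Rmin_r]).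
    destruct (Hminus k) as [X H]; [lra|]. destruct (H X (Rle_refl X)) as [h1 h2].
    rewrite <- (Hc X). generalize (pow2_ge_0 (Cmod (fst (flp X)))). nra.
  (* For k <= 1, (|a| + k)^2 + (|b| + k)^2 exceeds |a|^2 + |b|^2 by at most 2 k (|a| + |b| + 1). *)
  - apply le_epsilon. intros e He. set (k := Rmin 1 (e / (2 * (Cmod a + Cmod b + 1)))).
    assert (Hk : 0 < k <= 1 /\ k <= e / (2 * (Cmod a + Cmod b + 1))).
    { unfold k; repeat split; [apply Rmin_glb_lt; [lra|apply Rdiv_lt_0_compat; lra]|apply Rmin_l|apply Rmin_r]. }
    assert (Hke : k * (2 * (Cmod a + Cmod b + 1)) <= e).
    { apply Rle_trans with (e / (2 * (Cmod a + Cmod b + 1)) * (2 * (Cmod a + Cmod b + 1))); [apply Rmult_le_compat_r; lra|].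
      right. field. lra. }
    destruct (Hplus k) as [X H]; [lra|]. destruct (H X (Rle_refl X)) as [h1 h2].
    rewrite <- (Hc X).
    assert (Cmod (fst (flp X)) ^ 2 <= (Cmod b + k) ^ 2) by (apply pow_incr; split; [apply Cmod_pos|lra]).
    assert (Cmod (snd (flp X)) ^ 2 <= (Cmod a + k) ^ 2) by (apply pow_incr; split; [apply Cmod_pos|lra]).
    nra.
Qed.

(** * Exponential smallness of b *)

Lemma reflection_bound (A : R -> R) (delta : R) : assumption_A1 A -> 0 < delta ->
  exists K y0, 0 < K /\ 0 < y0 /\
  forall eps lam (frp frm flp : R -> Cx * Cx) (a b : Cx), 0 < eps -> delta <= Rabs lam ->
    ZS_solution A eps lam flp ->
    asymp_plus frp (jost_plus eps lam) -> asymp_plus frm (jost_minus eps lam) ->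
    asymp_minus flp (jost_plus eps lam) ->
    (forall x, flp x = (Cadd (Cmul a (fst (frp x))) (Cmul b (fst (frm x))),
                        Cadd (Cmul a (snd (frp x))) (Cmul b (snd (frm x))))) ->
    Cmod b ^ 2 <= K * exp (- (delta * y0 / eps)).
Proof.
  intros HA Hdel.
  destruct (A1_taylor A HA) as (An & r & M & tau & Hr & HM & Htau & HA0 & HdA & HbA).
  destruct (energy_growth An r M tau delta Hr HM Htau Hdel HdA HbA) as (K & ymax & HK & Hymax & Hyr & Hgrow).
  (* The bound K y0 <= delta makes the loss K y0^2 / eps at most |lam| y0 / eps, the [T] below. *)
  set (y0 := Rmin ymax (Rmin 1 (delta / K))).
  assert (Hy0 : 0 < y0 <= ymax /\ y0 <= 1 /\ K * y0 <= delta).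
  { unfold y0. split; [split; [repeat apply Rmin_glb_lt; try lra; apply Rdiv_lt_0_compat; lra|apply Rmin_l]|]. split.
    - eapply Rle_trans; [apply Rmin_r|apply Rmin_l].
    - apply Rle_trans with (K * (delta / K)); [|right; field; lra]. apply Rmult_le_compat_l; [lra|].
      eapply Rle_trans; [apply Rmin_r|apply Rmin_r]. }
  clearbody y0.
  (* 288 = 16 * 3 * 6: the 16 and the 6 come from the right and the left end of the curve, the 3
     from the comparison of the energy with the norm. *)
  exists (288 * exp K), y0. split; [generalize (exp_pos K); lra|]. split; [lra|].
  intros eps lam frp frm flp a b Heps Hlam Hsol Hp Hm Hl Hrel.
  destruct (transmission_reflection_norms A eps lam frp frm flp a b Heps Hsol Hp Hm Hl Hrel) as (Hplus & Hminus & _).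
  set (T := Rabs lam * y0 / eps).
  assert (Hie : 0 < / eps) by (apply Rinv_0_lt_compat; lra).
  assert (HT : delta * y0 / eps <= T).
  { unfold T, Rdiv. apply Rmult_le_compat_r; [lra|]. apply Rmult_le_compat_r; lra. }
  assert (HT0 : 0 < T) by (unfold T; apply Rdiv_lt_0_compat; [apply Rmult_lt_0_compat; lra|lra]).
  assert (Hconv : Cmod b ^ 2 <= 288 * exp K * exp (- T) -> Cmod b ^ 2 <= 288 * exp K * exp (- (delta * y0 / eps))).
  { intros h. eapply Rle_trans; [exact h|]. apply Rmult_le_compat_l; [generalize (exp_pos K); lra|].
    apply exp_le_mono. lra. }
  apply Hconv. clear Hconv.
  (* The tolerances at +oo are fractions of |b| and must be positive. *)
  destruct (Req_dec (Cmod b) 0) as [Hb0|Hb0].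
  { rewrite Hb0. replace (0 ^ 2) with 0 by ring. generalize (Rmult_lt_0_compat _ _ (exp_pos K) (exp_pos (- T))). lra. }
  assert (Hbpos : 0 < Cmod b) by (generalize (Cmod_pos b); lra).
  assert (Hode : ode4 (An 0%nat) (fun x => Cre (fst (flp x))) (fun x => Cim (fst (flp x)))
         (fun x => Cre (snd (flp x))) (fun x => Cim (snd (flp x))) lam eps).
  { intros x. rewrite HA0. apply (ZS_ode4 A eps lam flp Heps Hsol). }
  destruct (taylor4_exists An _ _ _ _ lam eps Heps HdA Hode) as (pn & qn & sn & tn & Ep & Eq & Es & Et & HTay).
  assert (Hcons := ode4_conserved _ _ _ _ _ _ _ Heps Hode). cbv beta in Hcons.
  set (c0 := Cre (fst (flp 0)) ^ 2 + Cim (fst (flp 0)) ^ 2 + Cre (snd (flp 0)) ^ 2 + Cim (snd (flp 0)) ^ 2) in *.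
  assert (Hg : forall x, 0 < decay tau x <= 1) by (intros x; split; [apply decay_pos|now apply decay_le_1]).
  assert (HbA' : forall n x, Rabs (An n x) <= M / r ^ n).
  { intros n x. eapply Rle_trans; [apply HbA|]. apply Rmult_le_compat_r; [left; apply Rinv_0_lt_compat, pow_lt; lra|].
    generalize (Hg x); intros; nra. }
  destruct (taylor4_bound An pn qn sn tn lam eps M r Heps HM Hr HbA' HTay) as (C & HC & HCb).
  assert (Hc0 : 0 <= c0).
  { unfold c0. generalize (pow2_ge_0 (Cre (fst (flp 0)))) (pow2_ge_0 (Cim (fst (flp 0)))) (pow2_ge_0 (Cre (snd (flp 0)))) (pow2_ge_0 (Cim (snd (flp 0)))). lra. }
  (* Each of the four components has square at most c0, hence modulus at most c0 + 1. *)
  set (C1 := C * (4 * (c0 + 1))).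
  assert (HC1 : 0 <= C1) by (unfold C1; apply Rmult_le_pos; lra).
  assert (Hb1 : forall n x, Rabs (pn n x) <= C1 / (r / 2) ^ n /\ Rabs (qn n x) <= C1 / (r / 2) ^ n /\
             Rabs (sn n x) <= C1 / (r / 2) ^ n /\ Rabs (tn n x) <= C1 / (r / 2) ^ n).
  { intros n x. specialize (HCb n x). rewrite Ep, Eq, Es, Et in HCb.
    assert (sm : forall u, u ^ 2 <= c0 -> Rabs u <= c0 + 1).
    { intros u Hu. apply Rabs_le. split; nra. }
    specialize (Hcons x).
    assert (g1 := pow2_ge_0 (Cre (fst (flp x)))). assert (g2 := pow2_ge_0 (Cim (fst (flp x)))).
    assert (g3 := pow2_ge_0 (Cre (snd (flp x)))). assert (g4 := pow2_ge_0 (Cim (snd (flp x)))).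
    assert (s1 := sm (Cre (fst (flp x))) ltac:(lra)). assert (s2 := sm (Cim (fst (flp x))) ltac:(lra)).
    assert (s3 := sm (Cre (snd (flp x))) ltac:(lra)). assert (s4 := sm (Cim (snd (flp x))) ltac:(lra)).
    assert (h : C * (Rabs (Cre (fst (flp x))) + Rabs (Cim (fst (flp x))) + Rabs (Cre (snd (flp x))) + Rabs (Cim (snd (flp x)))) / (r / 2) ^ n <= C1 / (r / 2) ^ n).
    { apply Rmult_le_compat_r; [left; apply Rinv_0_lt_compat, pow_lt; lra|]. unfold C1. apply Rmult_le_compat_l; lra. }
    generalize (Rabs_pos (pn n x)) (Rabs_pos (qn n x)) (Rabs_pos (sn n x)) (Rabs_pos (tn n x)).
    intros. repeat split; lra. }
  destruct (extension_free An pn qn sn tn lam eps M r tau C1 Heps Hr HM HC1 Htau HTay HbA Hb1) as (D & HD & Hfree).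
  set (y := fun x => y0 * (lam * inv_mu lam (An 0%nat x))).
  specialize (Hgrow y0 eps lam pn qn sn tn C1 ltac:(lra) Heps Hlam HC1 HTay Hb1). fold y in Hgrow. cbv zeta in Hgrow.
  assert (Hy : forall x, Rabs (y x) <= y0).
  { intros x. unfold y. replace y0 with (y0 * 1) at 2 by ring.
    apply Rabs_mult_le; [rewrite Rabs_pos_eq; lra|]. now apply (inv_mu_facts lam _ delta). }
  (* Where |A| <= |lam|, mu is at most sqrt 2 |lam|, so |lam| / mu >= 1 / 2. The crude T / 2
     replaces the limit T: the two ends gain 2 T together, and the growth estimate loses at most
     T. *)
  assert (Hlow : forall x, M * decay tau x <= delta -> T / 2 <= lam / eps * y x).
  { intros x Hx. destruct (inv_mu_facts lam (An 0%nat x) delta Hdel Hlam) as (w1 & w2 & w3 & w4).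
    unfold y. set (w := inv_mu lam (An 0%nat x)) in *.
    assert (hA : Rabs (An 0%nat x) <= Rabs lam) by (generalize (HbA 0%nat x); simpl; intros; lra).
    assert (hA2 : An 0%nat x ^ 2 <= Rabs lam ^ 2) by (rewrite <- pow2_abs; apply pow_incr; split; [apply Rabs_pos|assumption]).
    rewrite <- (pow2_abs lam) in w2.
    assert (h : 1 / 2 <= Rabs lam * w).
    { apply Rnot_lt_le. intros hn. assert (0 <= Rabs lam * w) by (apply Rmult_le_pos; [apply Rabs_pos|lra]). nra. }
    replace (lam / eps * (y0 * (lam * w))) with (Rabs lam * y0 / eps * (Rabs lam * w)).
    - fold T. nra.
    - unfold Rdiv. replace (lam * / eps * (y0 * (lam * w))) with (lam ^ 2 * / eps * y0 * w) by ring. rewrite <- (pow2_abs lam). ring. }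
  assert (Hup : forall x, lam / eps * y x <= T).
  { intros x. unfold T. replace (lam / eps * y x) with (lam * y x * / eps) by (unfold Rdiv; ring).
    apply Rmult_le_compat_r; [lra|]. eapply Rle_trans; [apply Rle_abs|]. rewrite Rabs_mult.
    apply Rmult_le_compat_l; [apply Rabs_pos|apply Hy]. }
  assert (Hfar : forall e, 0 < e -> exists X, 0 < X /\ forall x, X < Rabs x -> M * decay tau x <= delta /\ D * decay tau x <= e).
  { intros e He. set (k := Rmin (delta / M) (e / (D + 1))).
    assert (Hk : 0 < k) by (unfold k; apply Rmin_glb_lt; apply Rdiv_lt_0_compat; lra).
    exists (/ k). split; [now apply Rinv_0_lt_compat|]. intros x Hx.
    assert (h := decay_vanishes tau k Htau Hk x Hx). split.
    - apply Rle_trans with (M * (delta / M)); [|right; field; lra]. apply Rmult_le_compat_l; [lra|].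
      generalize (Rmin_l (delta / M) (e / (D + 1))). fold k. lra.
    - apply Rle_trans with ((D + 1) * (e / (D + 1))); [|right; field; lra].
      generalize (Rmin_r (delta / M) (e / (D + 1))) (Hg x). fold k. intros.
      apply Rmult_le_compat; lra. }
  (* On the curve v1 = e^h (u1 + O(k)) and v2 = e^(-h) (u2 + O(k)), with u1 and u2 the values on the
     real axis. *)
  assert (Hval : forall x, let h := lam / eps * y x in let k := D * decay tau x in
     exp (2 * h) * ((Cmod (fst (flp x)) ^ 2) / 2 - 2 * k ^ 2) <= norm2 pn qn sn tn x (y x) /\
     norm2 pn qn sn tn x (y x) <= exp (2 * h) * (2 * Cmod (fst (flp x)) ^ 2 + 4 * k ^ 2)
        + exp (- (2 * h)) * (2 * Cmod (snd (flp x)) ^ 2 + 4 * k ^ 2)).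
  { intros x h k.
    destruct (Hfree x (y x)) as (f1 & f2 & f3 & f4); [generalize (Hy x); lra|generalize (Hy x); lra|].
    rewrite Ep in f1. rewrite Eq in f2. rewrite Es in f3. rewrite Et in f4. fold h k in f1, f2, f3, f4.
    rewrite !Cmod_sqr.
    assert (u1 := sum_sqr_upper (Cre (fst (flp x))) (Cim (fst (flp x))) _ _ _ f1 f2).
    assert (l1 := sum_sqr_lower (Cre (fst (flp x))) (Cim (fst (flp x))) _ _ _ f1 f2).
    assert (u2 := sum_sqr_upper (Cre (snd (flp x))) (Cim (snd (flp x))) _ _ _ f3 f4).
    replace (Cre (fst (flp x)) + (val_re pn qn x (y x) * exp (- h) - Cre (fst (flp x)))) with (val_re pn qn x (y x) * exp (- h)) in u1, l1 by ring.
    replace (Cim (fst (flp x)) + (val_im pn qn x (y x) * exp (- h) - Cim (fst (flp x)))) with (val_im pn qn x (y x) * exp (- h)) in u1, l1 by ring.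
    replace (Cre (snd (flp x)) + (val_re sn tn x (y x) * exp h - Cre (snd (flp x)))) with (val_re sn tn x (y x) * exp h) in u2 by ring.
    replace (Cim (snd (flp x)) + (val_im sn tn x (y x) * exp h - Cim (snd (flp x)))) with (val_im sn tn x (y x) * exp h) in u2 by ring.
    rewrite !Rpow_mult_distr in u1, l1, u2.
    replace (2 * h) with (h + h) by ring. rewrite exp_Ropp in *. rewrite exp_plus.
    assert (eh := exp_pos h). set (e := exp h) in *.
    assert (ie : / (e * e) * e ^ 2 = 1) by (field; lra).
    assert (ie2 : e * e * (/ e) ^ 2 = 1) by (field; lra).
    assert (hp : 0 < e * e) by nra. assert (hp2 : 0 < / (e * e)) by (now apply Rinv_0_lt_compat).
    unfold norm2.
    set (v1 := val_re pn qn x (y x)) in *. set (v2 := val_im pn qn x (y x)) in *.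
    set (v3 := val_re sn tn x (y x)) in *. set (v4 := val_im sn tn x (y x)) in *.
    apply Rmult_le_compat_l with (r := e * e) in u1; [|lra]. apply Rmult_le_compat_l with (r := e * e) in l1; [|lra].
    apply Rmult_le_compat_l with (r := / (e * e)) in u2; [|lra].
    replace (e * e * (v1 ^ 2 * (/ e) ^ 2 + v2 ^ 2 * (/ e) ^ 2)) with (v1 * v1 + v2 * v2) in u1, l1 by (field; lra).
    replace (/ (e * e) * (v3 ^ 2 * e ^ 2 + v4 ^ 2 * e ^ 2)) with (v3 * v3 + v4 * v4) in u2 by (field; lra).
    generalize (Rle_0_sqr v3) (Rle_0_sqr v4). unfold Rsqr. intros. split; lra. }
  (* At the left end v1 is amplified by up to e^(2 T) in square; the tolerance e^(-3 T) / 6 reduces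
     its contribution to e^(-T), the size of the damped v2. *)
  set (k1 := Rmin (1 / 4) (exp (- (3 * T)) / 6)).
  assert (Hk1 : 0 < k1 <= 1 / 4 /\ k1 <= exp (- (3 * T)) / 6).
  { unfold k1. generalize (exp_pos (- (3 * T))). intros. repeat split; [apply Rmin_glb_lt; lra|apply Rmin_l|apply Rmin_r]. }
  assert (Hx1 : exists x1, x1 <= 0 /\ norm2 pn qn sn tn x1 (y x1) <= 6 * exp (- T)).
  { destruct (Hminus k1) as [X1 HX1]; [lra|]. destruct (Hfar k1) as (X2 & HX2 & HX2'); [lra|].
    set (x1 := Rmin X1 (- (X2 + 1))). exists x1.
    assert (m1 : x1 <= X1) by apply Rmin_l. assert (m2 : x1 <= - (X2 + 1)) by apply Rmin_r.
    split; [lra|]. destruct (HX1 x1 m1) as [b1 b2].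
    destruct (HX2' x1) as [b3 b4]; [rewrite Rabs_left; lra|].
    destruct (Hval x1) as [_ V]. cbv zeta in V. eapply Rle_trans; [exact V|].
    assert (kp : 0 <= D * decay tau x1) by (apply Rmult_le_pos; [lra|generalize (Hg x1); lra]).
    assert (q1 : 2 * Cmod (fst (flp x1)) ^ 2 + 4 * (D * decay tau x1) ^ 2 <= exp (- (3 * T))).
    { generalize (Cmod_pos (fst (flp x1))). intros. nra. }
    assert (q2 : 2 * Cmod (snd (flp x1)) ^ 2 + 4 * (D * decay tau x1) ^ 2 <= 5).
    { generalize (Cmod_pos (snd (flp x1))). intros. nra. }
    assert (t1 : exp (2 * (lam / eps * y x1)) <= exp (2 * T)) by (apply exp_le_mono; generalize (Hup x1); lra).
    assert (t2 : exp (- (2 * (lam / eps * y x1))) <= exp (- T)) by (apply exp_le_mono; generalize (Hlow x1 b3); lra).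
    assert (t3 : exp (2 * T) * exp (- (3 * T)) = exp (- T)) by (rewrite <- exp_plus; f_equal; ring).
    assert (p1 : 0 <= 2 * Cmod (fst (flp x1)) ^ 2 + 4 * (D * decay tau x1) ^ 2) by (generalize (pow2_ge_0 (Cmod (fst (flp x1)))) (pow2_ge_0 (D * decay tau x1)); lra).
    assert (p2 : 0 <= 2 * Cmod (snd (flp x1)) ^ 2 + 4 * (D * decay tau x1) ^ 2) by (generalize (pow2_ge_0 (Cmod (snd (flp x1)))) (pow2_ge_0 (D * decay tau x1)); lra).
    assert (r1 := Rmult_le_compat _ _ _ _ (Rlt_le _ _ (exp_pos _)) p1 t1 q1).
    assert (r2 := Rmult_le_compat _ _ _ _ (Rlt_le _ _ (exp_pos _)) p2 t2 q2). lra. }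
  assert (Hx2 : exists x2, 0 <= x2 /\ exp T * (Cmod b ^ 2 / 16) <= norm2 pn qn sn tn x2 (y x2)).
  (* These fractions give |b|^2 / 8 - |b|^2 / 32, which is at least |b|^2 / 16. *)
  { destruct (Hplus (Cmod b / 2)) as [X1 HX1]; [lra|]. destruct (Hfar (Cmod b / 8)) as (X2 & HX2 & HX2'); [lra|].
    set (x2 := Rmax X1 (X2 + 1)). exists x2.
    assert (m1 : X1 <= x2) by apply Rmax_l. assert (m2 : X2 + 1 <= x2) by apply Rmax_r.
    split; [lra|]. destruct (HX1 x2 m1) as [b1 _].
    destruct (HX2' x2) as [b3 b4]; [rewrite Rabs_pos_eq; lra|].
    destruct (Hval x2) as [V _]. cbv zeta in V. eapply Rle_trans; [|exact V].
    assert (kp : 0 <= D * decay tau x2) by (apply Rmult_le_pos; [lra|generalize (Hg x2); lra]).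
    apply Rmult_le_compat; [left; apply exp_pos| |apply exp_le_mono; generalize (Hlow x2 b3); lra|].
    - generalize (pow2_ge_0 (Cmod b)). lra.
    - nra. }
  destruct Hx1 as (x1 & Hx1 & N1). destruct Hx2 as (x2 & Hx2 & N2).
  assert (G := Hgrow x1 x2 (conj Hx1 Hx2)).
  assert (Hexp : exp (K + K * y0 ^ 2 / eps) <= exp K * exp T).
  { rewrite <- exp_plus. apply exp_le_mono. apply Rplus_le_compat_l. unfold T, Rdiv. apply Rmult_le_compat_r; [lra|].
    replace (K * y0 ^ 2) with ((K * y0) * y0) by ring. apply Rmult_le_compat_r; lra. }
  assert (eK := exp_pos K). assert (eT := exp_pos T). assert (emT := exp_pos (- T)).
  assert (eTT : exp (- T) * exp T = 1) by (rewrite <- exp_plus, Rplus_opp_l; apply exp_0).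
  assert (F : exp T * (Cmod b ^ 2 / 16) <= 3 * (6 * exp (- T)) * (exp K * exp T)).
  { eapply Rle_trans; [exact N2|]. eapply Rle_trans; [exact G|].
    apply Rmult_le_compat; [| left; apply exp_pos | lra | exact Hexp].
    assert (0 <= norm2 pn qn sn tn x1 (y x1)).
    { unfold norm2. generalize (Rle_0_sqr (val_re pn qn x1 (y x1))) (Rle_0_sqr (val_im pn qn x1 (y x1))) (Rle_0_sqr (val_re sn tn x1 (y x1))) (Rle_0_sqr (val_im sn tn x1 (y x1))). unfold Rsqr. lra. }
    lra. }
  apply Rmult_le_compat_l with (r := 16 * exp (- T)) in F; [|lra].
  replace (16 * exp (- T) * (exp T * (Cmod b ^ 2 / 16))) with ((exp (- T) * exp T) * Cmod b ^ 2) in F by field.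
  replace (16 * exp (- T) * (3 * (6 * exp (- T)) * (exp K * exp T))) with (288 * exp K * exp (- T) * (exp (- T) * exp T)) in F by ring.
  rewrite eTT in F. lra.
Qed.

Theorem theorem2p1 (A : R -> R) (HA : assumption_A1 A) :
  forall delta : R, 0 < delta ->
  exists sigma : R, 0 < sigma /\
  exists K eps0 : R, 0 < K /\ 0 < eps0 /\
  forall eps lam : R, 0 < eps < eps0 -> delta <= Rabs lam ->
  forall (frp frm flp : R -> Cx * Cx) (a b : Cx),
    ZS_solution A eps lam frp -> asymp_plus frp (jost_plus eps lam) ->
    ZS_solution A eps lam frm -> asymp_plus frm (jost_minus eps lam) ->
    ZS_solution A eps lam flp -> asymp_minus flp (jost_plus eps lam) ->
    (forall x, flp x = (Cadd (Cmul a (fst (frp x))) (Cmul b (fst (frm x))),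
                        Cadd (Cmul a (snd (frp x))) (Cmul b (snd (frm x))))) ->
    Cmod (Cdiv b a) <= K * exp (- sigma / eps).
Proof.
  intros delta Hdel.
  destruct (reflection_bound A delta HA Hdel) as (K & y0 & HK & Hy0 & H).
  (* Half of the exponent, since the bound is on |b|^2. *)
  set (sigma := delta * y0 / 2).
  assert (Hs : 0 < sigma) by (unfold sigma; generalize (Rmult_lt_0_compat _ _ Hdel Hy0); lra).
  exists sigma. split; [exact Hs|].
  set (K1 := sqrt K). assert (HK1 : 0 < K1) by (now apply sqrt_lt_R0).
  (* For eps below this value sigma / eps > 2 K1, and exp t > t then gives |b| <= 1 / 2; the 2 in
     the first constant is 1 / |a| at worst. *)
  exists (2 * K1), (sigma / (2 * K1)).
  split; [lra|]. split; [apply Rdiv_lt_0_compat; lra|].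
  intros eps lam Heps Hlam frp frm flp a b _ Hfrp _ Hfrm Hflp Hfl Hrel.
  assert (Hb := H eps lam frp frm flp a b ltac:(lra) Hlam Hflp Hfrp Hfrm Hfl Hrel).
  destruct (transmission_reflection_norms A eps lam frp frm flp a b ltac:(lra) Hflp Hfrp Hfrm Hfl Hrel) as (_ & _ & Hab).
  assert (Hb' : Cmod b <= K1 * exp (- sigma / eps)).
  { apply Rsqr_incr_0_var; [|apply Rmult_le_pos; [lra|left; apply exp_pos]]. unfold Rsqr.
    replace (K1 * exp (- sigma / eps) * (K1 * exp (- sigma / eps))) with (K * exp (- (delta * y0 / eps))); [simpl in Hb; lra|].
    replace (- (delta * y0 / eps)) with (- sigma / eps + - sigma / eps) by (unfold sigma; field; lra).
    rewrite exp_plus. rewrite <- (sqrt_sqrt K) at 1 by lra. fold K1. ring. }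
  assert (Hsmall : K1 * exp (- sigma / eps) <= 1 / 2).
  { replace (- sigma / eps) with (- (sigma / eps)) by (unfold Rdiv; ring). rewrite exp_Ropp.
    assert (hs : 2 * K1 < sigma / eps).
    { apply Rmult_lt_reg_r with eps; [lra|]. replace (sigma / eps * eps) with sigma by (field; lra).
      destruct Heps as [e1 e2]. apply Rmult_lt_compat_l with (r := 2 * K1) in e2; [|lra].
      replace (2 * K1 * (sigma / (2 * K1))) with sigma in e2 by (field; lra). exact e2. }
    assert (he : sigma / eps < exp (sigma / eps)) by (generalize (exp_ineq1 (sigma / eps) ltac:(lra)); lra).
    apply Rmult_le_reg_r with (exp (sigma / eps)); [apply exp_pos|].
    rewrite Rmult_assoc, Rinv_l by (generalize (exp_pos (sigma / eps)); lra). lra. }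
  (* From |a|^2 + |b|^2 >= 1 and |b| <= 1 / 2. In particular a is nonzero, so the total inverse is a
     genuine one. *)
  assert (Ha : / 2 <= Cmod a).
  { generalize (Cmod_pos a) (Cmod_pos b). intros. nra. }
  eapply Rle_trans; [now apply Cmod_div|]. lra.
Qed.
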